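(* Let $X$ be an integral normal projective scheme over a perfect field $k$ of characteristic $p>0$. Let $\Delta$ be a $\mathbb{Q}$-divisor on $X$ such that $\lfloor\Delta\rfloor=0$. Suppose that $(X,\Delta)$ is quasi-$F$-split and let $n$ be the minimal number for which $(X,\Delta)$ is $n$-quasi-$F$-split. Then \[ \kappa\Big(X,-\big(K_X+\tfrac{1}{p^n-1}\lfloor p^n\Delta\rfloor\big)\Big)\geq0. \]
   Context: For a $\mathbb{Q}$-divisor $D$ on $X$, $\kappa(X,D)$ is the Iitaka dimension; $\kappa(X,D)\geq0$ means $H^0(X,\mathcal{O}_X(\lfloor mD\rfloor))\neq0$ for some integer $m>0$. Quasi-$F$-splitting of pairs: let $X$ be an integral normal $F$-finite Noetherian $\mathbb{F}_p$-scheme with function field $K(X)$. For a $\mathbb{Q}$-divisor $D$ put $\mathcal{O}_X(D)=\mathcal{O}_X(\lfloor D\rfloor)$, and let $W_n\mathcal{O}_X(D)$ be the subsheaf of the constant sheaf $W_n(K(X))$ whose sections over $U$ are the Witt vectors $(\varphi_0,\dots,\varphi_{n-1})$ with $\varphi_i\in\Gamma(U,\mathcal{O}_X(p^iD))$ for all $i$; it is a $W_n\mathcal{O}_X$-module. There are a Frobenius $F\colon W_n\mathcal{O}_X(D)\to F_*W_n\mathcal{O}_X(pD)$ (componentwise $p$-th power) and a restriction $R^{n-1}\colon W_n\mathcal{O}_X(D)\to\mathcal{O}_X(D)$ (first component). If $\lfloor\Delta\rfloor=0$, then $(X,\Delta)$ is $n$-quasi-$F$-split if there is a $W_n\mathcal{O}_X$-module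 homomorphism $\alpha\colon F_*W_n\mathcal{O}_X(p\Delta)\to\mathcal{O}_X$ such that $\alpha\circ F=R^{n-1}\colon W_n\mathcal{O}_X(\Delta)\to\mathcal{O}_X(\Delta)=\mathcal{O}_X$. It is quasi-$F$-split if it is $n$-quasi-$F$-split for some $n\ge1$. *)

(* Defs.v *)
From HB Require Import structures.
From mathcomp Require Import all_boot all_order all_algebra.
From mathcomp Require Import boolp classical_sets cardinality topology.
From mathcomp Require mpoly.
(* The notations of mpoly are incompatible with those of topology. *)
Import (canonicals, coercions) mpoly.

Set Implicit Arguments.
Unset Strict Implicit.
Unset Printing Implicit Defensive.
Import Order.TTheory GRing.Theory Num.Theory.
Local Open Scope classical_set_scope.
Local Open Scope ring_scope.

(* On an integral scheme X every restriction map between nonempty opens is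
    injective, and so are the maps to the function field K = K(X).  The
    structure sheaf is therefore given as a subsheaf of the constant sheaf K:
    [sec U] is O_X(U), as a subset of K, for U open and nonempty.  The value
    of [sec] at the empty set and at non-open sets is never used. *)

Definition is_subring (K : fieldType) (A : set K) : Prop :=
  [/\ A 1, forall a b, A a -> A b -> A (a - b)
    & forall a b, A a -> A b -> A (a * b)].

Definition is_prime_ideal (K : fieldType) (A P : set K) : Prop :=
  [/\ P `<=` A, P 0 & ~ P 1] /\
  [/\ forall a b, P a -> P b -> P (a + b),
      forall a b, A a -> P b -> P (a * b)
    & forall a b, A a -> A b -> P (a * b) -> P a \/ P b].

Definition stalk_of (K : fieldType) (T : topologicalType)
    (O : set T -> set K) (x : T) : set K :=
  [set f | exists U, [/\ open U, U x & O U f]].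

Definition is_unit_in (K : fieldType) (A : set K) (f : K) : Prop :=
  [/\ f != 0, A f & A f^-1].

(* The elements of O(U) vanishing at x. *)
Definition vanishing_ideal (K : fieldType) (T : topologicalType)
    (O : set T -> set K) (U : set T) (x : T) : set K :=
  [set f | O U f /\ ~ is_unit_in (stalk_of O x) f].

Definition nonvanishing_locus (K : fieldType) (T : topologicalType)
    (O : set T -> set K) (U : set T) (f : K) : set T :=
  [set x | U x /\ is_unit_in (stalk_of O x) f].

(* (U, O|_U) is Spec O(U), through the canonical map sending x to its
   vanishing ideal, and K is the fraction field of O(U): the map is bijective,
   the sets D(f) form a base of the topology, and O(D(f)) = O(U)[1/f]. *)
Definition affine_open (K : fieldType) (T : topologicalType)
    (O : set T -> set K) (U : set T) : Prop :=
  [/\ open U, U !=set0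
    & forall f : K, exists a b, [/\ O U a, O U b, b != 0 & f = a / b]] /\
  [/\ (forall x, U x -> is_prime_ideal (O U) (vanishing_ideal O U x)) /\
      (forall P, is_prime_ideal (O U) P ->
         exists! x, U x /\ vanishing_ideal O U x = P),
      (forall f, O U f -> open (nonvanishing_locus O U f)) /\
      (forall V x, open V -> V `<=` U -> V x ->
         exists f, [/\ O U f, nonvanishing_locus O U f x
                     & nonvanishing_locus O U f `<=` V])
    & forall f, O U f -> f != 0 ->
        O (nonvanishing_locus O U f)
        = [set g | exists a i, O U a /\ g = a / f ^+ i]].

Record integralScheme (K : fieldType) := IntegralScheme {
  space :> topologicalType;
  sec : set space -> set K;
  space_nonempty : exists x : space, True;
  space_irreducible : forall U V : set space,
    open U -> open V -> U !=set0 -> V !=set0 -> U `&` V !=set0;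
  sec_subring : forall U : set space,
    open U -> U !=set0 -> is_subring (sec U);
  sec_sheaf : forall F : set (set space), F !=set0 ->
    (forall U, F U -> open U /\ U !=set0) ->
    sec (\bigcup_(U in F) U) = \bigcap_(U in F) sec U;
  locally_affine : forall x : space, exists2 U, affine_open sec U & U x }.

Definition stalk (K : fieldType) (X : integralScheme K) (x : X) : set K :=
  stalk_of (@sec K X) x.

Definition is_normal (K : fieldType) (X : integralScheme K) : Prop :=
  forall (x : X) (f : K) (P : {poly K}),
    P \is monic -> (forall i, stalk x P`_i) -> root P f -> stalk x f.

(* X is a closed subscheme of the projective space of dimension N over k.
   [s] is the image of the generic point of X, in homogeneous coordinates in
   K; the inverse image of the chart D_+(X_i) is empty if s_i = 0, and
   otherwise it is the set of x such that all s_j / s_i are in O_{X,x}.  The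
   morphism is a closed immersion if and only if these sets are affine and
   the maps k[X_j / X_i]_j -> O_X(U_i), X_j / X_i |-> s_j / s_i, are
   surjective.  In particular k, embedded in K by iota, is contained in every
   ring O_X(U): this is the k-scheme structure of X. *)
Definition proj_chart (K : fieldType) (X : integralScheme K) (N : nat)
    (s : 'I_N.+1 -> K) (i : 'I_N.+1) : set X :=
  [set x | s i != 0 /\ forall j, stalk x (s j / s i)].

Definition is_projective (k K : fieldType) (iota : {rmorphism k -> K})
    (X : integralScheme K) : Prop :=
  exists (N : nat) (s : 'I_N.+1 -> K),
    (forall x : X, exists i, proj_chart s i x) /\
    forall i, s i != 0 ->
      affine_open (@sec K X) (proj_chart s i) /\
      sec (proj_chart (X := X) s i)
      = [set f | exists q : mpoly.mpoly N.+1 k,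
                   f = mpoly.mmap iota (fun j => s j / s i) q].

(* x_0, ..., x_d with each point a proper specialization of the previous
   ones; as schemes are sober, this is a chain of d + 1 distinct irreducible
   closed subsets. *)
Definition is_chain (T : topologicalType) (d : nat) (c : 'I_d.+1 -> T) : Prop :=
  forall i j : 'I_d.+1, (i < j)%N ->
    closure [set c i] (c j) /\ ~ closure [set c j] (c i).

Definition has_dim (T : topologicalType) (d : nat) : Prop :=
  (exists c : 'I_d.+1 -> T, is_chain c) /\
  ~ (exists c : 'I_d.+2 -> T, is_chain c).

Definition has_codim (T : topologicalType) (x : T) (d : nat) : Prop :=
  (exists c : 'I_d.+1 -> T, is_chain c /\ c ord_max = x) /\
  ~ (exists c : 'I_d.+2 -> T, is_chain c /\ c ord_max = x).

(* Prime divisors are represented by their generic points. *)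
Definition is_prime_divisor (T : topologicalType) (x : T) : Prop :=
  has_codim x 1.

Definition is_uniformizer (K : fieldType) (X : integralScheme K) (x : X)
    (t : K) : Prop :=
  [/\ t != 0, stalk x t, ~ is_unit_in (stalk x) t
    & forall f, stalk x f -> ~ is_unit_in (stalk x) f -> stalk x (f / t)].

(* The normalized discrete valuation of O_{X,x}, for X normal and x of
   codimension one; it is only meaningful at f != 0. *)
Definition ord (K : fieldType) (X : integralScheme K) (x : X) (f : K) : int :=
  xget 0 [set n : int | exists t u, [/\ is_uniformizer x t,
                          is_unit_in (stalk x) u & f = u * t ^ n]].

(* A Q-divisor is a function on X vanishing outside the codimension one
   points, with finite support. *)
Definition is_Qdivisor (K : fieldType) (X : integralScheme K) (D : X -> rat) :
    Prop :=
  finite_set [set x | D x != 0] /\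
  forall x, D x != 0 -> is_prime_divisor x.

(* O_X(D)(U) = O_X(floor D)(U) as a subset of K, for U open and nonempty. *)
Definition div_sec (K : fieldType) (X : integralScheme K) (D : X -> rat)
    (U : set X) : set K :=
  [set f | f != 0 -> forall x, U x -> is_prime_divisor x ->
             0 <= ord x f + Num.floor (D x)].

Definition iitaka_dim_ge0 (K : fieldType) (X : integralScheme K)
    (D : X -> rat) : Prop :=
  exists m : nat, (0 < m)%N /\
    exists f : K, f != 0 /\ div_sec (fun x => m%:R * D x) setT f.

Definition is_derivation (k K : fieldType) (iota : {rmorphism k -> K})
    (D : K -> K) : Prop :=
  [/\ forall a b, D (a + b) = D a + D b,
      forall a b, D (a * b) = a * D b + b * D a
    & forall c, D (iota c) = 0].

(* Since K is finitely generated over k, the K-vector space of Kaehler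
   differentials Omega_{K/k} is finite dimensional with dual Der_k(K, K), and
   an element of its d-th exterior power is the same thing as the alternating
   form it defines on Der_k(K, K)^d; for example dt_1 /\ ... /\ dt_d maps
   (D_1, ..., D_d) to det (D_i t_j).  For a k-subalgebra A of K,
   [is_form_over iota A w] means that w is in the image of the d-th exterior
   power of Omega_{A/k}, that is, w is a finite sum of forms
   a dt_1 /\ ... /\ dt_d with a and the t_j in A. *)
Definition is_form_over (k K : fieldType) (iota : {rmorphism k -> K})
    (A : set K) (d : nat) (w : ('I_d -> K -> K) -> K) : Prop :=
  exists (m : nat) (a : 'I_m -> K) (t : 'I_m -> 'I_d -> K),
    [/\ forall l, A (a l), forall l j, A (t l j)
      & forall D : 'I_d -> K -> K, (forall i, is_derivation iota (D i)) ->
          w D = \sum_(l < m) a l * \det (\matrix_(i, j) D i (t l j))].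

(* For X normal over a perfect field and x of codimension one, O_{X,x} is
   smooth over k, so that the regular d-forms at x, d = dim X, are a free
   O_{X,x}-module of rank one; w has order n at x if this module consists of
   the g w with g = 0 or ord_x(g) >= - n. *)
Definition form_has_ord (k K : fieldType) (iota : {rmorphism k -> K})
    (X : integralScheme K) (d : nat) (w : ('I_d -> K -> K) -> K) (x : X)
    (n : int) : Prop :=
  forall g : K, g != 0 ->
    (is_form_over iota (stalk x) (fun D => g * w D) <-> 0 <= ord x g + n).

(* K_X is the divisor of a nonzero rational differential form of degree
   dim X. *)
Definition is_canonical_divisor (k K : fieldType) (iota : {rmorphism k -> K})
    (X : integralScheme K) (KX : X -> int) : Prop :=
  is_Qdivisor (fun x : X => (KX x)%:~R) /\
  exists (d : nat) (w : ('I_d -> K -> K) -> K),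
    [/\ has_dim X d, is_form_over iota setT w,
        exists D, (forall i, is_derivation iota (D i)) /\ w D != 0
      & forall x : X, is_prime_divisor x -> form_has_ord iota w x (KX x)].

Definition ghost (R : nzRingType) (p : nat) (z : nat -> R) (m : nat) : R :=
  \sum_(i < m.+1) (z i ^+ (p ^ (m - i))) *+ (p ^ i).

(* The polynomials S_0, ..., S_{m-1} over Q with ghost p S i = g i for all
   i < m. *)
Fixpoint unghost (N p : nat) (g : nat -> mpoly.mpoly N rat) (m : nat) :
    seq (mpoly.mpoly N rat) :=
  if m is m'.+1 then
    let s := unghost p g m' in
    rcons s ((p ^ m')%:R^-1 *:
      (g m' - \sum_(i < m') (s`_i ^+ (p ^ (m' - i))) *+ (p ^ i)))
  else [::].

(* The variables are X_0, ..., X_{n-1}, Y_0, ..., Y_{n-1}, in this order. *)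
Definition witt_varX (n i : nat) : mpoly.mpoly (n + n) rat :=
  if insub i is Some j then mpoly.mpolyX rat (mpoly.mnm1 (lshift n j)) else 0.

Definition witt_varY (n i : nat) : mpoly.mpoly (n + n) rat :=
  if insub i is Some j then mpoly.mpolyX rat (mpoly.mnm1 (rshift n j)) else 0.

Definition witt_sum_poly (p n : nat) : seq (mpoly.mpoly (n + n) rat) :=
  unghost p (fun m => ghost p (@witt_varX n) m + ghost p (@witt_varY n) m) n.

Definition witt_prod_poly (p n : nat) : seq (mpoly.mpoly (n + n) rat) :=
  unghost p (fun m => ghost p (@witt_varX n) m * ghost p (@witt_varY n) m) n.

(* By a theorem of Witt, the coefficients of the polynomials above are
   integers, hence equal to their numerators. *)
Definition witt_eval (K : fieldType) (n : nat) (q : mpoly.mpoly (n + n) rat)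
    (x y : n.-tuple K) : K :=
  mpoly.mmap (fun c : rat => (numq c)%:~R)
    (fun j => match split j with inl i => tnth x i | inr i => tnth y i end) q.

Definition witt_add (K : fieldType) (p n : nat) (x y : n.-tuple K) :
    n.-tuple K :=
  [tuple witt_eval (witt_sum_poly p n)`_i x y | i < n].

Definition witt_mul (K : fieldType) (p n : nat) (x y : n.-tuple K) :
    n.-tuple K :=
  [tuple witt_eval (witt_prod_poly p n)`_i x y | i < n].

(* Frobenius, in characteristic p. *)
Definition witt_frob (K : fieldType) (p n : nat) (x : n.-tuple K) :
    n.-tuple K :=
  [tuple tnth x i ^+ p | i < n].

Definition witt_sec (K : fieldType) (X : integralScheme K) (n : nat)
    (U : set X) : set (n.-tuple K) :=
  [set z | forall i, sec U (tnth z i)].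

Definition witt_div_sec (K : fieldType) (X : integralScheme K) (p n : nat)
    (D : X -> rat) (U : set X) : set (n.-tuple K) :=
  [set z | forall i : 'I_n,
     div_sec (fun x => (p ^ i)%:R * D x) U (tnth z i)].

(* [alpha U] is the component over U of a homomorphism of W_n O_X-modules
   F_* W_n O_X(p Delta) -> O_X: W_n O_X acts on the source through Frobenius,
   and on the target through its first component (the entry z`_0).  The
   restriction maps are inclusions.  Only the values of [alpha U] on
   W_n O_X(p Delta)(U), for U open and nonempty, are relevant. *)
Definition n_quasi_F_split (K : fieldType) (X : integralScheme K) (p : nat)
    (Delta : X -> rat) (n : nat) : Prop :=
  (0 < n)%N /\
  exists alpha : set X -> n.-tuple K -> K,
    let M U := witt_div_sec (n := n) p (fun x => p%:R * Delta x) U in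
    [/\ forall U, open U -> U !=set0 -> forall z, M U z -> sec U (alpha U z),
        forall U V, open U -> open V -> V !=set0 -> V `<=` U ->
          forall z, M U z -> alpha V z = alpha U z,
        forall U, open U -> U !=set0 -> forall y z, M U y -> M U z ->
          alpha U (witt_add p y z) = alpha U y + alpha U z,
        forall U, open U -> U !=set0 ->
          forall a z, witt_sec U a -> M U z ->
          alpha U (witt_mul p (witt_frob p a) z) = a`_0 * alpha U z
      & forall U, open U -> U !=set0 ->
          forall z, witt_div_sec p Delta U z ->
          alpha U (witt_frob p z) = z`_0].

Definition quasi_F_split (K : fieldType) (X : integralScheme K) (p : nat)
    (Delta : X -> rat) : Prop :=
  exists n, n_quasi_F_split p Delta n.

(* Main.v *)
(* Restrict a splitting alpha of minimal length n along
   V^(n-1) : O_X(p^n Delta) -> W_n O_X(p Delta).  If the restriction vanished,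
   alpha would factor through Witt vectors of length n-1.  So it is a nonzero
   p^(-n)-linear map O_X(p^n Delta) -> O_X, and extends to K(X).

   Every p^(-n)-linear endomorphism of K(X) has the form f |-> C^n(g f w) / w,
   where w is the rational form of top degree defining K_X and C is the Cartier
   operator; this replaces Grothendieck duality for the Frobenius.  At a prime
   divisor x there are local functions t with dt a unit times s^e w, where s is
   a uniformizer and -e is at least the order of w.  In the coordinates t the
   integrality of the map on O_X(p^n Delta) becomes
   ord(g) >= (p^n - 1) ord(w) + floor(p^n Delta).

   The operator C is computed in a p-basis of K(X), and its independence of the
   p-basis is checked by exchanging one element at a time.  That dim X functions
   with independent differentials form a p-basis holds because a p-independent
   family is algebraically independent over the perfect field k, and the algebra
   of an affine chart has chains of primes of length its transcendence degree. *)

(* The number p^n - 1 records the choice of the form: replacing w by u w multiplies g by u^(p^n -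
   1), so that g w^(1 - p^n) depends only on the map, and this is the section sought of -((p^n - 1)
   K_X + floor(p^n Delta)).

   Two features of the definitions shape the proof. Witt polynomials are evaluated through the
   numerators of their rational coefficients, and taking numerators is not additive, so that an
   identity between such polynomials cannot simply be evaluated in K. The ring axioms for Witt
   vectors are therefore avoided: only weighted homogeneity is used, together with substitutions of
   the variables by distinct variables or by 0, which commute with the evaluation.

   The splitting is given on open sets, whereas orders are bounded at single points of codimension
   one. A function with a bounded pole at such a point has to become a section of O_X(p^n Delta) on
   a neighbourhood. This rests on the finite generation of the ideals of an affine chart, whence
   Hilbert's basis theorem. *)
Require Import Defs.
From HB Require Import structures.
From mathcomp Require Import all_boot all_order all_algebra.
From mathcomp Require Import boolp classical_sets cardinality topology.
From mathcomp Require Import generic_quotient ring_quotient.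
From mathcomp Require mpoly.
From mathcomp Require Import ring zify.
Import -(notations) mpoly.

Set Implicit Arguments.
Unset Strict Implicit.
Unset Printing Implicit Defensive.
Import Order.TTheory GRing.Theory Num.Theory.
Local Open Scope classical_set_scope.
Local Open Scope ring_scope.

(** * Derivations and p-bases *)

Section Derivations.

Variable K : fieldType.

Definition derivation (D : K -> K) : Prop :=
  (forall a b, D (a + b) = D a + D b) /\
  (forall a b, D (a * b) = a * D b + b * D a).

Lemma der0 D : derivation D -> D 0 = 0.
Proof. by case=> DD _; apply: (addrI (D 0)); rewrite -DD !addr0. Qed.

Lemma der1 D : derivation D -> D 1 = 0.
Proof.
case=> _ /(_ 1 1); rewrite !mul1r => h.
by apply: (addrI (D 1)); rewrite -h addr0.
Qed.

Lemma derN D : derivation D -> forall a, D (- a) = - D a.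
Proof.
move=> hD a; apply: (addrI (D a)).
by rewrite -(proj1 hD) !subrr der0.
Qed.

Lemma der_sum D : derivation D -> forall (I : Type) (r : seq I) (P : pred I) F,
  D (\sum_(i <- r | P i) F i) = \sum_(i <- r | P i) D (F i).
Proof. by move=> hD I r P F; apply: big_morph; [case: hD | exact: der0]. Qed.

Lemma derXn D : derivation D -> forall a n, D (a ^+ n) = a ^+ n.-1 * D a *+ n.
Proof.
move=> hD a; elim=> [|n IH]; first by rewrite expr0 der1.
rewrite exprS (proj2 hD) IH; case: n {IH} => [|n].
  by rewrite mulr0n mulr0 add0r !expr0.
by rewrite /= mulrnAr mulrA -exprS [in RHS]mulrS addrC.
Qed.

Lemma der_nat D : derivation D -> forall n, D n%:R = 0.
Proof.
move=> hD; elim=> [|n IH]; first exact: der0.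
by rewrite -addn1 natrD (proj1 hD) IH der1 // addr0.
Qed.

Lemma derMconst D : derivation D -> forall a b, D a = 0 -> D (a * b) = a * D b.
Proof. by move=> hD a b Da; rewrite (proj2 hD) Da mulr0 addr0. Qed.

Lemma der_prod0 D : derivation D -> forall (I : Type) (r : seq I) (P : pred I) F,
  (forall i, P i -> D (F i) = 0) -> D (\prod_(i <- r | P i) F i) = 0.
Proof.
move=> hD I r P F hF; apply: (big_ind (fun x => D x = 0)) => //.
  exact: der1.
by move=> x y Dx Dy; rewrite (proj2 hD) Dx Dy !mulr0 addr0.
Qed.

Lemma der_pchar D p : p \in [pchar K] -> derivation D -> forall a, D (a ^+ p) = 0.
Proof. by move=> hp hD a; rewrite derXn // mulrn_pchar. Qed.

Lemma der_lin (n : nat) (D : 'I_n -> K -> K) (c : 'I_n -> K) :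
  (forall i, derivation (D i)) -> derivation (fun f => \sum_i c i * D i f).
Proof.
move=> hD; split=> a b.
  by rewrite -big_split; apply: eq_bigr => i _; rewrite (proj1 (hD i)) mulrDr.
rewrite !mulr_sumr -big_split; apply: eq_bigr => i _.
by rewrite (proj2 (hD i)) /=; ring.
Qed.

(** The value of dt_1 /\ ... /\ dt_d at the derivations [D]; for fixed [D] it measures top forms by
    elements of K. *)
Definition jac (d : nat) (D : 'I_d -> K -> K) (t : 'I_d -> K) : K :=
  \det (\matrix_(i, j) D i (t j)).

(** The partial derivatives with respect to the coordinates [t]. *)
Definition dual_der (d : nat) (E : 'I_d -> K -> K) (t : 'I_d -> K) : Prop :=
  (forall j, derivation (E j)) /\ forall j l, E j (t l) = (j == l)%:R.

(** The inverse of the Jacobian matrix turns the [D i] into the partial derivatives along [t]; the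
    formula for [jac D s] is then the chain rule. *)
Lemma jac_dual (d : nat) (D : 'I_d -> K -> K) (t : 'I_d -> K) :
  (forall i, derivation (D i)) -> jac D t != 0 ->
  exists2 E, dual_der E t &
    forall s, jac D s = jac D t * \det (\matrix_(i, j) E i (s j)).
Proof.
move=> hD ht; pose M := \matrix_(i, j) D i (t j).
have uM : M \in unitmx by rewrite unitmxE unitfE.
pose E j f := \sum_i invmx M j i * D i f.
exists E; first split=> [j|j l]; first exact: der_lin.
  transitivity ((invmx M *m M) j l); last by rewrite mulVmx // mxE.
  by rewrite mxE; apply: eq_bigr => i _; rewrite mxE.
move=> s; rewrite -det_mulmx; congr (\det _); apply/matrixP => i j.
have -> : \matrix_(i, j) E i (s j) = invmx M *m (\matrix_(i, j) D i (s j)).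
  by apply/matrixP => a b; rewrite !mxE; apply: eq_bigr => c _; rewrite mxE.
by rewrite mulmxA mulmxV // mul1mx.
Qed.

Definition upd (d : nat) (t : 'I_d -> K) (j : 'I_d) (s : K) (l : 'I_d) : K :=
  if l == j then s else t l.

Lemma det_upd (d : nat) (E : 'I_d -> K -> K) (t : 'I_d -> K) j s :
  dual_der E t -> \det (\matrix_(i, l) E i (upd t j s l)) = E j s.
Proof.
case=> _ hE; rewrite (expand_det_row _ j) (bigD1 j) //= big1 ?addr0; last first.
  by move=> i ij; rewrite !mxE /upd (negPf ij) hE eq_sym (negPf ij) mul0r.
rewrite !mxE /upd eqxx /cofactor addnn -signr_odd odd_double mul1r.
rewrite (_ : row' _ _ = 1%:M) ?det1 ?mulr1 //.
apply/matrixP => a b; rewrite !mxE eq_sym (negPf (neq_lift _ _)) hE.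
by rewrite (inj_eq lift_inj).
Qed.

End Derivations.

Section PBasis.

Variables (K : fieldType) (p : nat).
Hypothesis charK : p \in [pchar K].

Lemma frobD (x y : K) : (x + y) ^+ p = x ^+ p + y ^+ p.
Proof. by have := rmorphD (pFrobenius_aut charK) x y. Qed.

Lemma frobB (x y : K) : (x - y) ^+ p = x ^+ p - y ^+ p.
Proof. by have := rmorphB (pFrobenius_aut charK) x y. Qed.

Lemma frob_sum (I : Type) (r : seq I) (P : pred I) (F : I -> K) :
  (\sum_(i <- r | P i) F i) ^+ p = \sum_(i <- r | P i) F i ^+ p.
Proof. by have := rmorph_sum (pFrobenius_aut charK) r P F. Qed.

Lemma frob_nat m : (m%:R : K) ^+ p = m%:R.
Proof. exact: (pFrobenius_aut_nat charK). Qed.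

Lemma frob0 : (0 : K) ^+ p = 0.
Proof. exact: (rmorph0 (pFrobenius_aut charK)). Qed.

Let p_pr : prime p := pcharf_prime charK.
Let p_gt0 : (0 < p)%N := prime_gt0 p_pr.

Definition mon (d : nat) (t : 'I_d -> K) (e : 'I_d -> nat) : K :=
  \prod_j t j ^+ e j.

(** A combination of monomials over the subfield of p-th powers. The coefficients are given by their
    p-th roots, which are the values that the Cartier operator returns. *)
Definition plin (d : nat) (t : 'I_d -> K) (c : {ffun 'I_d -> 'I_p} -> K) : K :=
  \sum_i c i ^+ p * mon t (fun j => i j).

Definition pspan (d : nat) (t : 'I_d -> K) : set K :=
  [set f | exists c, f = plin t c].

Definition pindep (d : nat) (t : 'I_d -> K) : Prop :=
  forall c, plin t c = 0 -> forall i, c i = 0.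

Lemma mon_neq0 (d : nat) (t : 'I_d -> K) e :
  (forall j, t j != 0) -> mon t e != 0.
Proof. by move=> t0; apply/prodf_neq0 => j _; rewrite expf_neq0. Qed.

Lemma monD (d : nat) (t : 'I_d -> K) e e' :
  mon t (fun j => (e j + e' j)%N) = mon t e * mon t e'.
Proof. by rewrite /mon -big_split; apply: eq_bigr => j _; rewrite exprD. Qed.

Lemma eq_mon (d : nat) (t : 'I_d -> K) e e' : e =1 e' -> mon t e = mon t e'.
Proof. by move=> ee; apply: eq_bigr => j _; rewrite ee. Qed.

Lemma monM (d : nat) (t : 'I_d -> K) e m :
  mon t (fun j => (e j * m)%N) = mon t e ^+ m.
Proof. by rewrite /mon -prodrXl; apply: eq_bigr => j _; rewrite exprM. Qed.

Definition modord (m : nat) : 'I_p := Ordinal (ltn_pmod m p_gt0).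

Lemma mon_divmod (d : nat) (t : 'I_d -> K) (e : 'I_d -> nat) :
  mon t e = mon t (fun j => e j %/ p)%N ^+ p
            * mon t (fun j => [ffun j => modord (e j)] j).
Proof.
rewrite -monM -monD; apply: eq_mon => j.
by rewrite ffunE /= -divn_eq.
Qed.

Lemma der_mon (d : nat) (E : 'I_d -> K -> K) (t : 'I_d -> K) :
  dual_der E t -> forall j e, t j * E j (mon t e) = (e j)%:R * mon t e.
Proof.
case=> hE hEt j e; rewrite /mon (bigD1 j) //= (proj2 (hE j)).
rewrite (@der_prod0 _ (E j)) // => [|i ij]; last first.
  by rewrite derXn // hEt eq_sym (negPf ij) mulr0 mul0rn.
rewrite mulr0 add0r derXn // hEt eqxx mulr1 -mulr_natl.
case: (e j) => [|m] /=; first by rewrite !mul0r !mulr0.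
by rewrite exprS; ring.
Qed.

Lemma dual_neq0 (d : nat) (E : 'I_d -> K -> K) (t : 'I_d -> K) :
  dual_der E t -> forall j, t j != 0.
Proof.
case=> hE hEt j; apply/eqP => tj0; have := hEt j j.
by rewrite tj0 der0 // eqxx => /esym/eqP; rewrite oner_eq0.
Qed.

(* The monomials are eigenvectors of the operators [t_j E_j], with distinct
   eigenvalues in the prime field. *)
Lemma pindep_dual (d : nat) (E : 'I_d -> K -> K) (t : 'I_d -> K) :
  dual_der E t -> pindep t.
Proof.
move=> hE; have t0 := dual_neq0 hE.
suff H n : forall (c : {ffun 'I_d -> 'I_p} -> K) (S : {set {ffun 'I_d -> 'I_p}}),
    (#|S| <= n)%N -> \sum_(i in S) c i ^+ p * mon t (fun j => i j) = 0 ->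
    forall i, i \in S -> c i = 0.
  move=> c hc i; apply: (H _ c [set: _]%SET (leqnn _)); rewrite ?inE //.
  by rewrite -[RHS]hc; apply: eq_bigl => j; rewrite inE.
elim: n => [|n IH] c S hS hsum i iS.
  by move: hS; rewrite leqn0 cards_eq0 => /eqP S0; rewrite S0 inE in iS.
have drop i0 : i0 \in S -> c i0 = 0 -> forall i, i \in S -> c i = 0.
  move=> i0S ci0 l lS; have [->//|li0] := eqVneq l i0.
  apply: (IH c (S :\ i0)); last by rewrite !inE li0.
    by move: hS; rewrite (cardsD1 i0) i0S.
  move: hsum; rewrite (big_setD1 i0) //= ci0 frob0 mul0r add0r; exact: id.
have [i' /andP[i'S i'i]|none] := pickP [pred i' | (i' \in S) && (i' != i)]; last first.
  have S1 : S = [set i]%SET.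
    apply/setP => l; rewrite inE; apply/idP/eqP => [lS|->//].
    by have := none l; rewrite /= lS /= => /negbFE/eqP.
  move: hsum; rewrite S1 big_set1 => /eqP; rewrite mulf_eq0 expf_eq0.
  by rewrite (negPf (mon_neq0 _ t0)) orbF => /andP[_ /eqP].
have [j hj] : exists j, i j != i' j.
  apply/existsP; rewrite -negb_forall; apply: contraNN i'i => /forallP h.
  by apply/eqP/ffunP => l; apply/esym/eqP.
(* The operator t_j E_j - i'_j annihilates the monomial i' and multiplies the others by elements of
   the prime field, which are their own p-th roots. *)
pose c' (l : {ffun 'I_d -> 'I_p}) := ((l j)%:R - (i' j)%:R) * c l.
have ci0 : c' i = 0.
  apply: (IH c' (S :\ i')); last by rewrite !inE iS eq_sym i'i.
    by move: hS; rewrite (cardsD1 i') i'S.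
  have -> : \sum_(l in S :\ i') c' l ^+ p * mon t (fun j => l j)
      = \sum_(l in S) c' l ^+ p * mon t (fun j => l j).
    by rewrite [RHS](big_setD1 i') //= /c' subrr mul0r frob0 mul0r add0r.
  transitivity (t j * E j (\sum_(l in S) c l ^+ p * mon t (fun j => l j))
     - (i' j)%:R * \sum_(l in S) c l ^+ p * mon t (fun j => l j)); last first.
    by rewrite hsum der0 ?mulr0 ?subrr //; case: hE.
  rewrite der_sum; last by case: hE.
  rewrite !mulr_sumr -sumrB; apply: eq_bigr => l _.
  rewrite derMconst; [|by case: hE|by rewrite der_pchar //; case: hE].
  rewrite mulrCA der_mon // /c' exprMn frobB !frob_nat; ring.
apply: (drop i) => //; apply/eqP; move/eqP: ci0; rewrite /c' mulf_eq0 => /orP[|//].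
rewrite subr_eq0 => /eqP eqij; case/eqP: hj; apply/val_inj => /=.
have lt1 := ltn_ord (i j); have lt2 := ltn_ord (i' j).
wlog le12 : i i' {iS i'S i'i c'} eqij lt1 lt2 / (i j <= i' j)%N.
  move=> hw; case/orP: (leq_total (i j) (i' j)) => h; first exact: hw.
  by apply/esym/hw.
have := natrB K le12; rewrite eqij subrr => /eqP.
rewrite -(dvdn_pcharf charK) => dv; apply/eqP; rewrite eqn_leq le12 /= -subn_eq0.
by apply: contraTT dv; rewrite -lt0n => h; rewrite gtnNdvd // ltn_subLR // ltn_addl.
Qed.

End PBasis.

Section Extension.

Variables (K : fieldType) (p : nat).
Hypothesis charK : p \in [pchar K].

Let p_pr : prime p := pcharf_prime charK.
Let p_gt0 : (0 < p)%N := prime_gt0 p_pr.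

Lemma natr_pchar_neq0 m : (0 < m < p)%N -> (m%:R : K) != 0.
Proof. by case/andP=> m0 mp; rewrite -(dvdn_pcharf charK) gtnNdvd. Qed.

Lemma poly_minsize (S : set {poly K}) : S !=set0 ->
  exists2 P, S P & forall Q, S Q -> (size P <= size Q)%N.
Proof.
case=> P0 SP0.
have ex : exists m, `[< exists2 P, S P & size P = m >].
  by exists (size P0); apply/asboolP; exists P0.
case: (ex_minnP ex) => m /asboolP[Q SQ sQ] hm.
by exists Q => // R SR; rewrite sQ; apply: hm; apply/asboolP; exists R.
Qed.

Section Subfield.

Variable E : set K.
Hypothesis E1 : E 1.
Hypothesis EB : forall a b, E a -> E b -> E (a - b).
Hypothesis EM : forall a b, E a -> E b -> E (a * b).
Hypothesis EV : forall a, E a -> E a^-1.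

Let E0 : E 0. Proof. by rewrite -(subrr 1); apply: EB. Qed.
Let EN a : E a -> E (- a). Proof. by move=> Ea; rewrite -sub0r; apply: EB. Qed.
Let ED a b : E a -> E b -> E (a + b).
Proof. by move=> Ea Eb; rewrite -[b]opprK; apply: EB => //; apply: EN. Qed.
Let EMn a m : E a -> E (a *+ m).
Proof. by move=> Ea; elim: m => [|m IH]; rewrite ?mulr0n // mulrS; apply: ED. Qed.

(* The minimal polynomial of [s] over [E] divides [(X - s)^p], hence is a
   power of [X - s]; its derivative has smaller degree, so it is [X - s]. *)
Lemma root_subfield s (P : {poly K}) : E (s ^+ p) ->
  (forall i, E P`_i) -> P != 0 -> (size P <= p)%N -> root P s -> E s.
Proof.
move=> Esp EP P0 sP rP.
pose S := [set Q : {poly K} | [/\ forall i, E Q`_i, Q != 0 & root Q s]].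
have [Q [EQ Q0 rQ] minQ] : exists2 Q, S Q & forall R, S R -> (size Q <= size R)%N.
  by apply: poly_minsize; exists P.
have {P0 EP rP} sQ : (size Q <= p)%N by apply: leq_trans (minQ P _) sP.
have lQ0 : lead_coef Q != 0 by rewrite lead_coef_eq0.
(* [E] is only a subset of K, so division by Q over [E] is carried out in K[X], cancelling leading
   terms with multipliers taken from [E]. *)
have dvdQ n : forall R : {poly K}, (size R <= n)%N -> (forall i, E R`_i) -> root R s -> Q %| R.
  elim: n => [|n IH] R sR ER rR.
    by move: sR; rewrite leqn0 size_poly_eq0 => /eqP ->; rewrite dvdp0.
  have [->|R0] := eqVneq R 0; first by rewrite dvdp0.
  have sQR : (size Q <= size R)%N by apply: minQ.
  pose c := lead_coef R / lead_coef Q; pose m := (size R - size Q)%N.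
  have Ec : E c by apply: EM; [exact: ER | apply: EV; exact: EQ].
  pose T := c *: ('X^m * Q).
  have -> : R = (R - T) + T by rewrite subrK.
  have dvT : Q %| T by rewrite dvdpZr ?mulf_neq0 ?lead_coef_eq0 ?invr_eq0 // dvdp_mull.
  rewrite dvdp_addl //; apply: IH; last first.
    by rewrite /T rootE hornerD hornerN hornerZ hornerM (rootP rR) (rootP rQ) !mulr0 subr0.
    move=> i; rewrite coefB coefZ coefXnM; apply: EB; first exact: ER.
    by apply: EM => //; case: ifP => _ //.
  have sT : size T = size R.
    rewrite size_scale ?mulf_neq0 ?lead_coef_eq0 ?invr_eq0 //.
    by rewrite size_monicM ?monicXn // size_polyXn addSn /= /m subnK.
  rewrite -ltnS; apply: leq_trans sR; rewrite ltn_neqAle.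
  have le : (size (R - T)%R <= size R)%N.
    by rewrite (leq_trans (size_polyD _ _)) // size_polyN sT maxnn.
  rewrite le andbT; apply/negP => /eqP eqs.
  have RT0 : R - T != 0 by rewrite -size_poly_eq0 eqs size_poly_eq0.
  have : lead_coef (R - T) = 0.
    rewrite lead_coefE eqs coefB -[X in _ - T`_X.-1]sT -!lead_coefE lead_coefZ.
    rewrite lead_coef_monicM ?monicXn // /c mulfVK // subrr //.
  by move/eqP; rewrite lead_coef_eq0 (negPf RT0).
have : Q %| ('X - s%:P) ^+ p.
  have -> : ('X - s%:P) ^+ p = 'X^p - (s ^+ p)%:P.
    have cP : p \in [pchar {poly K}] by rewrite (rmorph_pchar (@polyC K)).
    have := rmorphB (pFrobenius_aut cP) 'X s%:P.
    by rewrite /= !pFrobenius_autE rmorphXn.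
  apply: (dvdQ _ _ (leqnn _)); last by rewrite rootE !hornerE subrr.
  move=> i; rewrite coefB coefXn coefC; apply: EB; last by case: ifP.
  by case: eqP.
case/dvdp_exp_XsubCP => j _ ejQ.
have [c [c0 eQ]] : exists c, c != 0 /\ Q = c *: ('X - s%:P) ^+ j.
  by case/eqpf_eq: ejQ => c c0 ->; exists c.
have j0 : (0 < j)%N.
  rewrite lt0n; apply: contraTneq rQ => j0.
  by rewrite eQ j0 rootE expr0 !hornerE.
have sQj : size Q = j.+1 by rewrite eQ size_scale // size_exp_XsubC.
have dQ0 : Q^`() != 0.
  have : Q^`()`_j.-1 != 0.
    rewrite coef_deriv prednK // -mulr_natl mulf_neq0 //.
      by apply: natr_pchar_neq0; rewrite j0 -ltnS -sQj ltnS.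
    by have := lQ0; rewrite lead_coefE sQj.
  by apply: contraNneq => ->; rewrite coef0.
have ndQ : ~~ root Q^`() s.
  apply/negP => rd; have : (size Q <= size Q^`()%R)%N.
    by apply: minQ; split=> // i; rewrite coef_deriv; apply: EMn.
  by rewrite leqNgt lt_size_deriv.
have j1 : j = 1%N.
  case: j j0 ejQ eQ sQj => [//|[//|j]] _ _ eQ _; case/negP: ndQ.
  rewrite eQ derivZ deriv_exp derivXsubC mul1r rootE hornerZ hornerMn horner_exp.
  by rewrite hornerXsubC subrr expr0n /= mul0rn mulr0.
have := EQ 0%N; have := EQ 1%N; rewrite eQ j1 expr1 !coefE /= !(subr0, sub0r) mulr1 => Ec.
by rewrite mulrN => /EN; rewrite opprK => /(EM (EV Ec)); rewrite mulKf.
Qed.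

End Subfield.

Section Span.

Variables (d : nat) (t : 'I_d -> K).

Lemma pspanD f g : pspan p t f -> pspan p t g -> pspan p t (f + g).
Proof.
move=> [c ->] [c' ->]; exists (fun i => c i + c' i).
by rewrite /plin -big_split; apply: eq_bigr => i _; rewrite frobD // mulrDl.
Qed.

Lemma pspanZ a f : pspan p t f -> pspan p t (a ^+ p * f).
Proof.
move=> [c ->]; exists (fun i => a * c i).
by rewrite /plin mulr_sumr; apply: eq_bigr => i _; rewrite exprMn mulrA.
Qed.

Lemma pspan0 : pspan p t 0.
Proof. by exists (fun _ => 0); rewrite /plin big1 // => i _; rewrite frob0 // mul0r. Qed.

Lemma pspan_sum (I : Type) (r : seq I) (P : pred I) F :
  (forall i, P i -> pspan p t (F i)) -> pspan p t (\sum_(i <- r | P i) F i).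
Proof. by move=> h; apply: big_ind => //; [exact: pspan0 | exact: pspanD]. Qed.

Lemma pspan_mon e : pspan p t (mon t e).
Proof.
rewrite (mon_divmod charK); apply: pspanZ.
exists (fun i => (i == [ffun j => modord charK (e j)])%:R).
rewrite /plin (bigD1 [ffun j => modord charK (e j)]) //= eqxx big1 ?addr0.
  by rewrite expr1n mul1r.
by move=> i /negPf ->; rewrite frob0 // mul0r.
Qed.

Lemma pspanM f g : pspan p t f -> pspan p t g -> pspan p t (f * g).
Proof.
move=> [c ->] [c' ->]; rewrite /plin big_distrl; apply: pspan_sum => i _ /=.
rewrite big_distrr; apply: pspan_sum => j _ /=.
rewrite mulrACA -exprMn -monD; apply: pspanZ; exact: pspan_mon.
Qed.

Lemma pspan_p a : pspan p t (a ^+ p).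
Proof.
rewrite -[_ ^+ p]mulr1; apply: pspanZ.
have -> : 1 = mon t (fun _ => 0%N) by rewrite /mon big1.
exact: pspan_mon.
Qed.

Lemma pspan1 : pspan p t 1.
Proof. by rewrite -(expr1n _ p); apply: pspan_p. Qed.

Lemma pspanN f : pspan p t f -> pspan p t (- f).
Proof.
move=> h; have -> : - f = (-1) ^+ p * f.
  by rewrite -[-1]sub0r frobB // frob0 // expr1n sub0r mulN1r.
exact: pspanZ.
Qed.

Lemma pspanB f g : pspan p t f -> pspan p t g -> pspan p t (f - g).
Proof. by move=> hf hg; apply: pspanD => //; apply: pspanN. Qed.

(** The identity f^-1 = (f^-1)^p f^(p-1) reduces inverses to products; with this the span is a
    field. *)
Lemma pspanV f : pspan p t f -> pspan p t f^-1.
Proof.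
have [->|f0] := eqVneq f 0; first by rewrite invr0.
move=> hf; have -> : f^-1 = f^-1 ^+ p * f ^+ p.-1.
  rewrite -{1}(prednK p_gt0) exprSr exprVn mulrAC mulVf ?mul1r //.
  by rewrite expf_neq0.
apply: pspanZ; elim: (p.-1) => [|m IH]; first by rewrite expr0; apply: pspan1.
by rewrite exprS; apply: pspanM.
Qed.

End Span.

Definition ext (d : nat) (t : 'I_d -> K) (s : K) (j : 'I_d.+1) : K :=
  if unlift ord_max j is Some i then t i else s.

Lemma ext_widen d (t : 'I_d -> K) s i : ext t s (widen_ord (leqnSn d) i) = t i.
Proof.
rewrite /ext; have -> : widen_ord (leqnSn d) i = lift ord_max i.
  by apply/val_inj; rewrite /= /bump leqNgt ltn_ord.
by rewrite liftK.
Qed.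

Lemma ext_max d (t : 'I_d -> K) s : ext t s ord_max = s.
Proof. by rewrite /ext unlift_none. Qed.

(** A relation for [ext t s] is a polynomial in s of degree less than p over the field spanned by t,
    which contains s^p. By [root_subfield] it is zero, and its coefficients are relations for t. *)
Lemma pindep_ext d (t : 'I_d -> K) s :
  pindep p t -> ~ pspan p t s -> pindep p (ext t s).
Proof.
move=> ht ns c hc.
pose lo (i : {ffun 'I_d.+1 -> 'I_p}) : {ffun 'I_d -> 'I_p} :=
  [ffun j => i (widen_ord (leqnSn d) j)].
pose P : {poly K} := \sum_(i : {ffun 'I_d.+1 -> 'I_p})
  (c i ^+ p * mon t (fun j => lo i j)) *: 'X^(i ord_max).
have coefP m : P`_m = \sum_(i : {ffun 'I_d.+1 -> 'I_p} | val (i ord_max) == m)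
     c i ^+ p * mon t (fun j => lo i j).
  rewrite /P coef_sum [RHS]big_mkcond; apply: eq_bigr => i _.
  by rewrite coefZ coefXn eq_sym; case: eqP; rewrite ?mulr1 ?mulr0.
have Ps : root P s.
  rewrite rootE /P horner_sum -[X in _ == X]hc; apply/eqP/eq_bigr => i _.
  rewrite hornerZ hornerXn -mulrA /mon big_ord_recr /= ext_max; congr (_ * (_ * _)).
  by apply: eq_bigr => j _; rewrite ext_widen /lo ffunE.
have P0 : P = 0.
  apply/eqP; apply: contrapT => /negP Pn0; apply: ns.
  apply: (@root_subfield (pspan p t) _ _ _ _ s P) => //.
  - exact: pspan1.
  - by move=> a b; apply: pspanB.
  - by move=> a b; apply: pspanM.
  - by move=> a; apply: pspanV.
  - exact: pspan_p.
  - move=> i; rewrite coefP; apply: pspan_sum => j _; apply: pspanZ; exact: pspan_mon.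
  - apply/leq_sizeP => m pm; rewrite coefP big1 // => i /eqP im.
    by move: pm; rewrite -im leqNgt ltn_ord.
move=> i; pose a := i ord_max.
pose up (i' : {ffun 'I_d -> 'I_p}) : {ffun 'I_d.+1 -> 'I_p} :=
  [ffun j => if unlift ord_max j is Some l then i' l else a].
have wid (l : 'I_d) : widen_ord (leqnSn d) l = lift ord_max l.
  by apply/val_inj; rewrite /= /bump leqNgt ltn_ord.
have upK i' : lo (up i') = i'.
  by apply/ffunP => l; rewrite !ffunE wid liftK.
have upK' (i0 : {ffun 'I_d.+1 -> 'I_p}) : i0 ord_max = a -> up (lo i0) = i0.
  move=> ia; apply/ffunP => l; rewrite ffunE; case: unliftP => [l' ->|->].
    by rewrite ffunE wid.
  by rewrite ia.
have : plin t (fun i' => c (up i')) = 0.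
  transitivity (P`_a); last by rewrite P0 coef0.
  rewrite coefP (reindex_onto up lo) => [|i0 /eqP/val_inj /upK' //].
  apply: eq_big => i'; first by rewrite upK eqxx andbT ffunE unlift_none eqxx.
  by rewrite upK.
by move=> /ht/(_ (lo i)); rewrite upK'.
Qed.

End Extension.

(** * The Cartier operator on top forms *)

Section Cartier.

Variables (K : fieldType) (p : nat).
Hypothesis charK : p \in [pchar K].

Let p_pr : prime p := pcharf_prime charK.
Let p_gt0 : (0 < p)%N := prime_gt0 p_pr.

Definition pbasis (d : nat) (t : 'I_d -> K) : Prop :=
  pindep p t /\ forall f, pspan p t f.

Definition topexp (d : nat) : {ffun 'I_d -> 'I_p} :=
  [ffun _ => modord charK p.-1].

Lemma topexpE d j : topexp d j = p.-1 :> nat.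
Proof. by rewrite ffunE /= modn_small // ltn_predL. Qed.

(* The coordinate of [f] on the monomial [t^(p-1)]: up to the choice of the
   generator [dt], this is the Cartier operator on top differential forms. *)
Definition Phi (d : nat) (t : 'I_d -> K) (f : K) : K :=
  xget 0 [set a | exists2 c : {ffun 'I_d -> 'I_p} -> K, f = plin t c & a = c (topexp d)].

Section OneBasis.

Variables (d : nat) (t : 'I_d -> K).
Hypothesis tb : pbasis t.

Lemma Phi_plin (c : {ffun 'I_d -> 'I_p} -> K) : Phi t (plin t c) = c (topexp d).
Proof.
rewrite /Phi; case: xgetP => [a _ [c' ecc' ->]|/(_ (c (topexp d)))]; last first.
  by case; exists c.
apply/eqP; rewrite -subr_eq0; apply/eqP.
apply: (proj1 tb (fun i => c' i - c i)).
transitivity (plin t c' - plin t c); last by rewrite ecc' subrr.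
by rewrite /plin -sumrB; apply: eq_bigr => i _; rewrite frobB // mulrBl.
Qed.

Lemma PhiD f g : Phi t (f + g) = Phi t f + Phi t g.
Proof.
have [[c ->] [c' ->]] := (proj2 tb f, proj2 tb g).
have -> : plin t c + plin t c' = plin t (fun i => c i + c' i).
  by rewrite /plin -big_split; apply: eq_bigr => i _; rewrite frobD // mulrDl.
by rewrite !Phi_plin.
Qed.

Lemma PhiZ a f : Phi t (a ^+ p * f) = a * Phi t f.
Proof.
have [c ->] := proj2 tb f.
have -> : a ^+ p * plin t c = plin t (fun i => a * c i).
  by rewrite /plin mulr_sumr; apply: eq_bigr => i _; rewrite exprMn mulrA.
by rewrite !Phi_plin.
Qed.

Lemma Phi0 : Phi t 0 = 0.
Proof. by have := PhiZ 0 0; rewrite mulr0 mul0r. Qed.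

Lemma Phi_sum (I : Type) (r : seq I) (P : pred I) F :
  Phi t (\sum_(i <- r | P i) F i) = \sum_(i <- r | P i) Phi t (F i).
Proof. by apply: big_morph; [exact: PhiD | exact: Phi0]. Qed.

Lemma PhiN f : Phi t (- f) = - Phi t f.
Proof. by apply/eqP; rewrite -addr_eq0 -PhiD addNr Phi0. Qed.

Lemma Phi_pmon (i : {ffun 'I_d -> 'I_p}) :
  Phi t (mon t (fun j => i j)) = (i == topexp d)%:R.
Proof.
have -> : mon t (fun j => i j) = plin t (fun i' => (i' == i)%:R).
  rewrite /plin (bigD1 i) //= eqxx big1 ?addr0 ?expr1n ?mul1r //.
  by move=> i' /negPf ->; rewrite frob0 // mul0r.
by rewrite Phi_plin eq_sym.
Qed.

Lemma Phi_mon (e : 'I_d -> nat) :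
  Phi t (mon t e) = if [forall j, e j %% p == p.-1]%N
                    then mon t (fun j => e j %/ p)%N else 0.
Proof.
rewrite (mon_divmod charK) PhiZ Phi_pmon.
have -> : ([ffun j => modord charK (e j)] == topexp d)
    = [forall j, e j %% p == p.-1]%N.
  apply/eqP/forallP => [/ffunP h j|h].
    by have := h j; rewrite !ffunE => /(congr1 val) /= ->; rewrite modn_small ?ltn_predL.
  apply/ffunP => j; apply/val_inj; rewrite !ffunE /= [RHS]modn_small ?ltn_predL //.
  exact/eqP/h.
by case: ifP; rewrite ?mulr1 ?mulr0.
Qed.

(** Multiplication by t^(p-1-i) moves the exponent i to the top exponent p-1 and no other exponent
    to one congruent to it modulo p. Hence the pairing (f, g) |-> Phi(f g) is perfect, with explicit
    dual bases. *)
Lemma Phi_expand f : f = \sum_i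
  Phi t (f * mon t (fun j => p.-1 - (i : {ffun 'I_d -> 'I_p}) j)%N) ^+ p * mon t (fun j => i j).
Proof.
have [c ->] := proj2 tb f; rewrite {1}/plin; apply: eq_bigr => i _; congr (_ ^+ p * _).
rewrite /plin mulr_suml Phi_sum (bigD1 i) //= big1 ?addr0.
  rewrite -mulrA -monD PhiZ Phi_mon.
  have le j : (i j + (p.-1 - i j) = p.-1)%N by rewrite subnKC // -ltnS prednK.
  have -> : [forall j, (i j + (p.-1 - i j)) %% p == p.-1]%N.
    by apply/forallP => j; rewrite le modn_small ?ltn_predL.
  rewrite /mon big1 ?mulr1 // => j _.
  by rewrite le divn_small ?ltn_predL.
move=> i' ii'; rewrite -mulrA -monD PhiZ Phi_mon; case: ifP; last by rewrite mulr0.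
move=> /forallP h; case/eqP: ii'; apply/ffunP => j; apply/val_inj => /=.
have := h j; have := ltn_ord (i j); have := ltn_ord (i' j).
set a := nat_of_ord (i j); set b := nat_of_ord (i' j).
move=> blt alt /eqP; have pp := p_gt0; have [ab|ba] := ltnP a b.
  have -> : (b + (p.-1 - a) = p + (b - a.+1))%N by lia.
  by rewrite modnDl modn_small; lia.
by rewrite modn_small; lia.
Qed.

(** The Cartier operator kills exact forms: a monomial with exponent p-1 in t_j could only be the
    derivative of one with exponent p, where the factor coming from the derivation is 0. *)
Lemma Phi_der (E : 'I_d -> K -> K) (hE : dual_der E t) j f : Phi t (E j f) = 0.
Proof.
have [hD _] := hE; have t0 := dual_neq0 hE.
have [c ->] := proj2 tb f; rewrite /plin der_sum // Phi_sum big1 // => i _.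
rewrite derMconst ?der_pchar // PhiZ.
(* The division by t_j is written as t_j^(-p) t_j^(p-1), which keeps the exponents natural
   numbers. *)
have -> : E j (mon t (fun l => i l)) = (t j)^-1 ^+ p *
   ((i j)%:R * mon t (fun l => (i l + (l == j) * p.-1)%N)).
  apply: (mulfI (t0 j)); rewrite (der_mon hE) monD.
  have -> : mon t (fun l => ((l == j) * p.-1)%N) = t j ^+ p.-1.
    rewrite /mon (bigD1 j) //= eqxx mul1n big1 ?mulr1 // => l /negPf ->.
    by rewrite mul0n expr0.
  have tp : t j ^+ p = t j * t j ^+ p.-1 by rewrite -exprS prednK.
  by rewrite exprVn tp; field; rewrite t0 expf_neq0.
rewrite PhiZ -(frob_nat charK) PhiZ Phi_mon; case: ifP => [/forallP/(_ j)|_].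
  rewrite eqxx mul1n; case: (i j) => [[|m] mp] /=; first by rewrite !(mul0r, mulr0).
  rewrite addSnnS prednK // modnDr modn_small ?(ltnW mp) // => /eqP e.
  by move: mp; rewrite e prednK // ltnn.
by rewrite !mulr0.
Qed.

Lemma bin_div_mul i : (0 < i < p)%N -> ('C(p, i) %/ p * p = 'C(p, i))%N.
Proof. by move=> h; rewrite divnK // prime_dvd_bin. Qed.

(* Cartier's computation: [((a + b)^p - a^p - b^p) / p] is a polynomial with
   integer coefficients in [a] and [b], so that the left hand side is additive
   in [s] up to the image of the derivation [E j]. *)
Lemma Phi_chain_add (E : 'I_d -> K -> K) (hE : dual_der E t) j u a b : E j u = 0 ->
  Phi t (u * (a + b) ^+ p.-1 * E j (a + b))
  = Phi t (u * a ^+ p.-1 * E j a) + Phi t (u * b ^+ p.-1 * E j b).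
Proof.
move=> hu; have [hD _] := hE; have DD := hD j.
pose Q := \sum_(0 <= i < p.-1) (a ^+ i.+1 * b ^+ (p - i.+1)) *+ ('C(p, i.+1) %/ p).
apply/eqP; rewrite -subr_eq0 opprD addrA -!PhiN -!PhiD.
suff eQ : (a + b) ^+ p.-1 * E j (a + b) = E j Q + a ^+ p.-1 * E j a + b ^+ p.-1 * E j b.
  apply/eqP; rewrite -[RHS](Phi_der hE j (u * Q)) (derMconst DD) // -mulrA eQ.
  by congr (Phi t _); ring.
have EQ : E j Q = \sum_(0 <= i < p.-1) (a ^+ i * b ^+ (p.-1 - i)) *+ 'C(p.-1, i) * E j a
   + \sum_(0 <= i < p.-1) (a ^+ i.+1 * b ^+ (p.-1 - i.+1)) *+ 'C(p.-1, i.+1) * E j b.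
  rewrite /Q der_sum // -big_split /=; apply: eq_big_nat => i /andP[_ ip].
  have ip' : (0 < i.+1 < p)%N by rewrite /= -(prednK p_gt0) ltnS.
  rewrite -mulr_natl (derMconst DD) ?der_nat // (proj2 DD) !(derXn DD).
  have -> : (p.-1 - i.+1 = (p - i.+1).-1)%N by rewrite -predn_sub.
  have -> : (p.-1 - i = p - i.+1)%N by rewrite -[in RHS](prednK p_gt0) subSS.
  have e1 : ('C(p, i.+1) %/ p * i.+1 = 'C(p.-1, i))%N.
    apply/eqP; rewrite -(eqn_pmul2r p_gt0) -mulnA [(i.+1 * p)%N]mulnC mulnA bin_div_mul //.
    by rewrite mulnC -mul_bin_diag [X in _ == X]mulnC.
  have e2 : ('C(p, i.+1) %/ p * (p - i.+1) = 'C(p.-1, i.+1))%N.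
    apply/eqP; rewrite -(eqn_pmul2r p_gt0) -mulnA [((p - _) * p)%N]mulnC mulnA bin_div_mul //.
    by rewrite mulnC -mul_bin_down [X in _ == X]mulnC.
  by rewrite -e1 -e2 /=; ring.
rewrite EQ exprDn (proj1 DD).
have -> : \sum_(i < p.-1.+1) a ^+ (p.-1 - i) * b ^+ i *+ 'C(p.-1, i)
   = \sum_(0 <= i < p.-1.+1) a ^+ i * b ^+ (p.-1 - i) *+ 'C(p.-1, i).
  rewrite -(big_mkord xpredT (fun i => a ^+ (p.-1 - i) * b ^+ i *+ 'C(p.-1, i))) big_nat_rev.
  apply: eq_big_nat => i /andP[_ ip]; rewrite add0n subSS subKn // bin_sub //.
rewrite mulrDr {1}big_nat_recr //= [in X in _ + X]big_nat_recl //=.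
rewrite !mulrDl !mulr_suml subnn expr0 subn0 bin0 binn !mulr1n mulr1 mul1r.
ring.
Qed.

(** Cartier's formula C(s^(p-1) ds) = ds, with a factor u constant along E_j. Both sides are
    additive in s, so that s may be taken to be a power of t_j times an element constant along
    E_j. *)
Lemma Phi_chain (E : 'I_d -> K -> K) (hE : dual_der E t) j u s : E j u = 0 ->
  Phi t (u * s ^+ p.-1 * E j s) = E j s * Phi t (u * t j ^+ p.-1).
Proof.
move=> hu; have [hD hEt] := hE; have t0 := dual_neq0 hE.
have [c ->] := proj2 tb s; rewrite /plin.
apply: (big_ind (fun s => Phi t (u * s ^+ p.-1 * E j s) = E j s * Phi t (u * t j ^+ p.-1))).
- by rewrite der0 // !mulr0 mul0r Phi0.
- by move=> a b ha hb; rewrite Phi_chain_add // ha hb (proj1 (hD j)) mulrDl.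
move=> i _; pose v := c i ^+ p * \prod_(l | l != j) t l ^+ i l.
have Ev : E j v = 0.
  rewrite (derMconst (hD j)) ?der_pchar // der_prod0 ?mulr0 // => l lj.
  by rewrite (derXn (hD j)) // hEt eq_sym (negPf lj) mulr0 mul0rn.
have -> : c i ^+ p * mon t (fun l => i l) = v * t j ^+ i j.
  by rewrite /mon (bigD1 j) //= /v; ring.
move: v Ev => v Ev; rewrite (derMconst (hD j)) // (derXn (hD j)) // hEt eqxx mulr1.
case: (i j : nat) => [|m]; first by rewrite !(mulr0n, mulr0) mul0r Phi0.
have -> : u * (v * t j ^+ m.+1) ^+ p.-1 * (v * (t j ^+ m.+1.-1 *+ m.+1))
   = (v * t j ^+ m * m.+1%:R) ^+ p * (u * t j ^+ p.-1).
  have xp (x : K) : x ^+ p = x * x ^+ p.-1 by rewrite -exprS prednK.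
  by rewrite -mulr_natl !exprMn /= frob_nat // !xp !exprS !exprMn; ring.
by rewrite PhiZ -mulr_natl /=; ring.
Qed.

End OneBasis.

(** Exchanging t_j for s multiplies the generator dt by E_j s. On a monomial u s^i, with u free of
    t_j, the case i = p-1 is Cartier's formula; otherwise i+1 is invertible and u s^i ds is
    exact. *)
Lemma Phi_change (d : nat) (t : 'I_d -> K) (E : 'I_d -> K -> K) j s :
  pbasis t -> dual_der E t -> E j s != 0 -> pbasis (upd t j s) ->
  forall f, Phi (upd t j s) f = (E j s)^-1 * Phi t (E j s * f).
Proof.
move=> tb hE cn0 tb' f; have [hD hEt] := hE.
have [c ->] := proj2 tb' f; rewrite /plin Phi_sum // mulr_sumr Phi_sum // mulr_sumr.
apply: eq_bigr => i _; rewrite PhiZ // mulrCA PhiZ // mulrCA; congr (_ * _).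
pose u := \prod_(l | l != j) t l ^+ i l.
have Eu : E j u = 0.
  rewrite der_prod0 // => l lj.
  by rewrite (derXn (hD j)) // hEt eq_sym (negPf lj) mulr0 mul0rn.
have e1 : mon (upd t j s) (fun l => i l) = u * s ^+ i j.
  rewrite /mon (bigD1 j) //= {1}/upd eqxx mulrC; congr (_ * _).
  by apply: eq_bigr => l /negPf lj; rewrite /upd lj.
have e2 : mon t (fun l => i l) = u * t j ^+ i j.
  by rewrite /mon (bigD1 j) //= mulrC.
have [ij|ij] := eqVneq (i j : nat) p.-1.
  apply: (mulfI cn0); rewrite mulrA divff // mul1r.
  rewrite Phi_pmon // -(Phi_pmon tb) e1 e2 ij -(Phi_chain tb hE) //.
  by congr (Phi t _); ring.
rewrite Phi_pmon //; have -> : (i == topexp d) = false.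
  by apply/negP => /eqP ei; case/eqP: ij; rewrite ei topexpE.
rewrite e1; have ip : (0 < (i j).+1 < p)%N.
  rewrite /= ltn_neqAle ltn_ord andbT; apply: contraNneq ij => e.
  by apply/eqP; have := congr1 predn e.
have n0 := natr_pchar_neq0 charK ip.
have -> : E j s * (u * s ^+ i j) = E j ((u * ((i j).+1%:R^-1) ^+ p) * s ^+ (i j).+1).
  rewrite (derMconst (hD j)) //; last by rewrite (derMconst (hD j)) // der_pchar // mulr0.
  rewrite (derXn (hD j)) // exprVn frob_nat // -[(_ * _) *+ _]mulr_natl /=.
  by move: ((i j).+1%:R : K) n0 => a n0; field.
by rewrite Phi_der // mulr0.
Qed.

End Cartier.

(** * Independence of the coordinates, and duality for iterates of Frobenius *)

Section CartierTop.

Variables (K : fieldType) (p : nat).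
Hypothesis charK : p \in [pchar K].

Lemma dual_uniq (d : nat) (t : 'I_d -> K) E E' :
  pbasis p t -> dual_der E t -> dual_der E' t -> forall j f, E j f = E' j f.
Proof.
move=> tb hE hE' j f; have t0 := dual_neq0 hE.
have [c ->] := proj2 tb f; rewrite /plin !der_sum; [|by case: hE'|by case: hE].
apply: eq_bigr => i _; rewrite !derMconst; try by case: hE hE' => ? ? [? ?] //; rewrite der_pchar.
congr (_ * _); apply: (mulfI (t0 j)).
by rewrite (der_mon hE) (der_mon hE').
Qed.

Variables (d : nat) (D : 'I_d -> K -> K).
Hypothesis hD : forall i, derivation (D i).
Hypothesis hb : forall t : 'I_d -> K, jac D t != 0 -> pbasis p t.

(* The operator [C(f w) / w], for the form [w] with [w(D) = 1] and [C] the
   Cartier operator, computed in the coordinates [t]. *)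
Definition CT (t : 'I_d -> K) (f : K) : K := jac D t * Phi charK t (f / jac D t).

Lemma CT_upd t j s : jac D t != 0 -> jac D (upd t j s) != 0 ->
  CT t =1 CT (upd t j s).
Proof.
move=> ht ht' f; have [E hE hjac] := jac_dual hD ht.
have ej : jac D (upd t j s) = jac D t * E j s by rewrite hjac det_upd.
have c0 : E j s != 0 by move: ht'; rewrite ej mulf_eq0 negb_or => /andP[].
rewrite /CT (Phi_change charK (hb ht) hE c0 (hb ht')) ej.
rewrite [RHS]mulrA mulfK //; congr (_ * Phi _ _ _); field.
by rewrite ht c0.
Qed.

(** The coordinates are exchanged in increasing order. If E_j0 kills s_j0, the exchange at j0 would
    make the differentials dependent; then some E_j1 with j1 > j0 does not kill s_j0, and replacing
    t_j1 by t_j1 - t_j0 beforehand turns E_j0 into E_j0 + E_j1. *)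
Lemma CT_indep t s : jac D t != 0 -> jac D s != 0 -> CT t =1 CT s.
Proof.
move=> ht hs f.
(* The induction is on k, a bound for the number of last coordinates not yet exchanged. *)
suff H k : forall t, (forall j : 'I_d, (j + k < d)%N -> t j = s j) ->
    jac D t != 0 -> CT t f = CT s f.
  by apply: (H d) => // j; rewrite ltnNge leq_addl.
elim: k => [|k IH] {ht}t ts ht.
  by congr CT; apply/funext => j; apply: ts; rewrite addn0.
have [dk|kd] := leqP d k.
  by apply: IH => // j; rewrite ltnNge (leq_trans dk) ?leq_addl.
have j0P : (d - k.+1 < d)%N by rewrite ltn_subrL (leq_ltn_trans _ kd).
pose j0 := Ordinal j0P.
have step u : (forall j : 'I_d, (j < j0)%N -> u j = s j) -> jac D u != 0 ->
    (forall E, dual_der E u -> E j0 (s j0) != 0) -> CT u f = CT s f.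
  move=> us hu hE0; have [E hE hjac] := jac_dual hD hu.
  have hu' : jac D (upd u j0 (s j0)) != 0.
    by rewrite hjac det_upd // mulf_neq0 // hE0.
  rewrite (CT_upd hu hu'); apply: IH => // j jk.
  rewrite /upd; case: eqP => [->//|/eqP jj0]; apply: us.
  rewrite ltn_neqAle jj0 /=; move: jk; rewrite -!ltn_subRL; lia.
have ts' (j : 'I_d) : (j < j0)%N -> t j = s j.
  by move=> /= jj0; apply: ts; lia.
have [E hE hjac] := jac_dual hD ht; have [hdE hEt] := hE.
have Euniq E' : dual_der E' t -> forall j g, E' j g = E j g.
  by move=> hE'; exact: (dual_uniq (hb ht) hE' hE).
have [c0|cn0] := eqVneq (E j0 (s j0)) 0; last first.
  by apply: step => // E' /Euniq ->.
have [j1 j01 cn1] : exists2 j1 : 'I_d, (j0 < j1)%N & E j1 (s j0) != 0.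
  apply: contrapT => none; move: hs; rewrite hjac mulf_eq0 (negPf ht) /=.
  set N := \matrix_(_, _) _; move=> dN.
  have uN : N \in unitmx by rewrite unitmxE unitfE.
  (* If no such j1 existed, ds_j0 would be a combination of the earlier ds_l = dt_l; v is this
     relation, a kernel vector of the Jacobian matrix of s. *)
  pose v : 'cV[K]_d := \col_l (if l == j0 then 1 else if (l < j0)%N then - E l (s j0) else 0).
  have Nv : N *m v = 0.
    apply/matrixP => i i1; rewrite !mxE (bigD1 j0) //= !mxE eqxx mulr1.
    have [ij|ij] := ltnP i j0.
      have ij' : i != j0 by apply/eqP => e; rewrite e ltnn in ij.
      rewrite (bigD1 i) //= big1 ?addr0 => [|l /andP[lj0 li]].
        by rewrite !mxE (negPf ij') ij -(ts' i ij) hEt eqxx mul1r subrr.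
      rewrite !mxE (negPf lj0); case: ltnP => ll; last by rewrite mulr0.
      by rewrite -(ts' l ll) hEt eq_sym (negPf li) mul0r.
    rewrite [X in X + _](_ : _ = 0); last first.
      have [->//|ij'] := eqVneq i j0; apply: contrapT => /eqP h; apply: none.
      exists i => //; rewrite ltn_neqAle ij andbT; apply: contraNneq ij' => e.
      exact/eqP/val_inj.
    rewrite add0r big1 // => l lj0; rewrite !mxE (negPf lj0).
    case: ltnP => ll; last by rewrite mulr0.
    rewrite -(ts' l ll) hEt; case: eqP => [e|]; last by rewrite mul0r.
    by move: ij; rewrite e leqNgt ll.
  have : v j0 ord0 = 0 by rewrite -(mulKmx uN v) Nv mulmx0 mxE.
  by rewrite mxE eqxx => /eqP; rewrite oner_eq0.
have j10 : j1 != j0 by apply/eqP => e; rewrite e ltnn in j01.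
pose t1 := upd t j1 (t j1 - t j0).
have EB j a b : E j (a - b) = E j a - E j b.
  by rewrite (proj1 (hdE j)) derN.
have ht1 : jac D t1 != 0.
  by rewrite hjac det_upd // EB !hEt eqxx (negPf j10) subr0 mulr1.
rewrite (CT_upd ht ht1); apply: step => // [j jj0|E1 hE1].
  by rewrite /t1 /upd; case: eqP => [e|_]; [rewrite e in jj0; lia | apply: ts'].
pose E2 j f := if j == j0 then E j0 f + E j1 f else E j f.
have hE2 : dual_der E2 t1.
  split=> [j|j l]; rewrite /E2.
    case: eqP => // _; split=> a b; first by rewrite (proj1 (hdE j0)) (proj1 (hdE j1)); ring.
    by rewrite (proj2 (hdE j0)) (proj2 (hdE j1)); ring.
  rewrite /t1 /upd; case: (eqVneq l j1) => [->|lj1].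
    rewrite !EB !hEt !eqxx (eq_sym j0) (negPf j10).
    case: (eqVneq j j0) => [->|jj0]; first by rewrite eq_sym (negPf j10) sub0r subr0 addNr.
    by rewrite subr0.
  rewrite !hEt; case: (eqVneq j j0) => [->|//].
  by rewrite (eq_sym j1) (negPf lj1) addr0.
by rewrite (dual_uniq (hb ht1) hE1 hE2) /E2 eqxx c0 add0r.
Qed.

Section Iterates.

Variable t : 'I_d -> K.
Hypothesis ht : jac D t != 0.
Let tb : pbasis p t := hb ht.

Lemma iter_CT n f :
  iter n (CT t) f = jac D t * iter n (Phi charK t) (f / jac D t).
Proof.
elim: n f => [|n IH] f /=; first by rewrite mulrCA divff ?mulr1.
by rewrite IH /CT [_ / _]mulrAC divff ?mul1r.
Qed.

Lemma iter_PhiD n f g : iter n (Phi charK t) (f + g) =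
  iter n (Phi charK t) f + iter n (Phi charK t) g.
Proof. by elim: n => //= n ->; rewrite PhiD. Qed.

Lemma iter_Phi0 n : iter n (Phi charK t) 0 = 0.
Proof. by elim: n => //= n ->; rewrite Phi0. Qed.

Lemma iter_Phi_sum n (I : Type) (r : seq I) (P : pred I) F :
  iter n (Phi charK t) (\sum_(i <- r | P i) F i)
  = \sum_(i <- r | P i) iter n (Phi charK t) (F i).
Proof. by apply: big_morph; [exact: iter_PhiD | exact: iter_Phi0]. Qed.

Lemma iter_PhiZ n a f : iter n (Phi charK t) (a ^+ (p ^ n) * f)
  = a * iter n (Phi charK t) f.
Proof.
elim: n a f => [|n IH] a f; first by rewrite expn0 expr1.
by rewrite !iterSr expnSr exprM PhiZ // IH.
Qed.

(** By induction on n: the map f |-> phi(f^p t^i) involves one Frobenius less, hence is given by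
    some g_i, and the g_i are assembled with the monomials t^(p-1-i) dual to the t^i in
    [Phi_expand]. *)
Lemma Phi_repr n (phi : K -> K) :
  (forall f g, phi (f + g) = phi f + phi g) ->
  (forall a f, phi (a ^+ (p ^ n) * f) = a * phi f) ->
  exists g, forall f, phi f = iter n (Phi charK t) (g * f).
Proof.
elim: n phi => [|n IH] phi phiD phiZ.
  exists (phi 1) => f /=; rewrite mulrC -phiZ expn0 expr1 mulr1 //.
pose I := {ffun 'I_d -> 'I_p}.
have /choice[g hg] : forall i : I, exists g, forall f,
    phi (f ^+ p * mon t (fun j => i j)) = iter n (Phi charK t) (g * f).
  move=> i; apply: IH => [f f'|a f]; first by rewrite frobD // mulrDl phiD.
  by rewrite exprMn -exprM -expnSr -mulrA phiZ.
exists (\sum_(i : I) g i ^+ p * mon t (fun j => (p.-1 - i j)%N)) => f.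
have phi0 : phi 0 = 0 by apply: (addrI (phi 0)); rewrite -phiD !addr0.
rewrite {1}(Phi_expand charK tb f) (big_morph _ phiD phi0) iterSr mulr_suml Phi_sum //.
rewrite iter_Phi_sum; apply: eq_bigr => i _.
by rewrite hg -mulrA PhiZ // [f * _]mulrC.
Qed.

Lemma CT_repr n (phi : K -> K) :
  (forall f g, phi (f + g) = phi f + phi g) ->
  (forall a f, phi (a ^+ (p ^ n) * f) = a * phi f) ->
  exists g, forall f, phi f = iter n (CT t) (g * f).
Proof.
move=> phiD phiZ.
have [||g hg] := @Phi_repr n (fun f => (jac D t)^-1 * phi f).
- by move=> f g; rewrite phiD mulrDr.
- by move=> a f; rewrite phiZ mulrCA.
exists (jac D t * g) => f; rewrite iter_CT.
have -> : jac D t * g * f / jac D t = g * f by field.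
by rewrite -hg mulrA divff ?mul1r.
Qed.

(** For one iterate, [Phi_expand] writes h in terms of the t_j and of p-th powers of values Phi(h f)
    with f in O. In general, evaluating at f g^p shows that Phi(h f) satisfies the hypothesis for
    one iterate less. *)
Lemma iter_Phi_integral (O : set K) n h : is_subring O -> (forall j, O (t j)) ->
  (forall f, O f -> O (iter n (Phi charK t) (h * f))) -> O h.
Proof.
move=> [O1 OB OM] Ot.
have O0 : O 0 by rewrite -(subrr 1); apply: OB.
have OD a b : O a -> O b -> O (a + b).
  by move=> Oa Ob; rewrite -[b]opprK -[- b]sub0r; apply: (OB) => //; apply: OB.
have OX a e : O a -> O (a ^+ e).
  by move=> Oa; elim: e => [|e IH]; rewrite ?expr0 // exprS; apply: OM.
have Omon e : O (mon t e) by apply: big_ind => // j _; apply: OX.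
have one g : (forall f, O f -> O (Phi charK t (g * f))) -> O g.
  move=> hg; rewrite (Phi_expand charK tb g); apply: big_ind => // i _.
  by apply: OM => //; apply: OX; apply: hg.
elim: n h => [|n IH] h hh; first by rewrite -[h]mulr1; apply: (hh 1).
apply: one => f Of; apply: IH => g Og.
have := hh (f * g ^+ p) (OM _ _ Of (OX _ _ Og)); rewrite iterSr.
by rewrite mulrA mulrC PhiZ // mulrC.
Qed.

(* In terms of a form [w] this reads [C^n(h f w) / w] in [O] for all [f] in
   [O]; passing from [w] to [dt] multiplies [h] by [(dt / w)^(p^n - 1)]. *)
Lemma iter_CT_integral (O : set K) n h : is_subring O -> (forall j, O (t j)) ->
  (forall f, O f -> O (iter n (CT t) (h * f))) -> O (h * jac D t ^+ (p ^ n).-1).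
Proof.
move=> hO Ot hh; apply: (iter_Phi_integral (n := n) hO Ot) => f Of.
have := hh f Of; rewrite iter_CT -iter_PhiZ.
rewrite (_ : _ * (_ / _) = h * jac D t ^+ (p ^ n).-1 * f) //.
have : (0 < p ^ n)%N by rewrite expn_gt0 prime_gt0 // (pcharf_prime charK).
by case: (p ^ n)%N => // m _; rewrite exprS /=; field.
Qed.

End Iterates.

End CartierTop.

(** * The dimension of a finitely generated algebra *)

Section AlgIndep.

Variables (k K : fieldType) (p : nat) (iota : {rmorphism k -> K}).
Hypothesis charK : p \in [pchar K].
Hypothesis perfect_k : forall a : k, exists b : k, b ^+ p = a.

Let p_pr : prime p := pcharf_prime charK.
Let p_gt0 : (0 < p)%N := prime_gt0 p_pr.

Lemma mmap1_mon d (t : 'I_d -> K) (m : multinom d) : mmap1 t m = mon t m.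
Proof. by []. Qed.

(* As [k] is perfect, a polynomial [F] is a sum of terms [G_i^p X^i] with
   exponents [i < p], where the [G_i] have smaller degree. *)
Lemma pindep_alg_indep d (t : 'I_d -> K) : pindep p t ->
  forall F : mpoly d k, mmap iota t F = 0 -> F = 0.
Proof.
move=> ht.
have /choice[r hr] := perfect_k.
pose lo (m : multinom d) : {ffun 'I_d -> 'I_p} := [ffun j => modord charK (m j)].
pose hi (m : multinom d) : multinom d := Multinom [tuple (m i %/ p)%N | i < d].
pose G (F : mpoly d k) i := \sum_(m <- msupp F | lo m == i) r (mcoeff m F) *: mpolyX k (hi m).
have lohi m m' : lo m = lo m' -> hi m = hi m' -> m = m'.
  move=> /ffunP el eh; apply/mnmP => j; have := el j; rewrite !ffunE => /(congr1 val) /= ej.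
  have := congr1 (fun m => fun_of_multinom m j) eh; rewrite !mnmE => e.
  by rewrite (divn_eq (m j) p) (divn_eq (m' j) p) e ej.
have eG (F : mpoly d k) : mmap iota t F = plin t (fun i => mmap iota t (G F i)).
  rewrite /mmap (partition_big lo xpredT) //= /plin; apply: eq_bigr => i _.
  rewrite -/(mmap iota t (G F i)) /G rmorph_sum /= frob_sum // mulr_suml.
  apply: eq_bigr => m /eqP <-; rewrite mmapZ mmapX !mmap1_mon (mon_divmod charK).
  rewrite exprMn -rmorphXn hr mulrA; congr (_ * _ ^+ p * _).
  by apply: eq_mon => j; rewrite mnmE.
have G0 (F : mpoly d k) : (forall i, G F i = 0) -> F = 0.
  move=> GF; apply/msuppnil0; case E: (msupp F) => [//|m s].
  have mF : m \in msupp F by rewrite E mem_head.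
  have := congr1 (mcoeff (hi m)) (GF (lo m)); rewrite mcoeff0 /G raddf_sum /=.
  rewrite big_mkcond (bigD1_seq m mF (msupp_uniq F)) /=.
  rewrite eqxx mcoeffZ mcoeffX eqxx mulr1 big1 ?addr0 => [e|m' m'm]; last first.
    case: eqP => // lm; rewrite mcoeffZ mcoeffX; case: eqP => [eh|]; last by rewrite mulr0.
    by case/eqP: m'm; apply: lohi.
  have := hr (mcoeff m F); rewrite e expr0n (gtn_eqF p_gt0) => e0.
  by move: mF; rewrite mcoeff_msupp -e0 eqxx.
have Gsupp (F : mpoly d k) i m' : m' \in msupp (G F i) -> exists2 m, m \in msupp F & m' = hi m.
  rewrite mcoeff_msupp /G raddf_sum /= => h; apply: contrapT => none.
  case/eqP: h; rewrite big_seq_cond big1 // => m /andP[mF _].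
  rewrite mcoeffZ mcoeffX; case: eqP => [e|]; last by rewrite mulr0.
  by case: none; exists m.
have mdeg_hi m : (mdeg (hi m) * 2 <= mdeg m)%N.
  rewrite !mdegE big_distrl leq_sum // => j _; rewrite mnmE.
  by apply: leq_trans (leq_trunc_div (m j) p); rewrite leq_mul2l prime_gt1 ?orbT.
suff H n (F : mpoly d k) : (forall m, m \in msupp F -> (mdeg m <= n)%N) ->
    mmap iota t F = 0 -> F = 0.
  move=> F; apply: (H (\max_(m <- msupp F) mdeg m)) => m mF.
  exact: leq_bigmax_seq.
elim: n F => [|n IH] F hF F0.
  have [c eF] : exists c, F = mpolyC d c.
    exists (mcoeff mnm0 F); rewrite {1}(mpolyE F).
    apply/mpolyP => m; rewrite -mpolyE mcoeffC.
    case: eqP => [->|m0]; first by rewrite mulr1.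
    rewrite mulr0; apply/eqP; rewrite mcoeff_eq0; apply/negP => /hF.
    by rewrite leqn0 mdeg_eq0 => /eqP.
  move: F0; rewrite eF mmapC => /eqP; rewrite fmorph_eq0 => /eqP ->.
  by rewrite mpolyC0.
apply: G0 => i; apply: IH; last by have := F0; rewrite eG => /ht ->.
move=> m' /Gsupp[m mF ->]; have := mdeg_hi m; have := hF m mF; lia.
Qed.

End AlgIndep.

(** * Elements with no multiple in a given subring *)

Section Avoid.

Variable A : comNzRingType.

Definition evalp (B : nzRingType) (beta : {rmorphism B -> A}) (x : A) : {poly B} -> A :=
  horner_eval x \o map_poly beta.

HB.instance Definition _ (B : nzRingType) (beta : {rmorphism B -> A}) (x : A) :=
  GRing.RMorphism.on (evalp beta x).

Lemma evalpC (B : nzRingType) (beta : {rmorphism B -> A}) (x : A) b :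
  evalp beta x b%:P = beta b.
Proof. by rewrite /evalp /= /horner_eval map_polyC hornerC. Qed.

Lemma evalpX (B : nzRingType) (beta : {rmorphism B -> A}) (x : A) :
  evalp beta x 'X = x.
Proof. by rewrite /evalp /= /horner_eval map_polyX hornerX. Qed.

Definition inj0 (B : nzRingType) (beta : B -> A) : Prop :=
  forall b, beta b = 0 -> b = 0.

Definition algebraic_over (B : nzRingType) (beta : {rmorphism B -> A}) (x : A) :=
  exists2 q : {poly B}, q != 0 & evalp beta x q = 0.

Lemma evalp_swap (B : nzRingType) (beta : {rmorphism B -> A}) x y
    (u : {poly {poly B}}) :
  evalp (evalp beta x) y u = evalp (evalp beta y) x (swapXY u).
Proof.
rewrite /evalp /= /horner_eval.
have e z (v : {poly {poly B}}) : map_poly (fun p => (map_poly beta p).[z]) v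
   = map_poly (horner_eval z) (map_poly (map_poly beta) v).
  by rewrite -map_poly_comp.
by rewrite !e -!horner_swapXY -swapXY_map swapXYK horner2_swapXY.
Qed.

(** An entry of [xs] transcendental over the current B[x] is adjoined to B as a variable; x stays
    transcendental, since the two variables may be swapped. In effect x is completed to a
    transcendence basis taken from [xs]. *)
Lemma tower (xs : seq A) (B : idomainType) (beta : {rmorphism B -> A}) (x : A) :
  inj0 (evalp beta x) ->
  exists (B' : idomainType) (beta' : {rmorphism B' -> A}) (j : {rmorphism B -> B'}),
    [/\ forall b, beta' (j b) = beta b, inj0 (evalp beta' x)
      & forall y, y \in xs -> algebraic_over (evalp beta' x) y].
Proof.
elim: xs B beta => [|y ys IH] B beta hx.
  by exists B, beta, idfun; split.
have [[q q0 qy]|nalg] := pselect (algebraic_over (evalp beta x) y).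
  have [B' [beta' [j [hj hx' alg]]]] := IH B beta hx.
  exists B', beta', j; split=> // z; rewrite inE => /orP[/eqP ->|]; last exact: alg.
  have jinj : injective j.
    apply: raddf_inj => b jb; have : beta b = 0 by rewrite -hj jb rmorph0.
    by rewrite -(evalpC beta x) => /hx/eqP; rewrite polyC_eq0 => /eqP.
  exists (map_poly (map_poly j) q); first rewrite raddf_eq0 //.
    by apply: map_inj_poly; [apply: map_inj_poly => //; apply: rmorph0 | apply: rmorph0].
  rewrite -qy /evalp /= /horner_eval -map_poly_comp; congr (_.[_]).
  apply: eq_map_poly => p; rewrite /= /evalp /= /horner_eval -map_poly_comp; congr (_.[_]).
  by apply: eq_map_poly => b /=; rewrite hj.
pose beta1 : {rmorphism {poly B} -> A} := evalp beta y.
have hx1 : inj0 (evalp beta1 x).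
  move=> u; rewrite /beta1 evalp_swap => eu; apply/eqP; rewrite -swapXY_eq0.
  by apply: contrapT => /negP u0; apply: nalg; exists (swapXY u).
have [B' [beta' [j [hj hx' alg]]]] := IH _ beta1 hx1.
exists B', beta', (j \o @polyC B : {rmorphism B -> B'}); split=> //= [b|z].
  by rewrite hj; apply: evalpC.
rewrite inE => /orP[/eqP ->|]; last exact: alg.
exists ('X - (j 'X)%:P%:P); first by rewrite polyXsubC_eq0.
rewrite rmorphB /= evalpX evalpC /= evalpC hj; have -> : beta1 'X = y by apply: evalpX.
by rewrite subrr.
Qed.

Lemma algebraic_integral (B : idomainType) (beta : {rmorphism B -> A}) y :
  inj0 beta -> algebraic_over beta y ->
  exists2 c : B, c != 0 & integralOver beta (beta c * y).
Proof.
move=> hb [q q0 qy]; pose c := lead_coef q; exists c; first by rewrite lead_coef_eq0.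
have sq : (1 < size q)%N.
  rewrite ltnNge; apply/negP => /size1_polyC eq; case/eqP: q0.
  by move: qy; rewrite eq evalpC => /hb ->.
pose n := (size q).-1.
have nP : n.+1 = size q by rewrite prednK // ltnW.
have n0 : (0 < n)%N by rewrite -ltnS nP.
(* This is c^(n-1) q, rewritten as a monic polynomial in c y. *)
pose r := 'X^n + \poly_(i < n) (c ^+ (n.-1 - i) * q`_i).
have sr : (size (\poly_(i < n) (c ^+ (n.-1 - i)%N * q`_i))%R <= n)%N by apply: size_poly.
exists r.
  rewrite monicE lead_coefDl ?lead_coefXn // size_polyXn ltnS //.
rewrite /r rootE rmorphD /= map_polyXn hornerD hornerXn.
rewrite (_ : map_poly beta _ = \poly_(i < n) beta (c ^+ (n.-1 - i) * q`_i)); last first.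
  by apply/polyP => i; rewrite coef_map /= !coef_poly; case: ifP => // _; rewrite rmorph0.
rewrite horner_poly.
have : beta c ^+ n.-1 * evalp beta y q = 0 by rewrite qy mulr0.
rewrite /evalp /= /horner_eval /map_poly horner_poly -nP big_ord_recr /=.
have -> : q`_n = c by [].
rewrite addrC mulrDr mulrA -exprSr prednK // -exprMn => e0; rewrite -[X in _ == X]e0 mulr_sumr.
apply/eqP; congr (_ + _); apply: eq_bigr => i _.
have -> : (n.-1 = (n.-1 - i) + i)%N by rewrite subnK // -ltnS prednK.
by rewrite addnK rmorphM rmorphXn exprMn exprD; ring.
Qed.

Variables (k : fieldType) (kappa : {rmorphism k -> A}) (xs : seq A).
Hypothesis Agen : forall P : set A, (forall c, P (kappa c)) ->
  (forall y, y \in xs -> P y) -> (forall a b, P a -> P b -> P (a - b)) ->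
  (forall a b, P a -> P b -> P (a * b)) -> forall a, P a.

(* After enlarging [B] the ring [A] is algebraic over [B'[x]], hence integral
   after inverting some [C] in [B'[x]].  If [1 + x C] divided a nonzero [b] in
   [B'], then [1 + x C] would divide a power of [C b] in [B'[x]], hence a power
   of [b], as it is prime to [C]. *)
Lemma exists_avoid (B : idomainType) (beta : {rmorphism B -> A}) (x : A) :
  inj0 (evalp beta x) -> (forall c, exists b, kappa c = beta b) ->
  exists2 a : A, a != 0 & forall b, b != 0 -> forall z, a * z != beta b.
Proof.
move=> hx hk; have [B' [beta' [j [hj hx' alg]]]] := tower xs hx.
pose gam : {rmorphism {poly B'} -> A} := evalp beta' x.
have [C C0 hC] : exists2 C : {poly B'}, C != 0 &
    forall y, y \in xs -> integralOver gam (gam C * y).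
  elim: (xs) alg => [|y ys IH] alg; first by exists 1; rewrite ?oner_eq0.
  have [C C0 hC] := IH (fun z zs => alg z (mem_behead (s := y :: ys) zs)).
  have [c c0 hc] := algebraic_integral hx' (alg y (mem_head _ _)).
  exists (c * C); first by rewrite mulf_neq0.
  move=> z; rewrite inE => /orP[/eqP ->|zs]; rewrite rmorphM.
    by rewrite mulrAC mulrC; apply: integral_mul hc; apply: integral_id.
  by rewrite -mulrA; apply: integral_mul (hC z zs); apply: integral_id.
have intX c N : integralOver gam (gam c ^+ N) by rewrite -rmorphXn; apply: integral_id.
have hA z : exists N, integralOver gam (gam C ^+ N * z).
  move: z; apply: Agen => [c|y /hC ?|a b [N hN] [M hM]|a b [N hN] [M hM]].
  - exists 0%N; rewrite mul1r; have [b ->] := hk c.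
    by rewrite -hj -(evalpC beta' x); apply: (integral_id gam).
  - by exists 1%N.
  - exists (N + M)%N; rewrite mulrBr {1}addnC !exprD -!mulrA.
    by apply: integral_sub; apply: integral_mul.
  - exists (N + M)%N; rewrite exprD mulrACA; exact: integral_mul.
pose a0 : {poly B'} := 1 + 'X * C.
have sa0 : (1 < size a0)%N.
  rewrite /a0 addrC size_polyDl ?size_poly1 ?(mulrC 'X) size_mulX // ?ltnS ?size_poly_gt0 //.
exists (gam a0).
  by apply/eqP => /hx' a00; rewrite a00 size_poly0 in sa0.
move=> b b0 z; apply/eqP => az.
pose s : {poly B'} := (j b)%:P.
have gs : gam s = gam a0 * z by rewrite az -hj; apply: evalpC.
have s0 : s != 0.
  rewrite polyC_eq0; apply: contraNneq b0 => jb.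
  have : beta b = 0 by rewrite -hj jb rmorph0.
  by rewrite -(evalpC beta x) => /hx/eqP; rewrite polyC_eq0.
have [N [r rm]] := hA z; rewrite rootE => /eqP rz.
pose m := (size r).-1.
have rP : size r = m.+1 by rewrite prednK // size_poly_gt0 monic_neq0.
(* The equation of degree m for C^N z is multiplied by a0^m. Since a0 z = s holds in A, every term
   but the leading one, (C^N s)^m, keeps a factor a0. *)
have [U eU] : exists U, a0 * U = (C ^+ N * s) ^+ m.
  exists (- \sum_(i < m) r`_i * (C ^+ N * s) ^+ i * a0 ^+ (m - i).-1).
  apply/eqP; rewrite mulrN eq_sym -subr_eq0 opprK; apply/eqP/hx'.
  rewrite -/gam -[RHS](mulr0 (gam a0 ^+ m)) -rz.
  rewrite /map_poly horner_poly rP big_ord_recr /=.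
  have -> : r`_m = 1 by apply/eqP; rewrite -[m]/((size r).-1) -lead_coefE -monicE.
  rewrite rmorph1 mul1r mulrDr addrC rmorphD -/gam; congr (_ + _); last first.
    by rewrite rmorphXn rmorphM gs rmorphXn -exprMn; congr (_ ^+ _); ring.
  rewrite !mulr_sumr rmorph_sum; apply: eq_bigr => i _ /=.
  rewrite !rmorphM !rmorphXn rmorphM gs rmorphXn.
  have -> : gam a0 ^+ m = gam a0 * gam a0 ^+ (m - i).-1 * gam a0 ^+ i.
    by rewrite -exprS prednK ?subn_gt0 // -exprD subnK // ltnW.
  by rewrite !exprMn; ring.
(* Modulo a0 the element X C is -1, so that multiplying by X^(N m) removes the power of C. *)
have XC e : exists V, ('X * C) ^+ e = a0 * V + (-1) ^+ e.
  elim: e => [|e [V IH]]; first by exists 0; rewrite mulr0 add0r.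
  exists ('X * C * V + (-1) ^+ e); rewrite exprS IH exprS /a0; ring.
have [V eV] := XC (N * m)%N.
have [Y eY] : exists Y, a0 * Y = s ^+ m.
  exists ((-1) ^+ (N * m) * ('X ^+ (N * m) * U - V * s ^+ m)).
  have -> : a0 * ((-1) ^+ (N * m) * ('X ^+ (N * m) * U - V * s ^+ m))
     = (-1) ^+ (N * m) * ('X ^+ (N * m) * (a0 * U) - a0 * V * s ^+ m) by ring.
  rewrite eU exprMn -exprM mulrA -exprMn eV mulrDl addrAC subrr add0r mulrA.
  by rewrite -exprMn mulrNN mulr1 expr1n mul1r.
have : (size (s ^+ m)) = 1%N by rewrite /s -rmorphXn size_polyC expf_neq0 // -polyC_eq0.
rewrite -eY; have Y0 : Y != 0.
  by apply: contraNneq s0 => Y0; move: eY; rewrite Y0 mulr0 => /esym/eqP; rewrite expf_eq0 => /andP[].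
have a00 : a0 != 0 by rewrite -size_poly_gt0 ltnW.
rewrite size_mul //; move: sa0 Y0; rewrite -size_poly_gt0.
by case: (size Y) => // y; case: (size a0) => [//|[//|w]] _ _; rewrite addnS.
Qed.

End Avoid.

(** * Prime ideals and chains of primes *)

Section Primes.

Variable R : comNzRingType.

Definition ring_ideal (I : set R) : Prop :=
  [/\ I 0, forall a b, I a -> I b -> I (a + b) & forall a b, I b -> I (a * b)].

Definition ring_prime (I : set R) : Prop :=
  [/\ ring_ideal I, ~ I 1 & forall a b, I (a * b) -> I a \/ I b].

Lemma ideal_oppr (I : set R) a : ring_ideal I -> I a -> I (- a).
Proof. by case=> _ _ IM Ia; rewrite -mulN1r; apply: IM. Qed.

Definition adj_ideal (I : set R) (a : R) : set R :=
  [set x | exists2 y, I y & exists z, x = y + a * z].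

Lemma adj_idealP (I : set R) a : ring_ideal I ->
  [/\ ring_ideal (adj_ideal I a), I `<=` adj_ideal I a & adj_ideal I a a].
Proof.
move=> [I0 ID IM]; split; first split.
- by exists 0 => //; exists 0; rewrite mulr0 addr0.
- move=> _ _ [y Iy [z ->]] [y' Iy' [z' ->]]; exists (y + y'); first exact: ID.
  by exists (z + z'); ring.
- move=> b _ [y Iy [z ->]]; exists (b * y); first exact: IM.
  by exists (b * z); ring.
- by move=> x Ix; exists x => //; exists 0; rewrite mulr0 addr0.
- by exists 0 => //; exists 1; rewrite mulr1 add0r.
Qed.

(** An ideal maximal among those that contain [I] and avoid [M] is prime. *)
Lemma prime_avoiding (I M : set R) : ring_ideal I -> M 1 ->
  (forall a b, M a -> M b -> M (a * b)) -> (forall a, I a -> ~ M a) ->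
  exists2 P, ring_prime P & I `<=` P /\ forall a, P a -> ~ M a.
Proof.
move=> hI M1 MM hIM.
pose good J := [/\ ring_ideal J, I `<=` J & forall a, J a -> ~ M a].
have [|P [hP maxP]] := @Zorn_bigcup R [set J | J = set0 \/ good J].
  move=> F FP tot; have [[J [FJ gJ]]|none] := pselect (exists J, F J /\ good J); last first.
    left; apply/seteqP; split=> // a [J FJ Ja].
    have [eJ|gJ] := FP _ FJ; first by rewrite eJ in Ja.
    by case: none; exists J.
  right; have [[J0 JD JM] IJ dJ] := gJ; split; first split.
  - by exists J.
  - move=> a b [J1 FJ1 J1a] [J2 FJ2 J2b].
    have [J1e|[[_ D1 _] _ _]] := FP _ FJ1; first by rewrite J1e in J1a.
    have [J2e|[[_ D2 _] _ _]] := FP _ FJ2; first by rewrite J2e in J2b.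
    by have [s|s] := tot _ _ FJ1 FJ2; [exists J2 => //; apply: D2 => //; apply: s
      | exists J1 => //; apply: D1 => //; apply: s].
  - move=> a b [J1 FJ1 J1b]; exists J1 => //.
    by have [J1e|[[_ _ M1'] _ _]] := FP _ FJ1; [rewrite J1e in J1b | apply: M1'].
  - by apply: subset_trans IJ _; apply: bigcup_sup.
  - move=> a [J1 FJ1 J1a].
    by have [J1e|[_ _ d1]] := FP _ FJ1; [rewrite J1e in J1a | apply: d1].
have gI : good I by split.
have [[P0 PD PM] IP dP] : good P.
  case: hP => // P0; case: (maxP I); last by right.
  by rewrite P0; split=> // s; case: hI => I0 _ _; have := s 0 I0.
have maxP' a : ~ P a -> exists2 b, P b & exists z, M (b + a * z).
  move=> nPa; have [hJ PJ Ja] := @adj_idealP P a (And3 P0 PD PM).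
  apply: contrapT => none; apply: (maxP (adj_ideal P a)).
    by split=> // s; apply: nPa; apply: s.
  right; split=> //; first exact: subset_trans IP PJ.
  by move=> _ [b Pb [z ->]] Mb; apply: none; exists b => //; exists z.
exists P => //; split=> //; first by move=> /dP /(_ M1).
move=> a b Pab; apply: contrapT => /not_orP[/maxP'[x Px [z Mz]] /maxP'[x' Px' [z' Mz']]].
apply: (dP _ _ (MM _ _ Mz Mz')).
have -> : (x + a * z) * (x' + b * z') = (x' + b * z') * x + (a * z) * x' + (z * z') * (a * b) by ring.
by apply: (PD); [apply: PD|]; apply: PM.
Qed.

End Primes.

Section Quotient.

Variables (R : comNzRingType) (I : set R).
Hypothesis hI : ring_ideal I.
Hypothesis I1 : ~ I 1.

Definition ideal_pred : pred R := fun x => `[< I x >].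

Lemma ideal_pred_closed : idealr_closed ideal_pred.
Proof.
have [I0 ID IM] := hI; split; first exact/asboolP.
  by apply/negP => /asboolP.
move=> a x y /asboolP Ix /asboolP Iy; apply/asboolP.
by apply: ID => //; apply: IM.
Qed.

HB.instance Definition _ := isIdealr.Build R ideal_pred ideal_pred_closed.

Let idl : idealr R := ideal_pred.

Let Q : comNzRingType := {ideal_quot idl}.
Let pr : {rmorphism R -> Q} := \pi_({ideal_quot idl})%qT.

Lemma ideal_quotient : exists (Q : comNzRingType) (pr : {rmorphism R -> Q}),
  (forall q, exists a, q = pr a) /\ forall a, pr a = 0 <-> I a.
Proof.
exists Q, pr; split=> [q|a].
  exists (repr (q : {ideal_quot idl})); exact/esym/reprK.
have -> : (pr a = 0) = (pr a = pr 0) by rewrite rmorph0.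
split=> [/eqP|Ia].
  by rewrite /pr /= -Quotient.idealrBE subr0 => /asboolP.
by apply/eqP; rewrite /pr /= -Quotient.idealrBE subr0; apply/asboolP.
Qed.

End Quotient.

Section Chains.

Lemma mmap_comp (k : fieldType) (S T : comNzRingType) d (f : {rmorphism k -> S})
    (g : {rmorphism S -> T}) (h : 'I_d -> S) q :
  g (mmap f h q) = mmap (g \o f) (g \o h) q.
Proof.
rewrite /mmap rmorph_sum; apply: eq_bigr => m _; rewrite rmorphM /mmap1 rmorph_prod.
by congr (_ * _); apply: eq_bigr => i _; rewrite rmorphXn.
Qed.

Lemma mmap_mwiden (k : fieldType) (S : comNzRingType) d (f : {rmorphism k -> S})
    (h : 'I_d.+1 -> S) q :
  mmap f h (mwiden q) = mmap f (h \o widen_ord (leqnSn d)) q.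
Proof.
rewrite {1}[q]mpolyE [mwiden _]raddf_sum rmorph_sum [RHS]/mmap.
apply: eq_bigr => m _ /=; rewrite mwidenZ mmapZ mwidenX mmapX; congr (_ * _).
rewrite /mmap1 big_ord_recr /= mnmwiden_ordmax expr0 mulr1.
by apply: eq_bigr => i _; rewrite mnmwiden_widen.
Qed.

Lemma mmap_mmulti (k : fieldType) (S : comNzRingType) d (f : {rmorphism k -> S})
    (h : 'I_d.+1 -> S) (q : {poly mpoly d k}) :
  mmap f h (mmulti q)
  = (map_poly (mmap f (h \o widen_ord (leqnSn d))) q).[h ord_max].
Proof.
rewrite /map_poly horner_poly /mmulti rmorph_sum; apply: eq_bigr => i _.
rewrite rmorphM rmorphXn /= mmap_mwiden mmapX; congr (_ * _ ^+ _).
exact: mmap1U.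
Qed.

(** Evaluation at the polynomial variable in the last place, and at constants elsewhere, is a left
    inverse of [mmulti]. *)
Lemma mmulti_inj (k : fieldType) d (q : {poly mpoly d k}) : mmulti q = 0 -> q = 0.
Proof.
move=> q0; pose h (j : 'I_d.+1) : {poly mpoly d k} :=
  if unlift ord_max j is Some i then (mpolyX k (mnm1 i))%:P else 'X.
pose f : {rmorphism k -> {poly mpoly d k}} := polyC \o @mpolyC d k.
have hw i : h (widen_ord (leqnSn d) i) = (mpolyX k (mnm1 i))%:P.
  rewrite /h; have -> : widen_ord (leqnSn d) i = lift ord_max i.
    by apply/val_inj; rewrite /= /bump leqNgt ltn_ord.
  by rewrite liftK.
have fh u : mmap f (h \o widen_ord (leqnSn d)) u = u%:P.
  rewrite {2}[u]mpolyE rmorph_sum; apply: eq_bigr => m _ /=.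
  rewrite -mul_mpolyC rmorphM; congr (_ * _).
  rewrite mpolyXE_id rmorph_prod /mmap1; apply: eq_bigr => i _.
  by rewrite /= hw rmorphXn.
have := mmap_mmulti f h q; rewrite q0 rmorph0 /h unlift_none (eq_map_poly fh).
by rewrite -[_.['X]]/(q \Po 'X) comp_polyXr.
Qed.

(* Primes lying above [I] are found one variable at a time: if the variables
   are algebraically independent modulo [I], some prime strictly above [I] meets
   no nonzero polynomial in all of them but the last. *)
Lemma prime_chain (k : fieldType) (R : comNzRingType) (kappa : {rmorphism k -> R})
    (xs : seq R)
    (Rgen : forall P : set R, (forall c, P (kappa c)) ->
      (forall y, y \in xs -> P y) -> (forall a b, P a -> P b -> P (a - b)) ->
      (forall a b, P a -> P b -> P (a * b)) -> forall a, P a)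
    d (I : set R) (T : 'I_d -> R) :
  ring_prime I -> (forall F : mpoly d k, I (mmap kappa T F) -> F = 0) ->
  exists c : nat -> set R, [/\ c 0%N = I,
    forall i, (i <= d)%N -> ring_prime (c i)
    & forall i, (i < d)%N -> c i `<=` c i.+1 /\ ~ (c i.+1 `<=` c i)].
Proof.
elim: d I T => [|d IH] I T hI hT.
  by exists (fun _ => I); split.
have [[I0 ID IM] I1 Ip] := hI.
have [Q [pr [prs pr0]]] := ideal_quotient (And3 I0 ID IM) I1.
pose T' := T \o widen_ord (leqnSn d).
pose kQ : {rmorphism k -> Q} := pr \o kappa.
pose beta : {rmorphism mpoly d k -> Q} := mmap kQ (pr \o T').
have betaE F : beta F = pr (mmap kappa T' F) by rewrite mmap_comp.
have hx : inj0 (evalp beta (pr (T ord_max))).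
  move=> u u0; apply: mmulti_inj; apply: hT; apply/pr0.
  rewrite mmap_comp mmap_mmulti -[RHS]u0; congr (_.[_]).
have gen : forall P : set Q, (forall c, P (kQ c)) ->
      (forall y, y \in map pr xs -> P y) -> (forall a b, P a -> P b -> P (a - b)) ->
      (forall a b, P a -> P b -> P (a * b)) -> forall a, P a.
  move=> P Pc Px PB PM q; have [a ->] := prs q; move: a; apply: Rgen => //.
  - by move=> y yx; apply: Px; apply: map_f.
  - by move=> a b Pa Pb; rewrite rmorphB; apply: PB.
  - by move=> a b Pa Pb; rewrite rmorphM; apply: PM.
(* No multiple of q in R/I is the value of a nonzero polynomial in the first d variables. The ideal
   generated by I and a lift of q can therefore be enlarged to a prime modulo which they remain
   independent. *)
have [|q q0 hq] := exists_avoid gen hx.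
  by move=> c; exists (mpolyC d c); rewrite /beta /= mmapC.
have [a ea] := prs q; have Ia : ~ I a by move=> /pr0; rewrite -ea => /eqP; rewrite (negPf q0).
have [J_id IJ Ja] := adj_idealP a (And3 I0 ID IM).
pose M := [set b | exists2 F : mpoly d k, F != 0 & b = mmap kappa T' F].
have [||b|P hP [JP dP]] := prime_avoiding (I := adj_ideal I a) (M := M) J_id.
- by exists 1; rewrite ?oner_eq0 // rmorph1.
- move=> _ _ [F F0 ->] [G G0 ->]; exists (F * G); first by rewrite mulf_neq0.
  by rewrite rmorphM.
- move=> [y Iy [z ->]] [F F0 eF]; have := hq F F0 (pr z).
  by rewrite betaE -eF rmorphD rmorphM -ea (proj2 (pr0 y) Iy) add0r eqxx.
have [F|c [c0 hc1 hc2]] := IH P T' hP.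
  by move=> PF; apply/eqP; apply: contrapT => /negP F0; apply: (dP _ PF); exists F.
exists (fun i => if i is i'.+1 then c i' else I); split=> // [[|i] //|[|i] hi].
- exact: hc1.
- rewrite c0; split; first exact: subset_trans IJ JP.
  by move=> PI; apply: Ia; apply: PI; apply: JP.
- exact: hc2.
Qed.

End Chains.

(** * Hilbert's basis theorem *)

Section Hilbert.

(* Generation by [s] is expressed through the ideals containing [s], which
   avoids linear combinations. *)
Definition fin_gen (R : comNzRingType) (I : set R) : Prop :=
  exists2 s : seq R, (forall a, a \in s -> I a) &
    forall J, ring_ideal J -> (forall a, a \in s -> J a) -> I `<=` J.

Definition noetherian (R : comNzRingType) : Prop :=
  forall I : set R, ring_ideal I -> fin_gen I.

Definition lead_ideal (R : comNzRingType) (I : set {poly R}) (n : nat) : set R :=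
  [set a | exists f, [/\ I f, (size f <= n.+1)%N & f`_n = a]].

Lemma lead_idealP (R : comNzRingType) (I : set {poly R}) n :
  ring_ideal I -> ring_ideal (lead_ideal I n).
Proof.
move=> [I0 ID IM]; split.
- by exists 0; rewrite size_poly0 coef0.
- move=> _ _ [f [If sf <-]] [g [Ig sg <-]]; exists (f + g); rewrite coefD; split=> //.
    exact: ID.
  by rewrite (leq_trans (size_polyD _ _)) // geq_max sf sg.
- move=> a _ [f [If sf <-]]; exists (a%:P * f); rewrite coefCM; split=> //.
    exact: IM.
  by rewrite mul_polyC (leq_trans (size_scale_leq _ _)).
Qed.

Lemma lead_ideal_le (R : comNzRingType) (I : set {poly R}) n m :
  ring_ideal I -> (n <= m)%N -> lead_ideal I n `<=` lead_ideal I m.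
Proof.
move=> [I0 ID IM] nm _ [f [If sf <-]]; exists ('X^(m - n) * f); split.
- exact: IM.
- rewrite (leq_trans (size_polyMleq _ _)) // size_polyXn addSn /=.
  by rewrite (leq_trans (leq_add (leqnn _) sf)) // addnS subnK.
- by rewrite coefXnM ltnNge leq_subr /= subKn.
Qed.

(** The classical argument: the ideals of leading coefficients increase with the degree and are
    constant from some N on; polynomials lifting their generators up to degree N generate [I], by
    induction on the degree of the element. *)
Lemma hilbert_basis (R : comNzRingType) : noetherian R -> noetherian {poly R}.
Proof.
move=> hR I hI; have [I0 ID IM] := hI.
have lift_seq n (s : seq R) : (forall a, a \in s -> lead_ideal I n a) ->
    exists2 l : seq {poly R}, (forall f, f \in l -> I f) &
    forall J : set {poly R}, (forall f, f \in l -> J f) ->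
      forall a, a \in s -> lead_ideal (I `&` J) n a.
  elim: s => [|a s IH] hs; first by exists [::].
  have [l lI hl] := IH (fun b bs => hs b (mem_behead (s := a :: s) bs)).
  have [f [If sf fa]] := hs a (mem_head _ _).
  exists (f :: l) => [g|J hJ b]; first by rewrite inE => /orP[/eqP ->|/lI].
  rewrite inE => /orP[/eqP ->|bs].
    by exists f; split=> //; split=> //; apply: hJ; rewrite mem_head.
  by apply: hl => // g gl; apply: hJ; rewrite inE gl orbT.
have step n : exists2 l : seq {poly R}, (forall f, f \in l -> I f) &
    forall J, ring_ideal J -> (forall f, f \in l -> J f) ->
      lead_ideal I n `<=` lead_ideal (I `&` J) n.
  have [s sI hs] := hR _ (lead_idealP n hI).
  have [l lI hl] := lift_seq n s sI.
  exists l => // J [J0 JD JM] lJ; apply: hs; last exact: hl.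
  apply: lead_idealP; split; first by split.
  - by move=> a b [Ia Ja] [Ib Jb]; split; [apply: ID|apply: JD].
  - by move=> a b [Ib Jb]; split; [apply: IM|apply: JM].
pose L := [set a | exists n, lead_ideal I n a].
have hL : ring_ideal L.
  split; first by exists 0%N; case: (lead_idealP 0 hI).
  - move=> a b [n Ia] [m Ib]; exists (maxn n m).
    have [_ LD _] := lead_idealP (maxn n m) hI; apply: LD.
      exact: (lead_ideal_le hI (leq_maxl n m)).
    exact: (lead_ideal_le hI (leq_maxr n m)).
  - by move=> a b [n Ib]; exists n; have [_ _ LM] := lead_idealP n hI; apply: LM.
have [s sL hs] := hR _ hL.
have [N hN] : exists N, forall a, a \in s -> lead_ideal I N a.
  elim: (s) sL => [|a t IH] tL; first by exists 0%N.
  have [N hN] := IH (fun b bt => tL b (mem_behead (s := a :: t) bt)).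
  have [n hn] := tL a (mem_head _ _).
  exists (maxn n N) => b; rewrite inE => /orP[/eqP ->|/hN].
    exact: (lead_ideal_le hI (leq_maxl n N)).
  exact: (lead_ideal_le hI (leq_maxr n N)).
have LN : L `<=` lead_ideal I N by apply: hs => //; apply: lead_idealP.
have /choice[l hl] : forall n, exists l : seq {poly R}, (forall f, f \in l -> I f) /\
    forall J, ring_ideal J -> (forall f, f \in l -> J f) ->
      lead_ideal I n `<=` lead_ideal (I `&` J) n.
  by move=> n; have [l ? ?] := step n; exists l.
exists (flatten [seq l n | n <- iota 0 N.+1]) => [f /flatten_mapP[n _ /(proj1 (hl n))] //|J hJ sJ].
have [J0 JD JM] := hJ.
have lJ n : (n <= N)%N -> lead_ideal I n `<=` lead_ideal (I `&` J) n.
  move=> nN; apply: (proj2 (hl n)) => // f fl; apply: sJ; apply/flatten_mapP.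
  by exists n => //; rewrite mem_iota.
suff H m : forall f : {poly R}, (size f <= m)%N -> I f -> J f by move=> f; apply: (H _ _ (leqnn _)).
elim: m => [|m IH] f sf If.
  by move: sf; rewrite leqn0 size_poly_eq0 => /eqP ->.
have Lf : lead_ideal I m f`_m by exists f.
have [g [[Ig Jg] sg gf]] : lead_ideal (I `&` J) m f`_m.
  have [mN|Nm] := leqP m N; first exact: lJ.
  have hIJ : ring_ideal (I `&` J).
    split; first by split.
    - by move=> a b [Ia Ja] [Ib Jb]; split; [apply: ID|apply: JD].
    - by move=> a b [Ib Jb]; split; [apply: IM|apply: JM].
  apply: (lead_ideal_le hIJ (ltnW Nm)); apply: lJ => //.
  by apply: LN; exists m.
rewrite -(subrK g f); apply: JD => //; apply: IH.
  apply/leq_sizeP => i mi; rewrite coefB; have [<-|im] := eqVneq m i.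
    by rewrite gf subrr.
  have {mi im} mi : (m < i)%N by rewrite ltn_neqAle im mi.
  by rewrite (leq_sizeP _ _ sf) // (leq_sizeP _ _ sg) // subrr.
by apply: ID => //; apply: ideal_oppr.
Qed.

Lemma noetherian_field (k : fieldType) : noetherian k.
Proof.
move=> I [I0 ID IM]; have [[a Ia a0]|none] := pselect (exists2 a, I a & a != 0).
  exists [:: a] => [b|J [J0 JD JM] aJ b _]; first by rewrite inE => /eqP ->.
  by rewrite -(mulfVK a0 b); apply: JM; apply: aJ; rewrite mem_head.
exists [::] => // J [J0 _ _] _ a Ia; have [->//|a0] := eqVneq a 0.
by case: none; exists a.
Qed.

(** T is a polynomial ring over k with one variable for each entry of [xs]. The last clause says
    that the image of [ev] is no larger than the subalgebra generated by [xs]. *)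
Lemma noetherian_cover (k : fieldType) (A : comNzRingType)
    (kappa : {rmorphism k -> A}) (xs : seq A) :
  exists (T : comNzRingType) (ev : {rmorphism T -> A}),
    [/\ noetherian T, forall c, exists t, kappa c = ev t,
        forall x, x \in xs -> exists t, x = ev t
      & forall P : set A, (forall c, P (kappa c)) ->
          (forall y, y \in xs -> P y) -> (forall a b, P a -> P b -> P (a - b)) ->
          (forall a b, P a -> P b -> P (a * b)) -> forall t, P (ev t)].
Proof.
elim: xs => [|x xs [T [ev [hT hk hx hP]]]].
  exists k, kappa; split=> //; [exact: noetherian_field|by move=> c; exists c].
exists {poly T}, (evalp ev x : {rmorphism {poly T} -> A}); split.
- exact: hilbert_basis.
- by move=> c; have [t ->] := hk c; exists t%:P; rewrite /= evalpC.
- move=> y; rewrite inE => /orP[/eqP ->|/hx[t ->]]; first by exists 'X; rewrite /= evalpX.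
  by exists t%:P; rewrite /= evalpC.
move=> P Pk Px PB PM t.
have Pev : forall t, P (ev t).
  by apply: hP => // y yx; apply: Px; rewrite inE yx orbT.
have PD a b : P a -> P b -> P (a + b).
  move=> Pa Pb; rewrite -[b]opprK -[- b]sub0r; apply: (PB) => //; apply: PB => //.
  by have := Pev 0; rewrite rmorph0.
have Pxx : P x by apply: Px; rewrite mem_head.
elim/poly_ind: t => [|t c IH]; first by have := Pev 0; rewrite !rmorph0.
by rewrite rmorphD rmorphM /= evalpX evalpC; apply: PD => //; apply: PM.
Qed.

End Hilbert.

(** * Local rings of an integral scheme *)

Section Scheme.

Variables (K : fieldType) (X : integralScheme K).

(** The sheaf condition for the covering of U by U and V itself contains the restriction map. *)
Lemma sec_mono (U V : set X) : open U -> open V -> V !=set0 -> V `<=` U ->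
  sec U `<=` sec V.
Proof.
move=> oU oV nV VU f Uf; have nU : U !=set0 by have [x Vx] := nV; exists x; apply: VU.
have eU : \bigcup_(W in [set W | W = U \/ W = V]) W = U.
  apply/seteqP; split=> [x [W [->//|->] /VU //]|x Ux]; by exists U => //; left.
have := @sec_sheaf K X [set W | W = U \/ W = V].
rewrite eU => e; move: Uf; rewrite e => [h||W [->|->] //].
- by apply: h; right.
- by exists U; left.
Qed.

Lemma setI_open (U V : set X) : open U -> open V -> U !=set0 -> V !=set0 ->
  open (U `&` V) /\ (U `&` V) !=set0.
Proof. by move=> oU oV nU nV; split; [exact: openI | exact: space_irreducible]. Qed.

Lemma subring0 (A : set K) : is_subring A -> A 0.
Proof. by move=> [A1 AB _]; rewrite -(subrr 1); apply: AB. Qed.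

Lemma subringN (A : set K) a : is_subring A -> A a -> A (- a).
Proof. by move=> hA Aa; rewrite -sub0r; case: (hA) => _ AB _; apply: AB => //; apply: subring0. Qed.

Lemma subringD (A : set K) a b : is_subring A -> A a -> A b -> A (a + b).
Proof.
move=> hA Aa Ab; rewrite -[b]opprK; case: (hA) => _ AB _; apply: AB => //.
exact: subringN.
Qed.

Lemma subringX (A : set K) a n : is_subring A -> A a -> A (a ^+ n).
Proof.
by move=> [A1 _ AM] Aa; elim: n => [|n IH]; rewrite ?expr0 // exprS; apply: AM.
Qed.

Lemma subring_sum (A : set K) (I : Type) (r : seq I) (P : pred I) F :
  is_subring A -> (forall i, P i -> A (F i)) -> A (\sum_(i <- r | P i) F i).
Proof.
move=> hA hF; apply: big_ind => //; first exact: subring0.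
by move=> a b; apply: subringD.
Qed.

Lemma subring_prod (A : set K) (I : Type) (r : seq I) (P : pred I) F :
  is_subring A -> (forall i, P i -> A (F i)) -> A (\prod_(i <- r | P i) F i).
Proof. by move=> [A1 _ AM] hF; apply: big_ind. Qed.

Lemma subring_det (A : set K) d (M : 'M[K]_d) :
  is_subring A -> (forall i j, A (M i j)) -> A (\det M).
Proof.
move=> hA hM; apply: subring_sum => // s _; case: (hA) => A1 AB AM.
apply: AM; last exact: subring_prod.
by apply: subringX => //; apply: subringN.
Qed.

Lemma stalk_subring (x : X) : is_subring (stalk x).
Proof.
have op f g : stalk x f -> stalk x g ->
    exists U, [/\ open U, U x, sec U f & sec U g].
  move=> [U [oU Ux Uf]] [V [oV Vx Vg]]; exists (U `&` V).
  have [o n] : open (U `&` V) /\ (U `&` V) !=set0.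
    by apply: setI_open => //; exists x.
  by split=> //; [apply: (sec_mono oU) | apply: (sec_mono oV)].
split.
- have [U [[oU nU _] _] Ux] := locally_affine x; exists U; split=> //.
  by case: (sec_subring oU nU).
- move=> f g xf xg; have [U [oU Ux Uf Ug]] := op f g xf xg; exists U; split=> //.
  by case: (sec_subring oU) => [|_ UB _]; [exists x|apply: UB].
- move=> f g xf xg; have [U [oU Ux Uf Ug]] := op f g xf xg; exists U; split=> //.
  by case: (sec_subring oU) => [|_ _ UM]; [exists x|apply: UM].
Qed.

Lemma stalkM (x : X) f g : stalk x f -> stalk x g -> stalk x (f * g).
Proof. by case: (stalk_subring x) => _ _; apply. Qed.

Lemma stalk1 (x : X) : stalk x 1. Proof. by case: (stalk_subring x). Qed.

Lemma unit1 (x : X) : is_unit_in (stalk x) 1.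
Proof. by split; rewrite ?oner_neq0 ?invr1 //; apply: stalk1. Qed.

Lemma unitM (x : X) f g : is_unit_in (stalk x) f -> is_unit_in (stalk x) g ->
  is_unit_in (stalk x) (f * g).
Proof.
move=> [f0 xf xf'] [g0 xg xg']; split; rewrite ?mulf_neq0 ?invfM //; exact: stalkM.
Qed.

Lemma unitV (x : X) f : is_unit_in (stalk x) f -> is_unit_in (stalk x) f^-1.
Proof. by move=> [f0 xf xf']; split; rewrite ?invr_eq0 ?invrK. Qed.

Lemma unitMl (x : X) f g : stalk x f -> stalk x g ->
  is_unit_in (stalk x) (f * g) -> is_unit_in (stalk x) f.
Proof.
move=> xf xg [fg0 _ xfg]; have [f0 g0] : f != 0 /\ g != 0.
  by apply/andP; rewrite -negb_or -mulf_eq0.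
split=> //; have -> : f^-1 = g * (f * g)^-1 by rewrite invfM mulrCA mulfV ?mulr1.
exact: stalkM.
Qed.

Section Affine.

Variable U : set X.
Hypothesis hU : affine_open (@sec K X) U.

Let oU : open U. Proof. by case: hU => [[]]. Qed.
Let nU : U !=set0. Proof. by case: hU => [[]]. Qed.
Let hA : is_subring (sec U). Proof. exact: sec_subring. Qed.

Definition van (x : X) : set K := vanishing_ideal (@sec K X) U x.

Lemma sec_stalk x f : U x -> sec U f -> stalk x f.
Proof. by move=> Ux Uf; exists U. Qed.

Lemma van_prime x : U x -> is_prime_ideal (sec U) (van x).
Proof. by move: x; case: hU => [_ [[h _] _ _]]. Qed.

Lemma van_surj P : is_prime_ideal (sec U) P -> exists x, U x /\ van x = P.
Proof. by case: hU => [_ [[_ h] _ _]] /h [x [hx _]]; exists x. Qed.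

Lemma van_inj x y : U x -> U y -> van x = van y -> x = y.
Proof.
move=> Ux Uy e; case: hU => [_ [[_ h] _ _]].
have [z [_ uz]] := h _ (van_prime Uy).
by rewrite -(uz x) // -(uz y).
Qed.

Lemma closure_van x y : U x -> U y -> closure [set x] y <-> van x `<=` van y.
Proof.
move=> Ux Uy; have [_ [_ [oD bD] _]] := hU; split=> [cl f [Uf nf]|s].
  split=> // uf.
  have [z [-> [_ uz]]] := cl _ (open_nbhs_nbhs (conj (oD f Uf) (conj Uy uf))).
  exact: nf.
move=> B /=; rewrite nbhsE => -[V [oV Vy] VB].
have [f [Uf [_ uf] sf]] := bD (V `&` U) y (openI oV oU) (@subIsetr _ _ _) (conj Vy Uy).
exists x; split=> //; apply: VB; case: (sf x) => //; split=> //.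
apply: contrapT => nf; have [_ h] : van y f by apply: s.
exact: h.
Qed.

Lemma stalk_frac x f : U x -> stalk x f ->
  exists a b, [/\ sec U a, sec U b, is_unit_in (stalk x) b & f = a / b].
Proof.
move=> Ux [V [oV Vx Vf]]; have [_ [_ [oD bD] hD]] := hU.
have [h [Uh [_ uh] sh]] := bD (V `&` U) x (openI oV oU) (@subIsetr _ _ _) (conj Vx Ux).
have h0 : h != 0 by case: uh.
have : sec (nonvanishing_locus (@sec K X) U h) f.
  apply: (sec_mono oV) Vf; [exact: oD|by exists x|].
  by move=> y /sh [].
rewrite hD // => -[a [i [Ua ->]]]; exists a, (h ^+ i); split=> //.
  exact: subringX.
elim: i => [|i IH]; first by rewrite expr0; apply: unit1.
by rewrite exprS; apply: unitM.
Qed.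

Lemma zero_prime : is_prime_ideal (sec U) [set 0].
Proof.
split; split.
- by move=> _ ->; apply: subring0.
- by [].
- by move=> /eqP; rewrite oner_eq0.
- by move=> a b -> ->; rewrite addr0.
- by move=> a b _ ->; rewrite mulr0.
- by move=> a b _ _ /eqP; rewrite mulf_eq0 => /orP[] /eqP; [left|right].
Qed.

Lemma prime_chain_points m (c : nat -> set K) :
  (forall i, (i <= m)%N -> is_prime_ideal (sec U) (c i)) ->
  (forall i, (i < m)%N -> c i `<=` c i.+1 /\ ~ (c i.+1 `<=` c i)) ->
  exists2 pt : 'I_m.+1 -> X, is_chain pt & forall i : 'I_m.+1, U (pt i) /\ van (pt i) = c i.
Proof.
move=> cp cs.
have /choice[pt hpt] : forall i : 'I_m.+1, exists x, U x /\ van x = c i.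
  by move=> i; apply: van_surj; apply: cp; rewrite -ltnS.
exists pt => // i j ij.
have cmono n l : (l + n <= m)%N -> c l `<=` c (l + n)%N.
  elim: n => [|n IH] h; first by rewrite addn0.
  rewrite addnS in h *; apply: subset_trans (proj1 (cs _ h)); apply: IH; exact: ltnW.
have jm : (j <= m)%N by rewrite -ltnS.
have sij : c i `<=` c j by have := @cmono (j - i)%N i; rewrite subnKC ?(ltnW ij) //; apply.
have nij : ~ (c j `<=` c i).
  move=> s; case: (cs i); first exact: leq_trans ij jm.
  move=> _; apply; apply: subset_trans s.
  by have := @cmono (j - i.+1)%N i.+1; rewrite subnKC //; apply.
have [[Ui ei] [Uj ej]] := (hpt i, hpt j).
by rewrite !closure_van // ei ej.
Qed.

Lemma divisor_van_neq0 x : U x -> is_prime_divisor x -> exists2 f, van x f & f != 0.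
Proof.
move=> Ux [[c [hc cx]] _]; have [cl ncl] := hc ord0 ord_max isT.
move: cl ncl; rewrite cx; set y := c ord0 => cl ncl.
have Uy : U y by have [z [-> Uz]] := cl _ (open_nbhs_nbhs (conj oU Ux)).
move: cl ncl; rewrite !closure_van // => s ns.
have [f [xf yf]] : exists f, van x f /\ ~ van y f.
  by apply: contrapT => none; apply: ns => f xf; apply: contrapT => yf; apply: none; exists f.
exists f => //; apply/eqP => f0; apply: yf; rewrite f0.
by case: (van_prime Uy) => -[].
Qed.

(** Otherwise 0, Q and the ideal of x would be three distinct primes in a chain, contradicting
    codimension one. *)
Lemma divisor_van_minimal x Q : U x -> is_prime_divisor x -> is_prime_ideal (sec U) Q ->
  Q `<=` van x -> (exists2 f, Q f & f != 0) -> van x `<=` Q.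
Proof.
move=> Ux [_ nc] Qp Qx [f Qf f0]; apply: contrapT => nxQ; apply: nc.
pose c i : set K := if i is i'.+1 then if i' is _.+1 then van x else Q else [set 0].
have [||pt hpt ptc] := @prime_chain_points 2 c.
- by move=> [_|[_|i _]] /=; [exact: zero_prime| |exact: van_prime].
- move=> [_|[_|//]] /=; split=> //; first by move=> _ ->; case: Qp => -[].
  by move=> s; have := s f Qf => /= /eqP; rewrite (negPf f0).
exists pt; split=> //; have [Um em] := ptc ord_max.
exact: van_inj.
Qed.

Lemma divisor_van_inj x y : U x -> U y -> is_prime_divisor x -> is_prime_divisor y ->
  van x `<=` van y -> x = y.
Proof.
move=> Ux Uy dx dy s; apply: van_inj => //; apply/seteqP; split=> //.
apply: divisor_van_minimal => //; first exact: van_prime.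
exact: divisor_van_neq0.
Qed.

End Affine.

End Scheme.

(** * Affine charts as finitely generated algebras *)

Section Charts.

Variables (k K : fieldType) (iota : {rmorphism k -> K}) (X : integralScheme K).

Definition chart (U : set X) (N : nat) (y : 'I_N -> K) : Prop :=
  affine_open (@sec K X) U /\
  sec U = [set f | exists q : mpoly N k, f = mmap iota y q].

Lemma projective_chart (x : X) : is_projective iota X ->
  exists U N (y : 'I_N -> K), U x /\ chart U y.
Proof.
move=> [N [s [cov hs]]]; have [i xi] := cov x; have [si0 _] := xi.
have [h1 h2] := hs i si0.
by exists (proj_chart s i), N.+1, (fun j => s j / s i).
Qed.

Variables (U : set X) (N : nat) (y : 'I_N -> K).
Hypothesis hUy : chart U y.

Let hU : affine_open (@sec K X) U. Proof. by case: hUy. Qed.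
Let hA : is_subring (sec U). Proof. by case: hU => -[oU nU _] _; apply: sec_subring. Qed.

Lemma chart_mmap q : sec U (mmap iota y q).
Proof. by rewrite (proj2 hUy); exists q. Qed.

Lemma chart_iota c : sec U (iota c).
Proof. by have := chart_mmap (mpolyC N c); rewrite mmapC. Qed.

Lemma chart_var i : sec U (y i).
Proof. by have := chart_mmap (mpolyX k (mnm1 i)); rewrite mmapX mmap1U. Qed.

Lemma chart_ind (P : set K) : (forall c, P (iota c)) -> (forall i, P (y i)) ->
  (forall a b, P a -> P b -> P (a - b)) -> (forall a b, P a -> P b -> P (a * b)) ->
  sec U `<=` P.
Proof.
move=> Pk Py PB PM f; rewrite (proj2 hUy) => -[q ->].
have hP : is_subring P by split=> //; rewrite -(rmorph1 iota).
apply: subring_sum => // m _; apply: PM => //; apply: subring_prod => // i _.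
exact: subringX.
Qed.

(** The ideal is the image of its preimage in a polynomial ring mapping onto O(U), and that ring is
    noetherian. *)
Lemma van_fin_gen x : U x -> exists2 s : seq K, (forall a, a \in s -> van U x a) &
  forall J : set K, J 0 -> (forall a b, J a -> J b -> J (a + b)) ->
    (forall a b, sec U a -> J b -> J (a * b)) -> (forall a, a \in s -> J a) ->
    van U x `<=` J.
Proof.
move=> Ux; have [T [ev [hT evk evy evP]]] := noetherian_cover iota (codom y).
have evA t : sec U (ev t).
  move: t; apply: evP => [c|b /codomP[i ->]|a b|a b].
  - exact: chart_iota.
  - exact: chart_var.
  - by move=> Ua Ub; case: (hA) => _ AB _; apply: AB.
  - by move=> Ua Ub; case: (hA) => _ _ AM; apply: AM.
have Aev : forall a, sec U a -> exists t, a = ev t.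
  apply: chart_ind => // [i|a b [t ->] [t' ->]|a b [t ->] [t' ->]].
  - by apply: evy; apply: codom_f.
  - by exists (t - t'); rewrite rmorphB.
  - by exists (t * t'); rewrite rmorphM.
have [[xA x0 _] [xD xM _]] := van_prime hU Ux.
have [|s sx hs] := hT [set t | van U x (ev t)].
  split=> [/=|a b|a b]; rewrite /= ?rmorph0 ?rmorphD ?rmorphM //; first exact: xD.
  by apply: xM; apply: evA.
exists (map ev s) => [_ /mapP[t ts ->]|J J0 JD JM sJ a xa]; first exact: sx.
have [t et] := Aev _ (xA _ xa); rewrite et; apply: (hs [set t | J (ev t)]).
- split=> [/=|b c|b c]; rewrite /= ?rmorph0 ?rmorphD ?rmorphM //; first exact: JD.
  by apply: JM; apply: evA.
- by move=> b bs; apply: sJ; apply: map_f.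
- by rewrite /= -et.
Qed.

Variable p : nat.
Hypothesis charK : p \in [pchar K].
Hypothesis perfect_k : forall a : k, exists b : k, b ^+ p = a.

Let p_gt0 : (0 < p)%N := prime_gt0 (pcharf_prime charK).

Lemma pindep_scale d (t b : 'I_d -> K) : (forall j, b j != 0) -> pindep p t ->
  pindep p (fun j => t j * b j ^+ p).
Proof.
move=> b0 ht c hc i; have := ht (fun i => c i * mon b (fun j => i j)).
have -> : plin t (fun i => c i * mon b (fun j => i j)) = 0.
  rewrite -[RHS]hc; apply: eq_bigr => l _; rewrite exprMn -mulrA; congr (_ * _).
  rewrite /mon -prodrXl -big_split; apply: eq_bigr => j _ /=.
  by rewrite exprMn -!exprM mulnC mulrC.
move=> /(_ erefl i)/eqP; rewrite mulf_eq0 (negPf (mon_neq0 _ b0)) orbF.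
exact/eqP.
Qed.

Lemma dim_pspan d (t : 'I_d -> K) : has_dim X d -> pindep p t ->
  forall f, pspan p t f.
Proof.
move=> [_ nc] ht s; apply: contrapT => ns; apply: nc.
have h1 := pindep_ext charK ht ns.
have [[_ _ frac] _] := hU.
have /choice[ab hab] : forall j, exists ab : K * K,
    [/\ sec U ab.1, sec U ab.2, ab.2 != 0 & ext t s j = ab.1 / ab.2].
  by move=> j; have [a [b hab]] := frac (ext t s j); exists (a, b).
have b0 j : (ab j).2 != 0 by case: (hab j).
(* Denominators are cleared by p-th powers, which do not affect p-independence. *)
have h2 := pindep_scale b0 h1.
have /choice[T hT] : forall j, exists q : mpoly N k,
    ext t s j * (ab j).2 ^+ p = mmap iota y q.
  move=> j; suff : sec U (ext t s j * (ab j).2 ^+ p) by rewrite {1}(proj2 hUy).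
  have [Ua Ub bn0 ->] := hab j; rewrite -(prednK p_gt0) exprS mulrA mulfVK //.
  by case: (hA) => _ _ AM; apply: AM => //; apply: subringX.
(* The chain is built in the polynomial ring above the kernel of the evaluation at [y], and then
   pushed forward to O(U) as [c']. *)
pose I := [set q : mpoly N k | mmap iota y q = 0].
have hI : ring_prime I.
  split; first split.
  - by rewrite /I /= rmorph0.
  - by move=> a b; rewrite /I /= => ha hb; rewrite rmorphD /= ha hb addr0.
  - by move=> a b; rewrite /I /= => hb; rewrite rmorphM /= hb mulr0.
  - by rewrite /I /= rmorph1 => /eqP; rewrite oner_eq0.
  - by move=> a b; rewrite /I /= rmorphM => /eqP; rewrite mulf_eq0 => /orP[] /eqP; [left|right].
have [||c [c0 cp cs]] := @prime_chain k (mpoly N k) (@mpolyC N k)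
     (codom (fun i : 'I_N => mpolyX k (mnm1 i))) _ d.+1 I T hI.
- move=> P Pk Px PB PM q; rewrite [q]mpolyE.
  have P1 : P 1 by rewrite -(rmorph1 (@mpolyC N k)).
  have P0 : P 0 by rewrite -(subrr 1); apply: PB.
  have PD a b : P a -> P b -> P (a + b).
    by move=> Pa Pb; rewrite -[b]opprK -[- b]sub0r; apply: (PB) => //; apply: PB.
  apply: big_ind => // m _; rewrite -mul_mpolyC; apply: (PM); first exact: Pk.
  rewrite mpolyXE_id; apply: (big_ind P) => [//|a b|i _]; first exact: PM.
  elim: (m i) => [|e IH]; first by rewrite expr0.
  by rewrite exprS; apply: PM => //; apply: Px; apply/codomP; exists i.
- move=> F; rewrite /I /= mmap_comp => F0; apply: (pindep_alg_indep charK perfect_k h2).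
  rewrite -[RHS]F0 /mmap; apply: eq_bigr => m _; rewrite /= mmapC; congr (_ * _).
  by apply: eq_bigr => i _; rewrite /= hT.
have cI i : (i <= d.+1)%N -> I `<=` c i.
  elim: i => [|i IH] h; first by rewrite c0.
  by apply: subset_trans (proj1 (cs i h)); apply: IH; apply: ltnW.
pose c' i := [set f : K | exists2 q, c i q & f = mmap iota y q].
have c'E i q : (i <= d.+1)%N -> c' i (mmap iota y q) -> c i q.
  move=> hi [q' cq' e]; have [[_ cD _] _ _] := cp i hi.
  rewrite -(subrK q' q); apply: (cD) => //; apply: (cI _ hi).
  by rewrite /I /= rmorphB /= e subrr.
have [||pt hpt _] := @prime_chain_points _ _ _ hU d.+1 c'; last by exists pt.
- move=> i hi; have [[i0 iD iM] i1 ip] := cp i hi; split; split.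
  + by move=> _ [q _ ->]; apply: chart_mmap.
  + by exists 0; rewrite ?rmorph0.
  + by rewrite -(rmorph1 (mmap iota y)) => /(c'E _ _ hi).
  + by move=> _ _ [q cq ->] [q' cq' ->]; exists (q + q'); [apply: iD|rewrite rmorphD].
  + move=> a b; rewrite {1}(proj2 hUy) => -[q ->] [q' cq' ->].
    by exists (q * q'); [apply: iM|rewrite rmorphM].
  + move=> a b; rewrite {1}(proj2 hUy) => -[q ->]; rewrite {1}(proj2 hUy) => -[q' ->].
    by rewrite -rmorphM => /(c'E _ _ hi)/ip[]; [left; exists q|right; exists q'].
- move=> i hi; have [s1 s2] := cs i hi; split.
    by move=> _ [q cq ->]; exists q => //; apply: s1.
  move=> s3; apply: s2 => q cq; apply: (c'E _ _ (ltnW hi)); apply: s3.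
  by exists q.
Qed.

(* Derivations have bounded denominators on the local rings, as these are
   localizations of a finitely generated algebra. *)
Lemma der_denominator d (D : 'I_d -> K -> K) x :
  U x -> (forall i, is_derivation iota (D i)) ->
  exists v, [/\ stalk x v, v != 0 & forall i f, stalk x f -> stalk x (v * D i f)].
Proof.
move=> Ux hD.
have hD' i : derivation (D i) by case: (hD i).
have [_ _ AM] := hA.
have [[_ _ frac] _] := hU.
have /choice[b hb] : forall f : K, exists b, [/\ sec U b, b != 0 & sec U (b * f)].
  move=> f; have [a [b [Ua Ub b0 ->]]] := frac f; exists b; split=> //.
  by rewrite mulrCA divff // mulr1.
pose v := \prod_i \prod_j b (D i (y j)).
have Uv : sec U v.
  by apply: subring_prod => // i _; apply: subring_prod => // j _; case: (hb (D i (y j))).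
exists v; split; first exact: (sec_stalk hU).
  by apply/prodf_neq0 => i _; apply/prodf_neq0 => j _; case: (hb (D i (y j))).
move=> i.
have UD f : sec U f -> sec U (v * D i f).
  suff : sec U `<=` [set g | sec U g /\ sec U (v * D i g)] by move=> h /h [].
  move=> {f}; apply: chart_ind => [c|j|f g [Uf UDf] [Ug UDg]|f g [Uf UDf] [Ug UDg]].
  - split; first exact: chart_iota.
    by case: (hD i) => _ _ ->; rewrite mulr0; apply: subring0.
  - split; first exact: chart_var.
    have [_ _ hbj] := hb (D i (y j)); rewrite /v (bigD1 i) //= (bigD1 j) //=.
    set r1 := \prod_(_ | _) _; set r2 := \prod_(_ | _) _.
    have -> : b (D i (y j)) * r1 * r2 * D i (y j) = (b (D i (y j)) * D i (y j)) * (r1 * r2) by ring.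
    apply: (AM) => //.
    apply: AM; first by apply: subring_prod => // l _; case: (hb (D i (y l))).
    by apply: subring_prod => // l _; apply: subring_prod => // l' _; case: (hb (D l (y l'))).
  - split; first by case: (hA) => _ AB _; apply: AB.
    rewrite (proj1 (hD' i)) derN // mulrBr; by case: (hA) => _ AB _; apply: AB.
  - split; first exact: AM.
    rewrite (proj2 (hD' i)) mulrDr mulrCA [v * (g * _)]mulrCA.
    by apply: subringD => //; apply: AM.
move=> f /(stalk_frac hU Ux)[a [c [Ua Uc uc ->]]].
have [c0 xc xc'] := uc.
have -> : v * D i (a / c) = (v * D i a) / c - (a / c) * (v * D i c) / c.
  have -> : D i a = D i (a / c * c) by rewrite mulfVK.
  by rewrite (proj2 (hD' i) (a / c) c); field.
have [_ SB SM] := stalk_subring x.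
apply: SB; apply: (SM) => //; first by apply: (sec_stalk hU) (UD _ Ua).
apply: (SM); last by apply: (sec_stalk hU) (UD _ Uc).
by apply: SM => //; apply: (sec_stalk hU) Ua.
Qed.

End Charts.

(** * Orders along prime divisors *)

Section Valuation.

Variables (K : fieldType) (X : integralScheme K).

Section Uniformizer.

Variables (x : X) (t : K).
Hypothesis ht : is_uniformizer x t.

Let t0 : t != 0. Proof. by case: ht. Qed.
Let xt : stalk x t. Proof. by case: ht. Qed.
Let hO : is_subring (stalk x) := stalk_subring x.

Lemma unitX f (n : nat) : is_unit_in (stalk x) f -> is_unit_in (stalk x) (f ^+ n).
Proof.
move=> uf; elim: n => [|n IH]; first by rewrite expr0; apply: unit1.
by rewrite exprS; apply: unitM.
Qed.

Lemma unitXz f (n : int) : is_unit_in (stalk x) f -> is_unit_in (stalk x) (f ^ n).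
Proof. by case: n => n uf; [apply: unitX | apply/unitV/unitX]. Qed.

Lemma uniformizer_Xz_unit (n : int) : is_unit_in (stalk x) (t ^ n) -> n = 0.
Proof.
have [_ _ nu _] := ht.
have key m : ~ is_unit_in (stalk x) (t ^+ m.+1).
  by rewrite exprS => /(unitMl xt (subringX m hO xt))/nu.
case: n => [[|n]|n] //; first by move=> /key.
by move=> /unitV; rewrite NegzE -exprnN invrK => /key.
Qed.

Lemma uniformizer_assoc s : is_uniformizer x s -> is_unit_in (stalk x) (s / t).
Proof.
move=> [s0 xs nus hs]; have [_ _ nut hts] := ht.
split; first by rewrite mulf_neq0 ?invr_eq0.
  exact: hts.
by rewrite invf_div; apply: hs.
Qed.

(** Two uniformizers differ by a unit, and no power of [t] with nonzero exponent is a unit; so the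
    value selected in [ord] is forced. *)
Lemma ordP u (n : int) : is_unit_in (stalk x) u -> ord x (u * t ^ n) = n.
Proof.
move=> uu; rewrite /ord; case: xgetP => [m _ [s [v [hs uv e]]]|/(_ n)]; last first.
  by case; exists t, u.
have ust := uniformizer_assoc hs.
have : is_unit_in (stalk x) (t ^ (m - n)).
  have -> : t ^ (m - n) = u * v^-1 * (s / t) ^ (- m).
    have [v0 _ _] := uv; have [s0 _ _ _] := hs; have [u0 _ _] := uu.
    have e1 : u = v * s ^ m / t ^ n by rewrite -e mulfK // expfz_neq0.
    rewrite e1 expfzDr // expfzMl exprz_inv opprK -!invr_expz; field.
    by rewrite v0 !expfz_neq0.
  by apply: unitM; [apply: unitM => //; apply: unitV | apply: unitXz].
by move=> /uniformizer_Xz_unit /eqP; rewrite subr_eq0 => /eqP.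
Qed.

End Uniformizer.

(** The local ring at x is a discrete valuation ring of K, with valuation [ord x]. *)
Definition valued (x : X) : Prop :=
  exists2 t, is_uniformizer x t & forall f, f != 0 ->
    exists u (n : int), is_unit_in (stalk x) u /\ f = u * t ^ n.

Section Valued.

Variable x : X.
Hypothesis hx : valued x.

Let hO : is_subring (stalk x) := stalk_subring x.

Lemma ord_unit u : is_unit_in (stalk x) u -> ord x u = 0.
Proof.
by have [t ht _] := hx; move=> uu; rewrite -[u]mulr1 -(expr0z t) (ordP ht).
Qed.

Lemma ordM f g : f != 0 -> g != 0 -> ord x (f * g) = ord x f + ord x g.
Proof.
have [t ht dec] := hx => /dec[u [n [uu ->]]] /dec[v [m [uv ->]]].
rewrite !(ordP ht) // mulrACA -expfzDr; last by case: ht.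
by rewrite (ordP ht) //; apply: unitM.
Qed.

Lemma ordx1 : ord x 1 = 0. Proof. exact/ord_unit/unit1. Qed.

Lemma ordV f : f != 0 -> ord x f^-1 = - ord x f.
Proof.
move=> f0; have := ordM f0 (invr_neq0 f0); rewrite divff // ordx1 => e.
by apply/esym/eqP; rewrite -subr_eq0 -opprD -e oppr0.
Qed.

Lemma ordX f n : f != 0 -> ord x (f ^+ n) = ord x f *+ n.
Proof.
move=> f0; elim: n => [|n IH]; first by rewrite expr0 ordx1.
by rewrite exprS ordM ?expf_neq0 // IH mulrS.
Qed.

Lemma ord_prod (I : Type) (r : seq I) (P : pred I) F : (forall i, P i -> F i != 0) ->
  ord x (\prod_(i <- r | P i) F i) = \sum_(i <- r | P i) ord x (F i).
Proof.
move=> hF; suff : \prod_(i <- r | P i) F i != 0 /\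
    ord x (\prod_(i <- r | P i) F i) = \sum_(i <- r | P i) ord x (F i) by case.
apply: (big_ind2 (fun a b => a != 0 /\ ord x a = b)).
- by rewrite oner_eq0 ordx1.
- by move=> a b c d [a0 <-] [c0 <-]; rewrite mulf_neq0 // ordM.
- by move=> i Pi; split=> //; apply: hF.
Qed.

Lemma ord_ge0 f : f != 0 -> (0 <= ord x f) <-> stalk x f.
Proof.
have [t ht dec] := hx => /dec[u [n [uu ->]]]; rewrite (ordP ht) //.
have [t0 xt nut _] := ht; have [u0 xu xu'] := uu; split=> [n0|xf].
  case: n n0 => [n|n] // _; apply: stalkM => //; exact: subringX.
case: n xf => [n|n] // xf; case: nut.
have : stalk x (t ^- n.+1).
  by rewrite -[_ ^- _](mulKf u0); apply: stalkM.
move=> h; split=> //; have -> : t^-1 = t ^- n.+1 * t ^+ n.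
  by rewrite exprS invfM -mulrA mulVf ?mulr1 // expf_neq0.
by apply: stalkM => //; apply: subringX.
Qed.

Lemma ord_geD f g m : f != 0 -> g != 0 -> f + g != 0 ->
  m <= ord x f -> m <= ord x g -> m <= ord x (f + g).
Proof.
have [t ht dec] := hx => f0 g0 fg0 mf mg; have [t0 _ _ _] := ht.
have tm0 (n : int) : t ^ n != 0 by apply: expfz_neq0.
have otm (n : int) : ord x (t ^ n) = n by rewrite -[t ^ n]mul1r (ordP ht) //; apply: unit1.
have key h : h != 0 -> (m <= ord x h) <-> stalk x (h * t ^ (- m)).
  move=> h0; rewrite -ord_ge0 ?mulf_neq0 // ordM // otm.
  by rewrite subr_ge0.
by apply/key => //; rewrite mulrDl; apply: subringD => //; apply/key.
Qed.

End Valued.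

(* If the maximal ideal of the local ring at [x] is [(t)], then the elements
   divisible by all powers of [t] form a prime ideal strictly below it. *)
Lemma uniformizer_valued (U : set X) (x : X) t : affine_open (@sec K X) U -> U x ->
  is_prime_divisor x -> is_uniformizer x t -> valued x.
Proof.
move=> hU Ux dx ht; exists t => // f f0.
have [t0 xt nut hts] := ht; have hO := stalk_subring x.
have hA : is_subring (sec U) by case: hU => -[oU nU _] _; apply: sec_subring.
have [A1 AB AM] := hA.
pose Q := [set a | sec U a /\ forall n, stalk x (a / t ^+ n)].
have dec a : sec U a -> ~ Q a -> exists n u, is_unit_in (stalk x) u /\ a = u * t ^+ n.
  move=> Ua nQ; have ex : exists n, `[< ~ stalk x (a / t ^+ n) >].
    apply: contrapT => none; apply: nQ; split=> // n; apply: contrapT => h.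
    by apply: none; exists n; apply/asboolP.
  case: (ex_minnP ex) => m /asboolP hm mmin.
  case: m hm mmin => [|m] hm mmin.
    by case: hm; rewrite expr0 divr1; apply: sec_stalk Ua.
  exists m, (a / t ^+ m); split; last by rewrite mulfVK // expf_neq0.
  have xm : stalk x (a / t ^+ m).
    by apply: contrapT => h; have := mmin m (introT (asboolP _) h); rewrite ltnn.
  apply: contrapT => nu; apply: hm; rewrite exprSr invfM mulrA.
  exact: hts.
have Qp : is_prime_ideal (sec U) Q.
  split; split.
  - by move=> a [].
  - by split; [exact: subring0 | move=> n; rewrite mul0r; apply: subring0].
  - move=> [_ /(_ 1%N)]; rewrite expr1 div1r => h; apply: nut; split=> //.
  - move=> a b [Ua ha] [Ub hb]; split; first exact: subringD.
    by move=> n; rewrite mulrDl; apply: subringD.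
  - move=> a b Ua [Ub hb]; split; first exact: AM.
    by move=> n; rewrite -mulrA; apply: stalkM => //; apply: sec_stalk Ua.
  - move=> a b Ua Ub [Uab hab]; apply: contrapT => /not_orP[/(dec _ Ua)[n [u [uu ea]]]].
    move=> /(dec _ Ub)[m [v [uv eb]]]; apply: nut; split=> //.
    have [u0 _ xu] := uu; have [v0 _ xv] := uv.
    have := hab (n + m).+1; rewrite ea eb => h.
    have -> : t^-1 = u^-1 * v^-1 * (u * t ^+ n * (v * t ^+ m) / t ^+ (n + m).+1).
      by rewrite exprS exprD; field; rewrite t0 u0 v0 !expf_neq0.
    by apply: stalkM => //; apply: stalkM.
(* A nonzero Q would be the whole ideal of x, by codimension one. But t = c / b with b a unit at x,
   and then c is in the ideal of x without being divisible by t^2. *)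
have Q0 a : Q a -> a = 0.
  move=> Qa; apply/eqP; apply: contrapT => /negP a0.
  have s : van U x `<=` Q.
    apply: divisor_van_minimal => //; last by exists a.
    move=> b [Ub hb]; split=> // ub; apply: nut; split=> //.
    have [b0 _ xb] := ub; have := stalkM (hb 1%N) xb.
    by rewrite expr1 mulrC mulKf.
  have [c [b [Uc Ub ub et]]] := stalk_frac hU Ux xt.
  have [b0 xb xb'] := ub.
  have ec : c = t * b by rewrite et mulfVK.
  have : van U x c.
    split=> // uc; apply: nut; rewrite et; apply: unitM => //; exact: unitV.
  move=> /s [_ /(_ 2)] h; apply: nut; split=> //.
  have -> : t^-1 = c / t ^+ 2 * b^-1 by rewrite ec; field; rewrite b0 t0.
  exact: stalkM.
have [[_ _ frac] _] := hU; have [a [b [Ua Ub b0 ef]]] := frac f.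
have a0 : a != 0 by apply: contraNneq f0 => a0; rewrite ef a0 mul0r.
have [|n [u [uu ea]]] := dec a Ua; first by move=> /Q0 /eqP; rewrite (negPf a0).
have [|m [v [uv eb]]] := dec b Ub; first by move=> /Q0 /eqP; rewrite (negPf b0).
exists (u / v), (n%:Z - m%:Z); split; first by apply: unitM => //; apply: unitV.
rewrite expfzDr // -invr_expz -!exprnP ef ea eb; have [v0 _ _] := uv.
by field; rewrite v0 expf_neq0.
Qed.

Section Canonical.

Variables (k : fieldType) (iota : {rmorphism k -> K}) (p : nat).
Hypothesis charK : p \in [pchar K].

Lemma form_denominator d (w : ('I_d -> K -> K) -> K) (O : set K) :
  is_subring O -> (forall f, exists b, [/\ O b, b != 0 & O (b * f)]) ->
  is_form_over iota setT w ->
  exists2 g, g != 0 & is_form_over iota O (fun D => g * w D).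
Proof.
move=> hO frac [m [a [t [_ _ ew]]]]; have [O1 _ OM] := hO.
have /choice[b hb] := frac.
pose v := \prod_l \prod_j b (t l j); pose c := \prod_l b (a l).
have v0 : v != 0.
  by apply/prodf_neq0 => l _; apply/prodf_neq0 => j _; case: (hb (t l j)).
have c0 : c != 0 by apply/prodf_neq0 => l _; case: (hb (a l)).
have Ot l j : O (v * t l j).
  rewrite /v (bigD1 l) //= (bigD1 j) //=.
  set r1 := \prod_(_ | _) _; set r2 := \prod_(_ | _) _.
  have -> : b (t l j) * r1 * r2 * t l j = (b (t l j) * t l j) * (r1 * r2) by ring.
  have [_ _ h] := hb (t l j); apply: (OM) => //; apply: (OM).
    by apply: subring_prod => // i _; case: (hb (t l i)).
  by apply: subring_prod => // i _; apply: subring_prod => // i' _; case: (hb (t i i')).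
have Oa l : O (c * a l).
  rewrite /c (bigD1 l) //= mulrAC; apply: OM; first by case: (hb (a l)).
  by apply: subring_prod => // i _; case: (hb (a i)).
have Ov : O v.
  by apply: subring_prod => // i _; apply: subring_prod => // i' _; case: (hb (t i i')).
have p0 : (0 < p)%N := prime_gt0 (pcharf_prime charK).
(* The functions t are scaled by v^p rather than by v because d(v^p t) = v^p dt has no second term;
   the determinant then contributes the exponent d. *)
exists ((v ^+ p) ^+ d * c); first by rewrite mulf_neq0 // !expf_neq0.
exists m, (fun l => c * a l), (fun l j => v ^+ p * t l j); split=> //.
  move=> l j; rewrite -(prednK p0) exprSr -mulrA; apply: OM => //; exact: subringX.
move=> D hD; rewrite ew // mulr_sumr; apply: eq_bigr => l _.
rewrite -mulrA mulrCA -mulrA; congr (_ * _); rewrite mulrCA; congr (_ * _).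
rewrite -detZ; congr (\det _); apply/matrixP => i j; rewrite !mxE.
have dD : derivation (D i) by case: (hD i).
by rewrite (proj2 dD) der_pchar // mulr0 addr0.
Qed.

(* Without a uniformizer [ord x] would vanish identically, so that all
   multiples of [w] would be regular at [x]; but the regular forms have bounded
   denominators. *)
Lemma exists_uniformizer (U : set X) N (y : 'I_N -> K) (x : X) d (w : ('I_d -> K -> K) -> K) D n :
  chart iota U y -> U x -> is_prime_divisor x -> is_form_over iota setT w ->
  (forall i, is_derivation iota (D i)) -> w D != 0 -> form_has_ord iota w x n ->
  exists t, is_uniformizer x t.
Proof.
move=> hUy Ux dx fw hD wD hord; apply: contrapT => none.
have hU : affine_open (@sec K X) U by case: hUy.
have hO := stalk_subring x.
have ord0 f : ord x f = 0.
  rewrite /ord; case: xgetP => // m _ [t [u [ht _ _]]].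
  by case: none; exists t.
have [[_ _ frac] _] := hU.
have [g g0 gw] : exists2 g, g != 0 & is_form_over iota (stalk x) (fun D => g * w D).
  apply: form_denominator => // f; have [a [b [Ua Ub b0 ->]]] := frac f.
  exists b; split=> //; first exact: (sec_stalk hU).
  by rewrite mulrCA divff // mulr1; apply: (sec_stalk hU).
have n0 : 0 <= n by have := proj1 (hord g g0) gw; rewrite ord0 add0r.
have [v [xv v0 hv]] := der_denominator hUy Ux hD.
(* The multiple of w with value f / v^d at [D] is regular at x, and v^d clears the denominators of
   its determinants, so that f is regular. *)
have all f : f != 0 -> stalk x f.
  move=> f0; have g1 : f / (v ^+ d * w D) != 0.
    by rewrite mulf_neq0 // invr_eq0 mulf_neq0 // expf_neq0.
  have [|m [a [t [xa xt ew]]]] := proj2 (hord _ g1); first by rewrite ord0 add0r.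
  have -> : f = v ^+ d * (f / (v ^+ d * w D) * w D).
    by field; rewrite wD expf_neq0.
  rewrite ew // mulr_sumr; apply: subring_sum => // l _.
  rewrite mulrCA; apply: stalkM => //; rewrite -detZ; apply: subring_det => // i j.
  by rewrite !mxE; apply: hv.
have [f [Uf nf] f0] := divisor_van_neq0 hU Ux dx.
by apply: nf; split=> //; apply: all; rewrite ?invr_eq0.
Qed.

End Canonical.

End Valuation.

(** * Witt vectors *)

Section MonomialMaps.

Variables (K : fieldType) (F : rat -> K).
Hypothesis F0 : F 0 = 0.

Lemma mmap_supp N (h : 'I_N -> K) (q : mpoly N rat) (L : seq (multinom N)) :
  uniq L -> {subset msupp q <= L} ->
  mmap F h q = \sum_(m <- L) F (mcoeff m q) * mmap1 h m.
Proof.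
move=> uL sL; rewrite /mmap.
rewrite [RHS](bigID (fun m => m \in msupp q)) /= [X in _ + X]big1 => [|m]; last first.
  by rewrite -mcoeff_eq0 => /eqP ->; rewrite F0 mul0r.
rewrite addr0 -[RHS]big_filter; apply: perm_big; apply: uniq_perm.
- exact: msupp_uniq.
- exact: filter_uniq.
- move=> m; rewrite mem_filter; case mq: (m \in msupp q) => //=.
  by rewrite sL.
Qed.

(** As F is not additive, the formula needs distinct exponents: injectivity of g keeps coefficients
    from being added up. *)
Lemma mmap_sumX N (h : 'I_N -> K) (I : eqType) (s : seq I) (c : I -> rat)
    (g : I -> multinom N) : uniq s -> {in s &, injective g} ->
  mmap F h (\sum_(i <- s) c i *: mpolyX rat (g i))
  = \sum_(i <- s) F (c i) * mmap1 h (g i).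
Proof.
move=> us ginj; have ug : uniq (map g s) by rewrite map_inj_in_uniq.
rewrite (mmap_supp h ug); last first.
  move=> m; rewrite mcoeff_msupp raddf_sum /= => h0; apply: contrapT => /negP nm.
  case/eqP: h0; rewrite big_seq big1 // => i iS; rewrite mcoeffZ mcoeffX.
  by case: eqP => [e|]; [rewrite -e map_f in nm | rewrite mulr0].
rewrite big_map big_seq [RHS]big_seq; apply: eq_bigr => i iS; congr (F _ * _).
rewrite raddf_sum /= (bigD1_seq i) //= mcoeffZ mcoeffX eqxx mulr1.
rewrite big_seq_cond big1 ?addr0 // => j /andP[jS ji]; rewrite mcoeffZ mcoeffX.
by case: eqP => [e|]; [case/eqP: ji; apply: ginj | rewrite mulr0].
Qed.

Lemma mmap_X N (h : 'I_N -> K) m : mmap F h (mpolyX rat m) = F 1 * mmap1 h m.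
Proof.
have := @mmap_sumX N h unit [:: tt] (fun _ => 1) (fun _ => m) isT.
by rewrite !big_seq1 scale1r; apply=> -[] [].
Qed.

Lemma mmap_XD N (h : 'I_N -> K) m m' : m != m' ->
  mmap F h (mpolyX rat m + mpolyX rat m') = F 1 * mmap1 h m + F 1 * mmap1 h m'.
Proof.
move=> mm'; have := @mmap_sumX N h bool [:: true; false] (fun _ => 1) (fun b => if b then m else m') isT.
rewrite !big_cons !big_nil !addr0 !scale1r; apply=> -[] [] _ _ //= e.
  by rewrite e eqxx in mm'.
by rewrite e eqxx in mm'.
Qed.

Lemma mmap_0 N (h : 'I_N -> K) : mmap F h (0 : mpoly N rat) = 0.
Proof. by rewrite /mmap (_ : msupp 0 = [::]) ?big_nil //; apply/eqP; rewrite msupp_eq0. Qed.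

Variables (N N' : nat) (r : 'I_N -> option 'I_N').
Hypothesis rinj : forall i i' j, r i = Some j -> r i' = Some j -> i = i'.

(* Sends the variable [X_i] to [X_j] if [r i = Some j], and to [0] if
   [r i = None].  Evaluation is compatible with such maps even though the
   numerator, used by [witt_eval] for the coefficients, is not additive. *)
Definition varmap : {rmorphism mpoly N rat -> mpoly N' rat} :=
  mmap (@mpolyC N' rat) (fun i => if r i is Some j then mpolyX rat (mnm1 j) else 0).

Lemma varmapX i : varmap (mpolyX rat (mnm1 i)) =
  if r i is Some j then mpolyX rat (mnm1 j) else 0.
Proof. by rewrite /varmap /= mmapX mmap1U. Qed.

Lemma varmapZ c q : varmap (c *: q) = c *: varmap q.
Proof. by rewrite /varmap /= mmapZ mul_mpolyC. Qed.

Definition alive (m : multinom N) : bool := [forall i, (0 < m i)%N ==> isSome (r i)].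

Definition mpush (m : multinom N) : multinom N' :=
  Multinom [tuple (\sum_(i | r i == Some j) m i)%N | j < N'].

Lemma mpush_inj m m' : alive m -> alive m' -> mpush m = mpush m' -> m = m'.
Proof.
move=> /forallP am /forallP am' e; apply/mnmP => i.
case E: (r i) => [j|].
  have := congr1 (fun m => fun_of_multinom m j) e; rewrite !mnmE.
  have h (m0 : multinom N) : (\sum_(l | r l == Some j) m0 l = m0 i)%N.
    rewrite (bigD1 i) ?E //= big1 ?addn0 // => l /andP[/eqP el li].
    by case/eqP: li; apply: rinj E.
  by rewrite !h.
have h (m0 : multinom N) : (0 < m0 i)%N ==> isSome (r i) -> m0 i = 0%N.
  by rewrite E implybF -eqn0Ngt => /eqP.
by rewrite (h m (am i)) (h m' (am' i)).
Qed.

Lemma mmap1_push (S : comNzRingType) (h : 'I_N' -> S) m :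
  mmap1 (fun i => oapp h 0 (r i)) m = if alive m then mmap1 h (mpush m) else 0.
Proof.
case: ifPn => [/forallP am|]; last first.
  rewrite negb_forall => /existsP[i]; rewrite negb_imply => /andP[mi ri].
  rewrite /mmap1 (bigD1 i) //=; case: (r i) ri => //= _.
  by rewrite expr0n (gtn_eqF mi) mul0r.
rewrite /mmap1 (bigID (fun i => isSome (r i))) /= [X in _ * X]big1 ?mulr1; last first.
  by move=> i ri; have := am i; rewrite (negPf ri) implybF -eqn0Ngt => /eqP ->.
transitivity (\prod_j \prod_(i | r i == Some j) h j ^+ m i); last first.
  by apply: eq_bigr => j _; rewrite mnmE -expr_sum.
rewrite (exchange_big_dep (fun i => isSome (r i))) /=; last by move=> j i _ /eqP ->.
apply: eq_bigr => i; case E: (r i) => [j|] //= _.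
rewrite (bigD1 j) //= big1 ?mulr1 // => l /andP[/eqP[->]]; by rewrite eqxx.
Qed.

Lemma mmap_varmap (h : 'I_N' -> K) q :
  mmap F h (varmap q) = mmap F (fun i => oapp h 0 (r i)) q.
Proof.
have e : varmap q = \sum_(m <- [seq m <- msupp q | alive m])
    mcoeff m q *: mpolyX rat (mpush m).
  rewrite {1}[q]mpolyE rmorph_sum big_filter [RHS]big_mkcond.
  apply: eq_bigr => m _; rewrite varmapZ {1}/varmap /= mmapX.
  rewrite (_ : mmap1 _ m = mmap1 (fun i => oapp (fun j => mpolyX rat (mnm1 j)) 0 (r i)) m); last first.
    by apply: eq_bigr => i _; case: (r i).
  rewrite mmap1_push; case: ifP => _; last by rewrite scaler0.
  by rewrite mpolyXE_id.
rewrite e mmap_sumX ?filter_uniq ?msupp_uniq //; last first.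
  by move=> m m'; rewrite !mem_filter => /andP[am _] /andP[am' _]; apply: mpush_inj.
rewrite big_filter big_mkcond /mmap; apply: eq_bigr => m _.
by rewrite mmap1_push; case: ifP => _ //; rewrite mulr0.
Qed.

End MonomialMaps.

(** * Ghost components and weights *)

Section Ghost.

Variable p : nat.
Hypothesis p_gt0 : (0 < p)%N.

Lemma ghost_ext (R : nzRingType) (z z' : nat -> R) m :
  (forall i, (i <= m)%N -> z i = z' i) -> ghost p z m = ghost p z' m.
Proof. by move=> h; apply: eq_bigr => i _; rewrite h // -ltnS. Qed.

Lemma size_unghost N (g : nat -> mpoly N rat) m : size (unghost p g m) = m.
Proof. by elim: m => //= m IH; rewrite size_rcons IH. Qed.

Lemma unghost_rec N (g : nat -> mpoly N rat) m i : (i < m)%N ->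
  (unghost p g m)`_i = (p ^ i)%:R^-1 *:
    (g i - \sum_(j < i) ((unghost p g m)`_j ^+ (p ^ (i - j))) *+ (p ^ j)).
Proof.
elim: m i => // m IH i; rewrite ltnS leq_eqVlt => /orP[/eqP ->|im].
  rewrite /= nth_rcons size_unghost ltnn eqxx; congr (_ *: (_ - _)).
  by apply: eq_bigr => j _; rewrite nth_rcons size_unghost ltn_ord.
rewrite /= nth_rcons size_unghost im IH //; congr (_ *: (_ - _)).
by apply: eq_bigr => j _; rewrite nth_rcons size_unghost (ltn_trans (ltn_ord j)).
Qed.

Lemma unghost_ext N (g g' : nat -> mpoly N rat) m m' :
  forall i, (i < m)%N -> (i < m')%N -> (forall j, (j <= i)%N -> g j = g' j) ->
  (unghost p g m)`_i = (unghost p g' m')`_i.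
Proof.
elim/ltn_ind => i IH im im' h; rewrite !unghost_rec // h //; congr (_ *: (_ - _)).
apply: eq_bigr => j _; rewrite IH //.
- exact: ltn_trans im.
- exact: ltn_trans im'.
- by move=> l lj; apply: h; apply: leq_trans lj (ltnW _).
Qed.

(** Over the rationals the ghost components determine z. A Witt polynomial is thus identified, after
    a substitution, by exhibiting a candidate with the right ghost components. *)
Lemma unghost_ghost N (g : nat -> mpoly N rat) z m i : (i < m)%N ->
  (forall j, (j <= i)%N -> g j = ghost p z j) -> (unghost p g m)`_i = z i.
Proof.
elim/ltn_ind: i => i IH im h; rewrite unghost_rec // h // /ghost big_ord_recr /=.
rewrite [X in _ - X](eq_bigr (fun j : 'I_i => (z j ^+ (p ^ (i - j))) *+ (p ^ j))); last first.
  move=> j _; rewrite IH //; first exact: ltn_trans im.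
  by move=> l lj; apply: h; apply: leq_trans lj (ltnW _).
rewrite addrAC subrr add0r subnn expn0 expr1 -scaler_nat scalerA mulVf ?scale1r //.
by rewrite pnatr_eq0 -lt0n expn_gt0 p_gt0.
Qed.

Lemma unghost_morph N N' (f : {rmorphism mpoly N rat -> mpoly N' rat}) g m i :
  (forall c q, f (c *: q) = c *: f q) -> (i < m)%N ->
  f (unghost p g m)`_i = (unghost p (f \o g) m)`_i.
Proof.
move=> fZ; elim/ltn_ind: i => i IH im; rewrite !unghost_rec // fZ; congr (_ *: _).
rewrite rmorphB rmorph_sum; congr (_ - _); apply: eq_bigr => j _.
by rewrite rmorphMn rmorphXn /= IH // (ltn_trans _ im).
Qed.

Lemma ghost_morph (R S : nzRingType) (f : {rmorphism R -> S}) z m :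
  f (ghost p z m) = ghost p (f \o z) m.
Proof. by rewrite rmorph_sum; apply: eq_bigr => i _; rewrite rmorphMn rmorphXn. Qed.

Section Weight.

Variables (N : nat) (v : 'I_N -> nat).

(** Weighted homogeneity of weight e, the variable X_i having weight [v i]. It turns bounds on the
    poles of the entries of Witt vectors into bounds for their sums and products. *)
Definition whom (e : nat) (q : mpoly N rat) : Prop :=
  forall m, m \in msupp q -> (\sum_i m i * v i)%N = e.

Lemma whom0 e : whom e 0.
Proof. by move=> m; rewrite mcoeff_msupp mcoeff0 eqxx. Qed.

Lemma whomX i : whom (v i) (mpolyX rat (mnm1 i)).
Proof.
move=> m; rewrite msuppX inE => /eqP ->; rewrite (bigD1 i) //= big1 => [|j ji].
  by rewrite mnm1E eqxx mul1n addn0.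
by rewrite mnm1E eq_sym (negPf ji) mul0n.
Qed.

Lemma whomZ e c q : whom e q -> whom e (c *: q).
Proof. by move=> hq m /msuppZ_le; apply: hq. Qed.

Lemma whomD e q q' : whom e q -> whom e q' -> whom e (q + q').
Proof. by move=> hq hq' m /msuppD_le; rewrite mem_cat => /orP[/hq|/hq']. Qed.

Lemma whomN e q : whom e q -> whom e (- q).
Proof. by move=> hq m; rewrite (perm_mem (msuppN q)); apply: hq. Qed.

Lemma whom_sum e (I : Type) (s : seq I) (P : pred I) G :
  (forall i, P i -> whom e (G i)) -> whom e (\sum_(i <- s | P i) G i).
Proof. by move=> h; apply: big_ind => //; [exact: whom0 | exact: whomD]. Qed.

Lemma whomMn e q c : whom e q -> whom e (q *+ c).
Proof. by move=> hq; rewrite -scaler_nat; apply: whomZ. Qed.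

Lemma whomM e e' q q' : whom e q -> whom e' q' -> whom (e + e') (q * q').
Proof.
move=> hq hq' m /msuppM_le /allpairsP[[m1 m2] /= [/hq h1 /hq' h2 ->]].
rewrite -h1 -h2 -big_split; apply: eq_bigr => i _.
by rewrite mnmDE mulnDl.
Qed.

Lemma whom1 : whom 0 1.
Proof. by move=> m; rewrite msupp1 inE => /eqP ->; rewrite big1 // => i _; rewrite mnm0E. Qed.

Lemma whomXn e q c : whom e q -> whom (e * c) (q ^+ c).
Proof.
move=> hq; elim: c => [|c IH]; first by rewrite muln0 expr0; apply: whom1.
by rewrite exprS mulnS; apply: whomM.
Qed.

Lemma unghost_whom g m i : (forall j, (j < m)%N -> whom (p ^ j) (g j)) ->
  (i < m)%N -> whom (p ^ i) (unghost p g m)`_i.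
Proof.
move=> hg; elim/ltn_ind: i => i IH im; rewrite unghost_rec //; apply: whomZ.
apply: whomD; first exact: hg.
apply/whomN/whom_sum => j _; apply: whomMn.
have -> : (p ^ i = p ^ j * p ^ (i - j))%N by rewrite -expnD subnKC // ltnW.
by apply: whomXn; apply: IH => //; apply: ltn_trans im.
Qed.

Lemma ghost_whom z m : (forall j, (j <= m)%N -> whom (p ^ j) (z j)) ->
  whom (p ^ m) (ghost p z m).
Proof.
move=> hz; apply: whom_sum => j _; apply: whomMn.
have jm : (j <= m)%N by rewrite -ltnS.
have -> : (p ^ m = p ^ j * p ^ (m - j))%N by rewrite -expnD subnKC.
by apply: whomXn; apply: hz.
Qed.

Lemma ghost_whom0 z m : (forall j, (j <= m)%N -> whom 0 (z j)) -> whom 0 (ghost p z m).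
Proof.
move=> hz; apply: whom_sum => j _; apply: whomMn.
by rewrite -(mul0n (p ^ (m - j))%N); apply/whomXn/hz; rewrite -ltnS.
Qed.

End Weight.

End Ghost.

(** * Verschiebung, Teichmüller representatives and truncation *)

Section WittVectors.

Variables (K : fieldType) (p : nat).
Hypothesis p_gt0 : (0 < p)%N.

Let num (c : rat) : K := (numq c)%:~R.
Let num0 : num 0 = 0. Proof. by rewrite /num. Qed.
Let num1 : num 1 = 1. Proof. by rewrite /num. Qed.

Definition witt_env n (x y : n.-tuple K) (j : 'I_(n + n)) : K :=
  match split j with inl i => tnth x i | inr i => tnth y i end.

Lemma witt_envl n (x y : n.-tuple K) i : witt_env x y (lshift n i) = tnth x i.
Proof.
rewrite /witt_env; case: splitP => j; first by move=> /= /val_inj ->.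
by move=> /= e; have := ltn_ord i; rewrite e ltnNge leq_addr.
Qed.

Lemma witt_envr n (x y : n.-tuple K) i : witt_env x y (rshift n i) = tnth y i.
Proof.
rewrite /witt_env; case: splitP => j /= e; last by move/addnI/val_inj: e => ->.
by have := ltn_ord j; rewrite -e ltnNge leq_addr.
Qed.

Lemma splitl n (i : 'I_n) : split (lshift n i) = inl i :> 'I_n + 'I_n.
Proof. exact: (unsplitK (inl i)). Qed.

Lemma splitr n (i : 'I_n) : split (rshift n i) = inr i :> 'I_n + 'I_n.
Proof. exact: (unsplitK (inr i)). Qed.

Lemma split_ind n (P : 'I_(n + n) -> Prop) :
  (forall i, P (lshift n i)) -> (forall i, P (rshift n i)) -> forall j, P j.
Proof. by move=> hl hr j; rewrite -(splitK j); case: (split j) => i; [apply: hl|apply: hr]. Qed.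

Lemma witt_varXE n (i : 'I_n) : witt_varX n i = mpolyX rat (mnm1 (lshift n i)).
Proof. by rewrite /witt_varX valK. Qed.

Lemma witt_varYE n (i : 'I_n) : witt_varY n i = mpolyX rat (mnm1 (rshift n i)).
Proof. by rewrite /witt_varY valK. Qed.

Lemma ghost_low (R : nzRingType) (z : nat -> R) m :
  (forall i, (i < m)%N -> z i = 0) -> ghost p z m = z m *+ (p ^ m).
Proof.
move=> h; rewrite /ghost big_ord_recr /= subnn expn0 expr1 big1 ?add0r // => i _.
by rewrite h // expr0n expn_eq0 (gtn_eqF p_gt0) /= mul0rn.
Qed.

Section Last.

Variable n' : nat.
Let n := n'.+1.

(** The n'-fold Verschiebung of f; [teich a] below is the Teichmüller representative of a. *)
Definition wV (f : K) : n.-tuple K := [tuple if i == ord_max then f else 0 | i < n].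

Definition wext (w : n'.-tuple K) (f : K) : n.-tuple K :=
  [tuple if unlift ord_max i is Some j then tnth w j else f | i < n].

Definition teich (a : K) : n.-tuple K := [tuple if i == ord0 then a else 0 | i < n].

(** Once Y_0, ..., Y_(n'-1) are set to 0, the ghost components of Y vanish except the last, p^n'
    Y_n'. Adding them to those of X amounts to replacing X_n' by X_n' + Y_n'. *)
Lemma witt_add_V (x : n.-tuple K) f i :
  tnth (witt_add p x (wV f)) i = if i == ord_max then tnth x i + f else tnth x i.
Proof.
pose r (j : 'I_(n + n)) := match split j with
  | inl i => Some j | inr i => if i == ord_max then Some j else None end.
have rinj j j' l : r j = Some l -> r j' = Some l -> j = j'.
  have h j0 : r j0 = Some l -> j0 = l.
    by rewrite /r; case: (split j0) => [i0 [//]|i0]; case: ifP => // _ [].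
  by move=> /h -> /h ->.
have re : witt_env x (wV f) = fun j => oapp (witt_env x (wV f)) 0 (r j).
  apply/funext; apply: split_ind => l; rewrite /r ?splitl ?splitr //.
  by case: ifP => //= h; rewrite witt_envr tnth_mktuple h.
pose X' := @witt_varX n.
pose Y' l := if l == n' then @witt_varY n l else 0.
pose z l := X' l + Y' l.
have eX l : (l < n)%N -> varmap r (witt_varX n l) = X' l.
  by move=> ln; rewrite /X' -[l]/(val (Ordinal ln)) witt_varXE varmapX /r splitl.
have eY l : (l < n)%N -> varmap r (witt_varY n l) = Y' l.
  move=> ln; rewrite /Y' -[l]/(val (Ordinal ln)) witt_varYE varmapX /r splitr.
  by rewrite -val_eqE /=; case: ifP.
have eS : varmap r (witt_sum_poly p n)`_i = z i.
  rewrite unghost_morph //; last exact: varmapZ.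
  apply: unghost_ghost => // j ji; have jn : (j < n)%N by apply: leq_ltn_trans (ltn_ord i).
  rewrite /= rmorphD !ghost_morph.
  rewrite (@ghost_ext p _ (_ \o _) X') => [|l lj]; last by rewrite /= eX //; apply: leq_ltn_trans jn.
  rewrite (@ghost_ext p _ (_ \o _) Y') => [|l lj]; last by rewrite /= eY //; apply: leq_ltn_trans jn.
  have Y0 l : (l < j)%N -> Y' l = 0.
    by move=> lj; rewrite /Y' ltn_eqF // (leq_trans lj).
  rewrite (ghost_low Y0) /ghost !big_ord_recr /= subnn expn0 !expr1 mulrnDl addrA.
  congr (_ + _ + _); apply: eq_bigr => l _; by rewrite /z Y0 // addr0.
rewrite tnth_mktuple /witt_eval -/(witt_env x (wV f)) -/num {1}re -(mmap_varmap num0) // eS.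
rewrite /z /X' /Y' witt_varXE -[i == n' :> nat]/(i == ord_max); case: ifP => im.
  rewrite witt_varYE mmap_XD //.
    by rewrite num1 !mul1r !mmap1U witt_envl witt_envr tnth_mktuple im.
  apply/eqP => /(congr1 (fun m => fun_of_multinom m (lshift n i))).
  by rewrite !mnm1E eqxx eq_rlshift.
by rewrite addr0 mmap_X // num1 mul1r mmap1U witt_envl.
Qed.

(** Only X_0 and Y_n' survive the substitution. The product of the ghost components is zero below
    n', and at n' it is p^n' X_0^(p^n') Y_n'. *)
Lemma witt_mul_V (a f : K) i :
  tnth (witt_mul p (teich a) (wV f)) i
  = if i == ord_max then a ^+ (p ^ n') * f else 0.
Proof.
set x := teich a.
pose r (j : 'I_(n + n)) := match split j with
  | inl i => if i == ord0 then Some j else None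
  | inr i => if i == ord_max then Some j else None end.
have rinj j j' l : r j = Some l -> r j' = Some l -> j = j'.
  have h j0 : r j0 = Some l -> j0 = l.
    by rewrite /r; case: (split j0) => i0; case: ifP => // _ [].
  by move=> /h -> /h ->.
have re : witt_env x (wV f) = fun j => oapp (witt_env x (wV f)) 0 (r j).
  apply/funext; apply: split_ind => l; rewrite /r ?splitl ?splitr //.
    by case: ifP => //= h; rewrite witt_envl tnth_mktuple h.
  by case: ifP => //= h; rewrite witt_envr tnth_mktuple h.
pose X' l := if l == 0%N then @witt_varX n l else 0.
pose Y' l := if l == n' then @witt_varY n l else 0.
pose z l := if l == n' then X' 0%N ^+ (p ^ n') * Y' n' else 0.
have eX l : (l < n)%N -> varmap r (witt_varX n l) = X' l.
  move=> ln; rewrite /X' -[l]/(val (Ordinal ln)) witt_varXE varmapX /r splitl.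
  by rewrite -val_eqE /=; case: ifP.
have eY l : (l < n)%N -> varmap r (witt_varY n l) = Y' l.
  move=> ln; rewrite /Y' -[l]/(val (Ordinal ln)) witt_varYE varmapX /r splitr.
  by rewrite -val_eqE /=; case: ifP.
have eS : varmap r (witt_prod_poly p n)`_i = z i.
  rewrite unghost_morph //; last exact: varmapZ.
  apply: unghost_ghost => // j ji; have jn : (j < n)%N by apply: leq_ltn_trans (ltn_ord i).
  rewrite /= rmorphM !ghost_morph.
  rewrite (@ghost_ext p _ (_ \o _) X') => [|l lj]; last by rewrite /= eX //; apply: leq_ltn_trans jn.
  rewrite (@ghost_ext p _ (_ \o _) Y') => [|l lj]; last by rewrite /= eY //; apply: leq_ltn_trans jn.
  have Y0 l : (l < j)%N -> Y' l = 0.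
    by move=> lj; rewrite /Y' ltn_eqF // (leq_trans lj).
  have z0 l : (l < j)%N -> z l = 0.
    by move=> lj; rewrite /z ltn_eqF // (leq_trans lj).
  rewrite (ghost_low Y0) (ghost_low z0) /ghost big_ord_recl /= subn0 expn0 mulr1n.
  rewrite big1 ?addr0 => [|l _]; last first.
    by rewrite /X' /= expr0n expn_eq0 (gtn_eqF p_gt0) /= mul0rn.
  rewrite mulrnAr /z; case: eqP => [->//|/eqP jn'].
  by rewrite /Y' (negPf jn') mulr0 mul0rn.
rewrite tnth_mktuple /witt_eval -/(witt_env x (wV f)) -/num {1}re -(mmap_varmap num0) // eS.
rewrite /z -[i == n' :> nat]/(i == ord_max); case: ifP => im; last exact: mmap_0.
rewrite /X' /Y' !eqxx -[0%N]/(val (@ord0 n')) witt_varXE -[n']/(val (@ord_max n')) witt_varYE.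
rewrite mpolyXn -mpolyXD mmap_X // num1 mul1r /=.
have -> (h : 'I_(n + n) -> K) m m' : mmap1 h (mnm_add m m') = mmap1 h m * mmap1 h m'.
  by rewrite /mmap1 -big_split; apply: eq_bigr => j _; rewrite mnmDE exprD.
have -> (h : 'I_(n + n) -> K) m e : mmap1 h (mnm_muln m e) = mmap1 h m ^+ e.
  by rewrite /mmap1 -prodrXl; apply: eq_bigr => j _; rewrite mulmnE exprM.
by rewrite !mmap1U witt_envl witt_envr !tnth_mktuple !eqxx.
Qed.

Let wid := widen_ord (leqnSn n').

Lemma tnth_wext_wid w f j : tnth (wext w f) (wid j) = tnth w j.
Proof.
rewrite tnth_mktuple; have -> : wid j = lift ord_max j.
  by apply/val_inj; rewrite /= /bump leqNgt ltn_ord.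
by rewrite liftK.
Qed.

Lemma tnth_wext_max w f : tnth (wext w f) ord_max = f.
Proof. by rewrite tnth_mktuple unlift_none. Qed.

Lemma ord_last_ind (P : 'I_n -> Prop) :
  P ord_max -> (forall j, P (wid j)) -> forall i, P i.
Proof.
move=> hm hw i; case: (unliftP ord_max i) => [j ->|->//].
have -> : lift ord_max j = wid j; last exact: hw.
by apply/val_inj; rewrite /= /bump leqNgt ltn_ord.
Qed.

(** The Witt polynomial of index j depends only on the ghost components of index at most j. For
    lengths n' and n it lives in different polynomial rings, compared through [varmap]; the
    hypothesis on [g] is naturality in the variables. *)
Lemma witt_eval_prefix (g : forall N, nat -> nat -> mpoly (N + N) rat) :
  forall (j : 'I_n') (x y : n'.-tuple K) f h,
  (forall (f : {rmorphism mpoly (n' + n') rat -> mpoly (n + n) rat}) m,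
      (forall l, (l <= m)%N -> f (witt_varX n' l) = witt_varX n l) ->
      (forall l, (l <= m)%N -> f (witt_varY n' l) = witt_varY n l) ->
      f (g n' p m) = g n p m) ->
  witt_eval (unghost p (g n p) n)`_j (wext x f) (wext y h)
  = witt_eval (unghost p (g n' p) n')`_j x y.
Proof.
move=> j x y f h hg.
pose r (l : 'I_(n' + n')) : option 'I_(n + n) := match split l with
  | inl i => Some (lshift n (wid i)) | inr i => Some (rshift n (wid i)) end.
have wid_inj : injective wid by move=> a b /(congr1 val) /= /val_inj.
have rinj a b l : r a = Some l -> r b = Some l -> a = b.
  elim/split_ind: a => a; elim/split_ind: b => b; rewrite /r ?splitl ?splitr.
  - by move=> [<-] /Some_inj/lshift_inj/wid_inj ->.
  - by move=> [<-] /Some_inj/eqP; rewrite eq_rlshift.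
  - by move=> [<-] /Some_inj/eqP; rewrite eq_lrshift.
  - by move=> [<-] /Some_inj/rshift_inj/wid_inj ->.
have re : witt_env x y = fun l => oapp (witt_env (wext x f) (wext y h)) 0 (r l).
  apply/funext; apply: split_ind => l; rewrite /r ?splitl ?splitr /=.
    by rewrite !witt_envl tnth_wext_wid.
  by rewrite !witt_envr tnth_wext_wid.
rewrite /witt_eval -/(witt_env x y) -/(witt_env (wext x f) (wext y h)) -/num re.
rewrite -(mmap_varmap num0) // unghost_morph //; last exact: varmapZ.
congr mmap; apply: unghost_ext => //; first by rewrite ltnS ltnW.
move=> l lj; rewrite /= hg // => m ml.
  have mn : (m < n')%N by apply: leq_ltn_trans ml (leq_ltn_trans lj _).
  rewrite -[m]/(val (Ordinal mn)) witt_varXE varmapX /r splitl -witt_varXE //.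
have mn : (m < n')%N by apply: leq_ltn_trans ml (leq_ltn_trans lj _).
by rewrite -[m]/(val (Ordinal mn)) witt_varYE varmapX /r splitr -witt_varYE.
Qed.

Lemma eq_witt (x y : n.-tuple K) : tnth x ord_max = tnth y ord_max ->
  (forall j, tnth x (wid j) = tnth y (wid j)) -> x = y.
Proof. by move=> h1 h2; apply/eq_from_tnth; apply: ord_last_ind. Qed.

Lemma witt_add_wext (x y : n'.-tuple K) f h :
  witt_add p (wext x f) (wext y h)
  = wext (witt_add p x y) (witt_eval (witt_sum_poly p n)`_n' (wext x f) (wext y h)).
Proof.
apply: eq_witt => [|j]; first by rewrite tnth_wext_max tnth_mktuple.
rewrite tnth_wext_wid !tnth_mktuple.
apply: (@witt_eval_prefix (fun N p m => ghost p (@witt_varX N) m + ghost p (@witt_varY N) m)).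
move=> g m hX hY; rewrite rmorphD !ghost_morph.
by congr (_ + _); apply: ghost_ext => l lm; [apply: hX | apply: hY].
Qed.

Lemma witt_mul_wext (x y : n'.-tuple K) f h :
  witt_mul p (wext x f) (wext y h)
  = wext (witt_mul p x y) (witt_eval (witt_prod_poly p n)`_n' (wext x f) (wext y h)).
Proof.
apply: eq_witt => [|j]; first by rewrite tnth_wext_max tnth_mktuple.
rewrite tnth_wext_wid !tnth_mktuple.
apply: (@witt_eval_prefix (fun N p m => ghost p (@witt_varX N) m * ghost p (@witt_varY N) m)).
move=> g m hX hY; rewrite rmorphM !ghost_morph.
by congr (_ * _); apply: ghost_ext => l lm; [apply: hX | apply: hY].
Qed.

Lemma wext_split w f : wext w f = witt_add p (wext w 0) (wV f).
Proof.
apply: eq_witt => [|j]; rewrite witt_add_V.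
  by rewrite eqxx !tnth_wext_max add0r.
by rewrite -val_eqE /= ltn_eqF // !tnth_wext_wid.
Qed.

Lemma wV_add f g : witt_add p (wV f) (wV g) = wV (f + g).
Proof.
by apply/eq_from_tnth => i; rewrite witt_add_V !tnth_mktuple; case: (i == ord_max).
Qed.

Lemma wV_mul a f : witt_mul p (teich a) (wV f) = wV (a ^+ (p ^ n') * f).
Proof. by apply/eq_from_tnth => i; rewrite witt_mul_V !tnth_mktuple. Qed.

Lemma frob_teich a : witt_frob p (teich a) = teich (a ^+ p).
Proof.
apply/eq_from_tnth => i; rewrite !tnth_mktuple; case: ifP => // _.
by rewrite expr0n (gtn_eqF p_gt0).
Qed.

Lemma frob_wext w f : witt_frob p (wext w f) = wext (witt_frob p w) (f ^+ p).
Proof.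
apply: eq_witt => [|j]; rewrite tnth_mktuple ?tnth_wext_max // !tnth_wext_wid.
by rewrite tnth_mktuple.
Qed.

Lemma nth0_wext w f : (0 < n')%N -> (wext w f)`_0 = w`_0.
Proof.
move=> n0; have := tnth_wext_wid w f (Ordinal n0).
by rewrite !(tnth_nth 0).
Qed.

Lemma nth0_teich a : (teich a)`_0 = a.
Proof. by rewrite -[0%N]/(val (@ord0 n')) -tnth_nth tnth_mktuple. Qed.

End Last.

End WittVectors.

(** * Poles of polynomial expressions in sections *)

Section WittSections.

Variables (K : fieldType) (X : integralScheme K).
Hypothesis val_X : forall x : X, is_prime_divisor x -> valued x.

Lemma div_secP (D : X -> rat) U f : div_sec D U f <->
  (f != 0 -> forall x, U x -> is_prime_divisor x -> (- ord x f)%:~R <= D x).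
Proof.
by split=> h f0 x Ux dx; have := h f0 x Ux dx;
  rewrite -?floor_ge_int -?(lerBlDl 0) ?sub0r // -subr_ge0 opprK addrC.
Qed.

Lemma div_sec_sec (D : X -> rat) (U : set X) f : open U ->
  (forall x, 0 <= D x) -> sec U f -> div_sec D U f.
Proof.
move=> oU D0 Uf; apply/div_secP => f0 x Ux dx; apply: le_trans (D0 x).
have : 0 <= ord x f by apply/(ord_ge0 (val_X dx)) => //; exists U.
by rewrite -(ler_int rat) mulrNz oppr_le0.
Qed.

Lemma div_sec0 (D : X -> rat) U : div_sec D U 0.
Proof. by move=> /eqP. Qed.

Lemma div_secN (D : X -> rat) U f : div_sec D U f -> div_sec D U (- f).
Proof.
move=> hf nf0 x Ux dx; have vx := val_X dx.
have f0 : f != 0 by rewrite -oppr_eq0.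
have -> : - f = -1 * f by rewrite mulN1r.
rewrite (ordM vx) ?oppr_eq0 ?oner_eq0 // (ord_unit vx) ?add0r; first exact: hf.
have x1 : stalk x (-1) by apply: subringN (stalk_subring x) (stalk1 x).
by split; rewrite ?oppr_eq0 ?oner_eq0 ?invrN1.
Qed.

Lemma div_secD (D : X -> rat) U f g : div_sec D U f -> div_sec D U g ->
  div_sec D U (f + g).
Proof.
have [->|f0] := eqVneq f 0; first by rewrite add0r.
have [->|g0] := eqVneq g 0; first by rewrite addr0.
move=> hf hg fg0 x Ux dx.
have key h : (0 <= ord x h + Num.floor (D x)) = (- Num.floor (D x) <= ord x h).
  by rewrite -[RHS]subr_ge0 opprK.
have := hf f0 x Ux dx; have := hg g0 x Ux dx; rewrite !key => h1 h2.
exact: ord_geD (val_X dx) _ _ _ _ _ _ _ _.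
Qed.

Lemma div_sec_sum (D : X -> rat) U (I : Type) (r : seq I) (P : pred I) F :
  (forall i, P i -> div_sec D U (F i)) -> div_sec D U (\sum_(i <- r | P i) F i).
Proof. by move=> h; apply: big_ind => //; [exact: div_sec0 | exact: div_secD]. Qed.

Lemma div_secMz (D : X -> rat) U f (z : int) : div_sec D U f -> div_sec D U (z%:~R * f).
Proof.
move=> hf; have hn (n : nat) : div_sec D U (n%:R * f).
  elim: n => [|n IH]; first by rewrite mul0r; apply: div_sec0.
  by rewrite -addn1 natrD mulrDl mul1r; apply: div_secD.
case: z => n; first exact: hn.
by rewrite NegzE mulrNz mulNr; apply: div_secN; apply: hn.
Qed.

Lemma div_secM (D D' : X -> rat) U f g : div_sec D U f -> div_sec D' U g ->
  div_sec (fun x => D x + D' x) U (f * g).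
Proof.
move=> /div_secP hf /div_secP hg; apply/div_secP; rewrite mulf_eq0 negb_or => /andP[f0 g0] x Ux dx.
by rewrite (ordM (val_X dx)) // opprD intrD lerD ?hf ?hg.
Qed.

Lemma div_sec_mmap1 N (v : 'I_N -> nat) (h : 'I_N -> K) (D : X -> rat) U (m : multinom N) :
  (forall j, div_sec (fun x => (v j)%:R * D x) U (h j)) ->
  div_sec (fun x => (\sum_i m i * v i)%N%:R * D x) U (mmap1 h m).
Proof.
move=> hh; apply/div_secP => mm0 x Ux dx; have vx := val_X dx.
have h0 i : h i ^+ m i != 0 by move/prodf_neq0: mm0; apply.
rewrite /mmap1 (ord_prod vx) // -sumrN rmorph_sum natr_sum mulr_suml /=.
apply: ler_sum => i _; have [->|mi] := eqVneq (m i) 0%N.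
  by rewrite expr0 (ordx1 vx) oppr0 mul0n mul0r.
have hi0 : h i != 0 by have := h0 i; rewrite expf_eq0 lt0n mi.
rewrite (ordX vx) // natrM -mulrA mulr_natl -mulNrn rmorphMn /= ler_wMn2r //.
by have /div_secP := hh i; apply.
Qed.

Lemma div_sec_mmap N (v : 'I_N -> nat) (h : 'I_N -> K) (D : X -> rat) U e
    (q : mpoly N rat) : whom v e q ->
  (forall j, div_sec (fun x => (v j)%:R * D x) U (h j)) ->
  div_sec (fun x => e%:R * D x) U (mmap (fun c => (numq c)%:~R) h q).
Proof.
move=> hq hh; rewrite /mmap big_seq; apply: div_sec_sum => m mq.
by apply: div_secMz; rewrite -(hq m mq); apply: div_sec_mmap1.
Qed.

End WittSections.

(** * Quasi-F-splittings *)

Section Splitting.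

Variables (K : fieldType) (X : integralScheme K) (p : nat).
Hypothesis charK : p \in [pchar K].
Hypothesis val_X : forall x : X, is_prime_divisor x -> valued x.

Let p_gt0 : (0 < p)%N := prime_gt0 (pcharf_prime charK).

(** With X_l and Y_l of weight p^l, the sum polynomial of index i is homogeneous of weight p^i,
    which matches the bound p^i D on the i-th entry. *)
Lemma witt_add_sec n (D : X -> rat) U (y z : n.-tuple K) :
  witt_div_sec p D U y -> witt_div_sec p D U z -> witt_div_sec p D U (witt_add p y z).
Proof.
move=> hy hz i; rewrite tnth_mktuple.
pose v (j : 'I_(n + n)) : nat :=
  match split j with inl l => (p ^ l)%N | inr l => (p ^ l)%N end.
apply: (div_sec_mmap val_X (v := v)).
  apply: unghost_whom => // j jn; apply: whomD; apply: ghost_whom => // l lj.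
    have ln := leq_ltn_trans lj jn; rewrite -[l]/(val (Ordinal ln)) witt_varXE.
    have -> : (p ^ Ordinal ln)%N = v (lshift n (Ordinal ln)) by rewrite /v splitl.
    exact: whomX.
  have ln := leq_ltn_trans lj jn; rewrite -[l]/(val (Ordinal ln)) witt_varYE.
  have -> : (p ^ Ordinal ln)%N = v (rshift n (Ordinal ln)) by rewrite /v splitr.
  exact: whomX.
by apply: split_ind => l; rewrite /v ?splitl ?splitr; [apply: hy | apply: hz].
Qed.

Lemma witt_mul_sec n (D : X -> rat) U (a z : n.-tuple K) : open U ->
  witt_sec U a -> witt_div_sec p D U z -> witt_div_sec p D U (witt_mul p a z).
Proof.
move=> oU ha hz i; rewrite tnth_mktuple.
(* Entries of Witt vectors over O_X have no poles, so the X_l are given weight 0. *)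
pose v (j : 'I_(n + n)) : nat :=
  match split j with inl l => 0%N | inr l => (p ^ l)%N end.
apply: (div_sec_mmap val_X (v := v)).
  apply: unghost_whom => // j jn; rewrite -[(p ^ j)%N]add0n; apply: whomM.
    apply: ghost_whom0 => // l lj.
    have ln := leq_ltn_trans lj jn; rewrite -[l]/(val (Ordinal ln)) witt_varXE.
    have -> : 0%N = v (lshift n (Ordinal ln)) by rewrite /v splitl.
    exact: whomX.
  apply: ghost_whom => // l lj.
  have ln := leq_ltn_trans lj jn; rewrite -[l]/(val (Ordinal ln)) witt_varYE.
  have -> : (p ^ Ordinal ln)%N = v (rshift n (Ordinal ln)) by rewrite /v splitr.
  exact: whomX.
apply: split_ind => l; rewrite /v ?splitl ?splitr; last exact: hz.
by apply: div_sec_sec => // x; rewrite mul0r.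
Qed.

Lemma wext_sec n (D : X -> rat) U (w : n.-tuple K) f :
  witt_div_sec p D U w -> div_sec (fun x => (p ^ n)%:R * D x) U f ->
  witt_div_sec p D U (wext w f).
Proof.
move=> hw hf; apply: ord_last_ind; first by rewrite tnth_wext_max.
by move=> j; rewrite tnth_wext_wid; apply: hw.
Qed.

Lemma wV_sec n (D : X -> rat) U f :
  div_sec (fun x => (p ^ n)%:R * D x) U f -> witt_div_sec p D U (wV n f).
Proof.
move=> hf i; rewrite tnth_mktuple; case: eqP => [->//|_]; exact: div_sec0.
Qed.

Lemma wext_witt_sec n U (w : n.-tuple K) : open U -> U !=set0 ->
  witt_sec (X := X) U w -> witt_sec U (wext w 0).
Proof.
move=> oU nU hw; apply: ord_last_ind => [|j]; last by rewrite tnth_wext_wid.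
by rewrite tnth_wext_max; apply: subring0; apply: sec_subring.
Qed.

Lemma quasi_split_descent (Delta : X -> rat) n (alpha : set X -> n.+1.-tuple K -> K) :
  (0 < n)%N ->
  let M U := witt_div_sec (n := n.+1) p (fun x => p%:R * Delta x) U in
  [/\ forall U, open U -> U !=set0 -> forall z, M U z -> sec U (alpha U z),
        forall U V, open U -> open V -> V !=set0 -> V `<=` U ->
          forall z, M U z -> alpha V z = alpha U z,
        forall U, open U -> U !=set0 -> forall y z, M U y -> M U z ->
          alpha U (witt_add p y z) = alpha U y + alpha U z,
        forall U, open U -> U !=set0 ->
          forall a z, witt_sec U a -> M U z ->
          alpha U (witt_mul p (witt_frob p a) z) = a`_0 * alpha U z
      & forall U, open U -> U !=set0 ->
          forall z, witt_div_sec p Delta U z ->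
          alpha U (witt_frob p z) = z`_0] ->
  (forall U f, open U -> U !=set0 ->
     div_sec (fun x => (p ^ n)%:R * (p%:R * Delta x)) U f -> alpha U (wV n f) = 0) ->
  n_quasi_F_split p Delta n.
Proof.
move=> n0 M [h1 h2 h3 h4 h5] hV; split=> //.
exists (fun U w => alpha U (wext w 0)) => M'.
have M0 U w : M' U w -> M U (wext w 0) by move=> hw; apply: wext_sec => //; apply: div_sec0.
(* Appending 0 is not additive. As alpha kills the last Verschiebung, this identity absorbs the last
   entries that sums and products create. *)
have lastE U w f : open U -> U !=set0 -> M' U w ->
    div_sec (fun x => (p ^ n)%:R * (p%:R * Delta x)) U f ->
    alpha U (wext w f) = alpha U (wext w 0).
  move=> oU nU hw hf; rewrite (wext_split p_gt0) h3 //; [|exact: M0|exact: wV_sec].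
  by rewrite hV // addr0.
split.
- by move=> U oU nU w hw; apply: h1 => //; apply: M0.
- by move=> U V oU oV nV VU w hw; apply: h2 => //; apply: M0.
- move=> U oU nU y z hy hz.
  have hs := witt_add_sec (M0 U y hy) (M0 U z hz).
  have := h3 U oU nU _ _ (M0 _ _ hy) (M0 _ _ hz) => <-; rewrite witt_add_wext //.
  apply/esym/lastE => //; first exact: witt_add_sec.
  by have := hs ord_max; rewrite tnth_mktuple.
- move=> U oU nU a z ha hz.
  have ha' := wext_witt_sec oU nU ha.
  have fsec m (b : m.-tuple K) : witt_sec U b -> witt_sec U (witt_frob p b).
    by move=> hb i; rewrite tnth_mktuple; apply: subringX; [apply: sec_subring|apply: hb].
  have hs := witt_mul_sec oU (fsec _ _ ha') (M0 U z hz).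
  have := h4 U oU nU _ _ ha' (M0 _ _ hz); rewrite nth0_wext // => <-.
  rewrite frob_wext // expr0n (gtn_eqF p_gt0) in hs *; rewrite witt_mul_wext //.
  apply/esym/lastE => //; first by apply: witt_mul_sec => //; apply: fsec.
  by have := hs ord_max; rewrite tnth_mktuple.
- move=> U oU nU z hz; have := h5 U oU nU (wext z 0).
  rewrite frob_wext // expr0n (gtn_eqF p_gt0) nth0_wext //; apply.
  by apply: wext_sec => //; apply: div_sec0.
Qed.

Lemma quasi_split_last (Delta : X -> rat) n :
  (forall x, 0 <= Delta x) -> n_quasi_F_split p Delta n ->
  (forall m, n_quasi_F_split p Delta m -> (n <= m)%N) ->
  let L U := div_sec (fun x => (p ^ n)%:R * Delta x) U in
  exists phi : set X -> K -> K,
    [/\ forall U, open U -> U !=set0 -> forall f, L U f -> sec U (phi U f),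
        forall U V, open U -> open V -> V !=set0 -> V `<=` U ->
          forall f, L U f -> phi V f = phi U f,
        forall U, open U -> U !=set0 -> forall f g, L U f -> L U g ->
          phi U (f + g) = phi U f + phi U g,
        forall U, open U -> U !=set0 -> forall a f, sec U a -> L U f ->
          phi U (a ^+ (p ^ n) * f) = a * phi U f
      & exists U f, [/\ open U, U !=set0, L U f & phi U f != 0]].
Proof.
move=> D0; case: n => [[]//|n] [_ [alpha]] hM hmin L; have := hM => -[h1 h2 h3 h4 h5].
have eL U f : div_sec (fun x => (p ^ n)%:R * (p%:R * Delta x)) U f <-> L U f.
  rewrite /L (_ : (fun x => _) = (fun x => (p ^ n.+1)%:R * Delta x)) //.
  by apply/funext => x; rewrite mulrA -natrM -expnSr.
have LV U f : L U f -> witt_div_sec p (fun x => p%:R * Delta x) U (wV n f).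
  by move=> /eL; apply: wV_sec.
exists (fun U f => alpha U (wV n f)); split.
- by move=> U oU nU f Lf; apply: h1 => //; apply: LV.
- by move=> U V oU oV nV VU f Lf; apply: h2 => //; apply: LV.
- move=> U oU nU f g Lf Lg; rewrite -(wV_add p_gt0) h3 //; exact: LV.
- move=> U oU nU a f Ua Lf.
  have := h4 U oU nU (teich n a) (wV n f); rewrite frob_teich // wV_mul //.
  rewrite nth0_teich -exprM -expnS; apply; last exact: LV.
  move=> i; rewrite tnth_mktuple; case: ifP => // _.
  by apply: subring0; apply: sec_subring.
apply: contrapT => none.
have zero U f : open U -> U !=set0 -> L U f -> alpha U (wV n f) = 0.
  by move=> oU nU Lf; apply/eqP; apply: contrapT => /negP h; apply: none; exists U, f.
(* In length one there is no shorter splitting to contradict minimality; instead alpha takes the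
   value 1 at F(1) = 1. *)
case: n => [|n] in alpha hM hmin L h1 h2 h3 h4 h5 eL LV none zero *.
  have oT : open [set: X] by apply: openT.
  have nT : [set: X] !=set0 by have [x _] := space_nonempty X; exists x.
  have hT : is_subring (sec [set: X]) by apply: sec_subring.
  have i1 (i : 'I_1) : (i == ord_max) = true by rewrite !ord1.
  have w1 : witt_div_sec p Delta [set: X] (wV 0 1).
    move=> i; rewrite tnth_mktuple i1; apply: div_sec_sec => //.
      by move=> x; rewrite mulr_ge0.
    by case: hT.
  have := h5 _ oT nT _ w1.
  have -> : witt_frob p (wV 0 1) = wV 0 1 :> 1.-tuple K.
    by apply/eq_from_tnth => i; rewrite !tnth_mktuple i1 expr1n.
  rewrite zero //; last by apply: div_sec_sec => // [x|]; [rewrite mulr_ge0|case: hT].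
  by move=> /esym/eqP; rewrite -[0%N]/(val (@ord0 0)) -tnth_nth tnth_mktuple i1 oner_eq0.
have : n_quasi_F_split p Delta n.+1.
  by apply: (quasi_split_descent _ hM) => // U f oU nU /eL; apply: zero.
by move=> /hmin; rewrite ltnn.
Qed.

End Splitting.

(** * Extension of the map to the function field *)

Section Globalization.

Variables (K : fieldType) (X : integralScheme K) (q : nat).
Hypothesis q_gt0 : (0 < q)%N.
Hypothesis val_X : forall x : X, is_prime_divisor x -> valued x.
Variable E : X -> rat.
Hypothesis E0 : forall x, 0 <= E x.

Let L (U : set X) : set K := div_sec E U.

Let LM (U : set X) a f : open U -> sec U a -> L U f -> L U (a * f).
Proof.
move=> oU Ua Lf; rewrite /L (_ : E = fun x => 0 + E x); last first.
  by apply/funext => x; rewrite add0r.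
by apply: div_secM => //; apply: div_sec_sec.
Qed.

Let LS (U V : set X) f : V `<=` U -> L U f -> L V f.
Proof. by move=> VU Lf f0 x /VU; apply: Lf. Qed.

Variable phi : set X -> K -> K.
Hypothesis phi_res : forall U V, open U -> open V -> V !=set0 -> V `<=` U ->
  forall f, L U f -> phi V f = phi U f.
Hypothesis phiD : forall U, open U -> U !=set0 -> forall f g, L U f -> L U g ->
  phi U (f + g) = phi U f + phi U g.
Hypothesis phiZ : forall U, open U -> U !=set0 -> forall a f, sec U a -> L U f ->
  phi U (a ^+ q * f) = a * phi U f.

(** The q-th power of a denominator b of f makes f a section on an affine open U0, and semilinearity
    forces [Phi f] to be [phi U0 (b ^+ q * f) / b]. Other open sets are compared with U0 on the
    intersection. *)
Lemma phi_global : exists Phi : K -> K,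
  [/\ forall f g, Phi (f + g) = Phi f + Phi g,
      forall a f, Phi (a ^+ q * f) = a * Phi f
    & forall U f, open U -> U !=set0 -> L U f -> Phi f = phi U f].
Proof.
have [x0 _] := space_nonempty X.
have [U0 [[oU nU frac] _] Ux0] := locally_affine x0.
have hA := sec_subring oU nU; have [A1 AB AM] := hA.
pose R f y := exists b, [/\ sec U0 b, b != 0, L U0 (b ^+ q * f) & phi U0 (b ^+ q * f) = b * y].
have /choice[Phi hPhi] : forall f, exists y, R f y.
  move=> f; have [a [c [Ua Uc c0 ->]]] := frac f.
  exists ((phi U0 (c ^+ q * (a / c))) / c), c; split=> //; last by rewrite [RHS]mulrCA divff ?mulr1.
  have -> : c ^+ q * (a / c) = (a * c ^+ q.-1) * 1.
    by rewrite -(prednK q_gt0) exprS /= mulr1; field.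
  by apply: LM => //; [apply: AM => //; apply: subringX | apply: div_sec_sec].
have Runiq f y y' : R f y -> R f y' -> y = y'.
  move=> [b [Ub b0 Lb eb]] [b' [Ub' b0' Lb' eb']].
  have := phiZ oU nU Ub' Lb; rewrite eb mulrCA phiZ // eb' mulrCA.
  by move=> /(mulfI b0')/(mulfI b0).
have Rmul f y b : R f y -> sec U0 b -> b != 0 ->
    exists c, [/\ sec U0 (b * c), b * c != 0, L U0 ((b * c) ^+ q * f) & phi U0 ((b * c) ^+ q * f) = b * c * y].
  move=> [c [Uc c0 Lc ec]] Ub b0; exists c; rewrite mulf_neq0 // exprMn -!mulrA; split=> //.
  - exact: AM.
  - by apply: LM => //; apply: subringX.
  - by rewrite phiZ // ec.
exists Phi; split=> [f g|a f|U f oU' nU' Lf].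
- have [b [Ub b0 Lb eb]] := hPhi f.
  have [c [Uc c0 Lc ec]] := Rmul _ _ b (hPhi g) Ub b0.
  have [e [Ue e0 Le ee]] := hPhi g.
  apply: (Runiq (f + g)); first exact: hPhi.
  exists (b * e); rewrite exprMn mulf_neq0 // mulrDr; split=> //.
  + exact: AM.
  + apply: div_secD => //; rewrite -mulrA; last by apply: LM => //; apply: subringX.
    by rewrite mulrCA; apply: LM => //; apply: subringX.
  + rewrite -!mulrA phiD //; last by apply: LM => //; apply: subringX.
      by rewrite [b ^+ q * (_ * f)]mulrCA (phiZ oU nU Ue Lb) (phiZ oU nU Ub Le) eb ee; ring.
    by rewrite mulrCA; apply: LM => //; apply: subringX.
- have [c [e [Uc Ue e0 ->]]] := frac a; have [b [Ub b0 Lb eb]] := hPhi f.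
  apply: (Runiq ((c / e) ^+ q * f)); first exact: hPhi.
  have eq1 : (b * e) ^+ q * ((c / e) ^+ q * f) = c ^+ q * (b ^+ q * f).
    rewrite !exprMn exprVn; field; by rewrite expf_neq0.
  exists (b * e); rewrite mulf_neq0 // eq1; split=> //; first exact: AM.
    by apply: LM => //; apply: subringX.
  by rewrite phiZ // eb; field.
- have [b [Ub b0 Lb eb]] := hPhi f.
  have [oV nV] := setI_open oU oU' nU nU'.
  have Vb := sec_mono oU oV nV (@subIsetl _ _ _) Ub.
  apply: (mulfI b0); rewrite -eb -(phi_res oU oV nV (@subIsetl _ _ _) Lb).
  have LVf : L (U0 `&` U) f by apply: LS Lf.
  by rewrite phiZ // (phi_res oU' oV nV (@subIsetr _ _ _) Lf).
Qed.

End Globalization.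

(** * Local analysis at a prime divisor *)

Section Local.

Variables (k K : fieldType) (iota : {rmorphism k -> K}) (X : integralScheme K).
Hypothesis val_X : forall x : X, is_prime_divisor x -> valued x.

Lemma stalk_seq (U : set X) (x : X) (s : seq K) : open U -> U x ->
  (forall a, a \in s -> stalk x a) ->
  exists V, [/\ open V, V x, V `<=` U & forall a, a \in s -> sec V a].
Proof.
move=> oU Ux; elim: s => [|a s IH] hs; first by exists U; split=> // z.
have [V [oV Vx VU sV]] := IH (fun b bs => hs b (mem_behead (s := a :: s) bs)).
have [W [oW Wx Wa]] := hs a (mem_head _ _).
have [oVW nVW] : open (V `&` W) /\ (V `&` W) !=set0.
  by apply: setI_open => //; exists x.
exists (V `&` W); split=> //; first by move=> z [/VU].
move=> b; rewrite inE => /orP[/eqP ->|/sV].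
  exact: (sec_mono oW oVW nVW (@subIsetr _ _ _)).
exact: (sec_mono oV oVW nVW (@subIsetl _ _ _)).
Qed.

(* A neighbourhood of [x] in which the uniformizer at [x] generates the ideal
   of [x], and thus has no other zero of codimension one. *)
Lemma div_sec_local (U : set X) N (y : 'I_N -> K) (x : X) (E : X -> rat) f :
  chart iota U y -> U x -> is_prime_divisor x -> (forall z, 0 <= E z) ->
  f != 0 -> 0 <= ord x f + Num.floor (E x) ->
  exists V, [/\ open V, V x & div_sec E V f].
Proof.
move=> hUy Ux dx E0 f0 hf; have hU : affine_open (@sec K X) U by case: hUy.
have oU : open U by case: hU => -[].
have [t ht dec] := val_X dx; have [t0 xt nut hts] := ht.
have [u [n [uu ef]]] := dec f f0; have [u0 xu xu'] := uu.
have [s sx hs] := van_fin_gen hUy Ux.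
have [|V [oV Vx VU sV]] := @stalk_seq U x [:: t, u, u^-1 & [seq a / t | a <- s]] oU Ux.
  move=> a; rewrite !inE => /or4P[/eqP ->|/eqP ->|/eqP ->|/mapP[b bs ->]] //.
  have [Ub nb] := sx b bs; apply: hts => //.
  exact: (sec_stalk hU).
exists V; split=> // _ z Vz dz; have [->//|zx] := pselect (z = x).
have tz : stalk z t by exists V; split=> //; apply: sV; rewrite mem_head.
have uz : is_unit_in (stalk z) u.
  by split=> //; exists V; split=> //; apply: sV; rewrite !inE eqxx ?orbT.
(* If t vanished at z, so would the generators of the ideal of x, which are multiples of t over V;
   then z = x, as both have codimension one. *)
have utz : is_unit_in (stalk z) t.
  apply: contrapT => nt; apply: zx; apply/esym; have Uz := VU _ Vz.
  apply: (divisor_van_inj hU) => //.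
  have [[_ z0 _] [zD zM _]] := van_prime hU Uz.
  apply: hs => // a as_; split; first by case: (sx a as_).
  move=> ua; apply: nt; have xat : stalk z (a / t).
    by exists V; split=> //; apply: sV; rewrite !inE (map_f (fun b => b / t) as_) !orbT.
  by apply: (unitMl tz xat); rewrite mulrC mulfVK.
rewrite ef (ord_unit (val_X dz)); last by apply: unitM => //; apply: unitXz.
by rewrite add0r floor_ge0.
Qed.

End Local.

Section LocalCoordinates.

Variables (k K : fieldType) (iota : {rmorphism k -> K}) (X : integralScheme K).

(* If [w] has order [n] at [x] and [s] is a uniformizer, then [s^(-n) w] is a
   sum of forms [a dt] with [a] and [t] regular at [x]; these cannot all be
   multiples of [s^(1-n) w]. *)
Lemma local_coordinates (x : X) d (w : ('I_d -> K -> K) -> K) (D : 'I_d -> K -> K) n :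
  valued x -> form_has_ord iota w x n -> (forall i, is_derivation iota (D i)) ->
  w D != 0 ->
  exists t : 'I_d -> K,
    [/\ forall j, stalk x (t j), jac D t != 0 & ord x (jac D t) <= ord x (w D) - n].
Proof.
move=> vx hord hD wD; have [s hs dec] := vx; have [s0 xs nus _] := hs.
pose g := s ^ (- n); have g0 : g != 0 by apply: expfz_neq0.
have og : ord x g = - n by rewrite -[g]mul1r (ordP hs) //; apply: unit1.
have [|m [a [t [xa xt ew]]]] := proj2 (hord g g0); first by rewrite og addNr.
have gw0 : g * w D != 0 by rewrite mulf_neq0.
have ogw : ord x (g * w D) = ord x (w D) - n by rewrite (ordM vx) // og addrC.
apply: contrapT => none; apply: nus; split=> //.
have -> : s^-1 = \sum_(l < m) a l * jac D (t l) / (g * w D) / s.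
  rewrite -!mulr_suml -[X in _ = X / _ / _](ew D hD) divff // mul1r //.
apply: subring_sum => [|l _]; first exact: stalk_subring.
have [j0|j0] := eqVneq (jac D (t l)) 0.
  by rewrite j0 mulr0 !mul0r; apply: subring0; apply: stalk_subring.
have os : ord x s = 1 by rewrite -[s]mul1r -(expr1z s) (ordP hs) //; apply: unit1.
rewrite -!mulrA; apply: stalkM => //.
have n0 : jac D (t l) * ((g * w D)^-1 * s^-1) != 0.
  by rewrite !mulf_neq0 ?invr_eq0 //; case/norP: (gw0).
apply/(ord_ge0 vx n0); rewrite !(ordM vx) ?mulf_neq0 ?invr_eq0 //.
rewrite !(ordV vx) // ogw os addrA subr_ge0 -ltzD1.
have : ~ (ord x (jac D (t l)) <= ord x (w D) - n) by move=> h; apply: none; exists (t l).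
move=> /negP; rewrite -ltNge; lia.
Qed.

End LocalCoordinates.

Lemma mul_addV_int (q : nat) (a b : int) : (0 < q)%N ->
  q%:R * - (a%:~R + q%:R^-1 * b%:~R) = (- (a *+ q + b))%:~R :> rat.
Proof.
move=> q0; have qn0 : (q%:R : rat) != 0 by rewrite pnatr_eq0 -lt0n.
rewrite -(mulr_natr a q) rmorphN rmorphD rmorphM /= [(q%:R)%:~R]rmorph_nat.
by field.
Qed.

Theorem proposition3p14 (p : nat) (k : fieldType)
  (char_k : p \in [pchar k])
  (perfect_k : forall a : k, exists b : k, b ^+ p = a)
  (K : fieldType) (iota : {rmorphism k -> K})
  (X : integralScheme K)
  (normal_X : is_normal X) (projective_X : is_projective iota X)
  (Delta : X -> rat) (divisor_Delta : is_Qdivisor Delta)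
  (floor_Delta : forall x : X, Num.floor (Delta x) = 0)
  (split_Delta : quasi_F_split p Delta)
  (n : nat) (split_n : n_quasi_F_split p Delta n)
  (min_n : forall m : nat, n_quasi_F_split p Delta m -> (n <= m)%N)
  (KX : X -> int) (canonical_KX : is_canonical_divisor iota KX) :
  iitaka_dim_ge0 (fun x : X =>
    - ((KX x)%:~R
       + ((p ^ n)%:R - 1)^-1 * (Num.floor ((p ^ n)%:R * Delta x))%:~R)).
Proof.
have charK : p \in [pchar K] by rewrite (fmorph_pchar iota).
have p_pr := pcharf_prime charK.
have n_gt0 : (0 < n)%N by case: split_n.
have q_gt1 : (1 < p ^ n)%N by rewrite -(exp1n n) ltn_exp2r // prime_gt1.
have Delta_ge0 x : 0 <= Delta x by rewrite -floor_ge0 floor_Delta.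
have [_ [d [w [dimX form_w [D [hD wD]] ord_w]]]] := canonical_KX.
have hD' i : derivation (D i) by case: (hD i).
have hb (t : 'I_d -> K) : jac D t != 0 -> pbasis p t.
  move=> ht; have [F hF _] := jac_dual hD' ht; have it := pindep_dual charK hF.
  split=> //; have [x0 _] := space_nonempty X.
  have [U [N [y [_ hUy]]]] := projective_chart x0 projective_X.
  exact: (dim_pspan hUy charK perfect_k dimX it).
have val_X (x : X) : is_prime_divisor x -> valued x.
  move=> dx; have [U [N [y [Ux hUy]]]] := projective_chart x projective_X.
  have [t ht] := exists_uniformizer charK hUy Ux dx form_w hD wD (ord_w x dx).
  exact: (uniformizer_valued (proj1 hUy) Ux dx ht).
have [t0 jac_t0] : exists t, jac D t != 0.
  have [m [a [t [_ _ ew]]]] := form_w; apply: contrapT => none.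
  move: wD; rewrite ew // big1 ?eqxx // => l _.
  have [jl|jl] := eqVneq (jac D (t l)) 0; first by rewrite -[\det _]/(jac D (t l)) jl mulr0.
  by case: none; exists (t l).
have [phi [phi1 phi2 phi3 phi4 [U1 [f1 [oU1 nU1 Lf1 phif1]]]]] :=
  quasi_split_last charK val_X Delta_ge0 split_n min_n.
pose E (x : X) := (p ^ n)%:R * Delta x.
have E_ge0 x : 0 <= E x by rewrite mulr_ge0.
have [Phi [PhiD PhiZ Phi_loc]] :=
  phi_global (E := E) (ltnW q_gt1) val_X E_ge0 phi2 phi3 phi4.
have [g hg] := CT_repr charK hb jac_t0 PhiD PhiZ.
have Phi0 : Phi 0 = 0 by apply: (addrI (Phi 0)); rewrite -PhiD !addr0.
have g0 : g != 0.
  apply: contraNneq phif1 => g0; rewrite -(Phi_loc _ _ oU1 nU1 Lf1) hg g0 mul0r.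
  by rewrite -[X in iter _ _ X](mul0r 0) -{1}g0 -hg Phi0.
(* The factor p^n - 1 clears the denominator in the divisor. [CT] refers to the form with value 1 at
   [D], which is w / w(D); passing to w multiplies g by w(D)^(p^n - 1). *)
exists (p ^ n).-1; split; first by rewrite -ltnS prednK // ltnW.
exists (g * w D ^+ (p ^ n).-1); rewrite mulf_neq0 ?expf_neq0 //; split=> // _ x _ dx.
have vx := val_X x dx; have hO := stalk_subring x.
set m := Num.floor ((p ^ n)%:R * Delta x).
have -> : (p ^ n).-1%:R * - ((KX x)%:~R + ((p ^ n)%:R - 1)^-1 * m%:~R)
    = (- (KX x *+ (p ^ n).-1 + m))%:~R :> rat.
  have -> : (p ^ n)%:R - 1 = (p ^ n).-1%:R :> rat by rewrite -subn1 (natrB _ (ltnW q_gt1)).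
  by rewrite mul_addV_int // -ltnS prednK // (ltnW q_gt1).
rewrite intrKfloor (ordM vx) ?expf_neq0 // (ordX vx) //.
have [t [xt jt ojt]] := local_coordinates vx (ord_w x dx) hD wD.
have [s hs dec] := vx; have [s0 _ _ _] := hs.
(* At x the sheaf O_X(p^n Delta) is generated by s^(-m); moving this generator into h leaves a map
   that preserves the local ring. *)
pose h := g * s ^ (- m); have sm0 : s ^ (- m) != 0 by apply: expfz_neq0.
have osm : ord x (s ^ (- m)) = - m by rewrite -[s ^ _]mul1r (ordP hs) //; apply: unit1.
have CTt : CT charK D t0 = CT charK D t by apply/funext/CT_indep.
have loc f : stalk x f -> stalk x (iter n (CT charK D t) (h * f)).
  move=> xf; have -> : h * f = g * (s ^ (- m) * f) by rewrite /h mulrA.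
  rewrite -CTt -hg; have [->|f0] := eqVneq f 0.
    by rewrite mulr0 Phi0; apply: subring0.
  have [U [N [y [Ux hUy]]]] := projective_chart x projective_X.
  have [||V [oV Vx LV]] := div_sec_local val_X (E := E) hUy Ux dx E_ge0 (f := s ^ (- m) * f).
  - by rewrite mulf_neq0.
  - rewrite (ordM vx) // osm addrAC addNr add0r; exact/(ord_ge0 vx f0).
  have nV : V !=set0 by exists x.
  by rewrite (Phi_loc _ _ oV nV LV); exists V; split=> //; apply: phi1.
have := iter_CT_integral hb jt hO xt loc.
move=> /(ord_ge0 vx); rewrite /h !mulf_neq0 ?expf_neq0 // => /(_ isT).
rewrite !(ordM vx) ?mulf_neq0 ?expf_neq0 // (ordX vx) // osm => hge.
(* In other words, dt = ([jac D t] / w(D)) w has order at most 0 at x. *)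
have le_jac : ord x (jac D t) *+ (p ^ n).-1 <= (ord x (w D) - KX x) *+ (p ^ n).-1.
  by apply: ler_wMn2r.
apply: (le_trans hge); move: le_jac; rewrite mulrnBl.
set a := ord x (jac D t) *+ _; set b := ord x (w D) *+ _; set c := KX x *+ _ => ab.
have -> : ord x g + b - (c + m) = ord x g - m + (b - c) by ring.
by rewrite lerD2l.
Qed.
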